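(* Let $K_n$ be the complete graph on $n$ vertices whose edge weights are i.i.d. copies of a nonnegative random variable $W$ whose probability distribution has density $1$ at $0$. For any number $m=m(n)$ of terminal vertices with $2\le m\le n$, let $T$ be a set of $m$ terminal vertices of $K_n$ and let $r$ be a pre-specified root vertex of $K_n$. Let $S$ be the minimum weight of a Steiner tree for $T$, let $D_k$ be the minimum weight of a Steiner tree for $T$ of depth at most $k$ from $r$, and let $E_{2k}$ be the minimum weight of a Steiner tree for $T$ of diameter at most $2k$. If $$k\ge \log_2\log n+\omega\!\left(\frac{n}{m\log(en/m)}\right),$$ then, as $n\to\infty$, $$\frac{D_k}{S}\to 1\quad\text{and}\quad\frac{E_{2k}}{S}\to 1$$ in probability, and if the expected edge weight $\mathbb{E}[W]$ is finite, this convergence holds in expectation too.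
   Context: $\log$ is the natural logarithm and $\log_2$ the base-2 logarithm. Here $k=k(n)$, and $\omega(g(n))$ denotes any quantity $\Delta(n)$ with $\Delta(n)/g(n)\to\infty$ as $n\to\infty$, however slowly. ''Density $1$ at $0$'' means $\Pr[W<t]=t+o(t)$ for positive $t$ near $0$. A Steiner tree for $T$ is a subtree of $K_n$ containing all vertices of $T$; it may or may not contain other vertices. The weight of a tree is the sum of its edge weights. A tree has depth at most $k$ from $r$ if it is rooted at $r$ and every vertex of the tree is within distance $k$ (number of edges along the tree) of $r$. The diameter of a tree is the maximum number of edges on a tree path between two of its vertices.
   Formalization: The claims about D_k are made under the condition that m tends to infinity along those n for which r is not a terminal; without it they fail (for m=2, r not in T, k=n, the ratio D_k/S tends to 2). The claims about E_2k are unrestricted. *)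

(* Defs.v *)
From HB Require Import structures.
From mathcomp Require Import all_boot all_order all_algebra.
From mathcomp Require Import all_classical all_reals all_analysis.
Set Implicit Arguments.
Unset Strict Implicit.
Unset Printing Implicit Defensive.
Import Order.TTheory GRing.Theory Num.Theory.
Import numFieldNormedType.Exports.
Local Open Scope classical_set_scope.
Local Open Scope ring_scope.

(* The edges of the complete graph on V. *)
Definition edge (V : finType) : finType := {e : {set V} | #|e| == 2%N}.

(* A pair of a set of vertices and a set of edges; it is a subgraph of the
   complete graph when the edges have their ends in the vertex set. *)
Definition graph (V : finType) : Type := ({set V} * {set edge V})%type.

Section Trees.
Variable V : finType.
Implicit Types (G : graph V) (T : {set V}) (r x y : V) (k : nat).

(* Since an edge has exactly two ends, adj is irreflexive. *)
Definition adj G : rel V :=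
  fun x y => [exists e in G.2, val e == [set x; y]%SET].

Definition is_subgraph G : Prop :=
  forall e, e \in G.2 -> val e \subset G.1.

Definition is_connected G : Prop :=
  (exists x, x \in G.1) /\ {in G.1 &, forall x y, connect (adj G) x y}.

(* ucycle also accepts [:: x; y] for an edge xy, which is not a cycle. *)
Definition is_acyclic G : Prop :=
  forall c : seq V, ucycle (adj G) c -> (size c <= 2)%N.

Definition is_tree G : Prop :=
  [/\ is_subgraph G, is_connected G & is_acyclic G].

Definition steiner_tree T G : Prop := is_tree G /\ T \subset G.1.

Definition dist_le G k x y : Prop :=
  exists p : seq V, [/\ path (adj G) x p, last x p = y & (size p <= k)%N].

Definition depth_le G r k : Prop :=
  r \in G.1 /\ {in G.1, forall x, dist_le G k r x}.

Definition diameter_le G k : Prop :=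
  forall x (p : seq V),
    x \in G.1 -> path (adj G) x p -> uniq (x :: p) -> (size p <= k)%N.

Variables (R : realType) (w : edge V -> R).

Definition weight G : R := \sum_(e in G.2) w e.

(* There are finitely many graphs on V, so the infimum is attained whenever
   some G satisfies Q; it is 0 otherwise (e.g. when the depth bound is 0). *)
Definition min_weight (Q : graph V -> Prop) : R :=
  inf [set weight G | G in [set G | Q G]].

Definition steiner_min T : R := min_weight (steiner_tree T).

Definition steiner_depth_min T r k : R :=
  min_weight (fun G => steiner_tree T G /\ depth_le G r k).

Definition steiner_diam_min T k : R :=
  min_weight (fun G => steiner_tree T G /\ diameter_le G k).

End Trees.

Section Probability.
Variables (R : realType) (d : measure_display) (Omega : measurableType d).
Variable P : probability Omega R.

Definition mutually_independent (I : finType) (X : I -> {RV P >-> R}) : Prop :=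
  forall (J : {set I}) (A : I -> set R), (forall i, measurable (A i)) ->
    P [set x | forall i, i \in J -> A i (X i x)]
    = (\prod_(i in J) P (X i @^-1` A i))%E.

Definition density1_at0 (W : {RV P >-> R}) : Prop :=
  (fun t : R => fine (P [set x | W x < t]) - t) =o_ ((0 : R)^'+) (fun t : R => t).

End Probability.

(* Measures are total functions on sets, with unspecified values outside the
   sigma-algebra, so laws are compared on measurable sets only. *)
Definition same_law (R : realType) (d d' : measure_display)
    (Omega : measurableType d) (Omega' : measurableType d')
    (P : probability Omega R) (P' : probability Omega' R)
    (X : {RV P >-> R}) (Y : {RV P' >-> R}) : Prop :=
  forall A : set R, measurable A -> distribution P X A = distribution P' Y A.

(* The probability spaces may vary with n. *)
Section Convergence.
Variables (R : realType) (d : nat -> measure_display).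
Variable Omega : forall n, measurableType (d n).
Variable P : forall n, probability (Omega n) R.

Definition cvg_in_probability (X : forall n, Omega n -> R) (l : R) : Prop :=
  forall eps : R, 0 < eps ->
    P n [set x | eps <= `|X n x - l|] @[n --> \oo] --> 0%E.

Definition cvg_in_expectation (X : forall n, Omega n -> R) (l : R) : Prop :=
  ('E_(P n)[X n])%E @[n --> \oo] --> l%:E.

End Convergence.

(* Main.v *)
(* Write n for the number of vertices, a = m ln (en/m) and h = n/a.

   With probability 1 - O(n^-10) the weighted graph is an expander: there is a
   light edge between any two disjoint vertex sets, the bound depending on their
   sizes only.  In an expander a core Q of n/h^O(1) vertices with total cost
   o(a/n) grows from the root in about log_2 log n levels, because a level of
   size s can be followed by one of size about sqrt(n s); every vertex is then
   joined to Q by O(log h) further edges, and the sum of the joining costs over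
   all vertices of a Steiner tree is O(1).  Take an optimal Steiner tree, cut it at
   the levels congruent to j modulo D', where D' is a constant fraction of Delta,
   and join the cut vertices to Q: for the best j this costs O(1)/D', which is
   o(a/n) as Delta/h tends to infinity, and the depth is at most k.

   Conversely a union bound over trees, encoded by parent functions, shows that
   the minimum Steiner tree weighs at least a constant times a/n, and that a tree
   with N >= 11 a edges weighs at least a constant times N/n, so that the ratio is
   1 + o(1) outside an event of probability O(n^-10).  When m is so small that the
   former union bound fails, k exceeds the size of every light tree and no cutting
   is needed.  A root that is not a terminal is joined to one at cost O(ln n / n),
   which is negligible as m tends to infinity.

   For the convergence of the means, a ratio of at least u forces either four
   edges lighter than 2 u^(-1/2) or, for some terminal, four disjoint two-edge
   paths from the root that all weigh at least u^(1/2)/n; this has probability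
   O(n^8 u^-2).  The diameter version is squeezed between S and D_k for a root
   in T. *)
Require Import Defs.
From HB Require Import structures.
From mathcomp Require Import all_boot all_order all_algebra.
From mathcomp Require Import all_classical all_reals all_analysis.
From mathcomp Require Import measurable_realfun zify ring lra.
Set Implicit Arguments.
Unset Strict Implicit.
Unset Printing Implicit Defensive.
Import Order.TTheory GRing.Theory Num.Theory.
Import numFieldNormedType.Exports.
Local Open Scope classical_set_scope.
Local Open Scope ring_scope.

(** * Binomial coefficients and logarithms *)

Section RealBounds.
Context {R : realType}.
Implicit Types (x y z N : R) (n k : nat).

(** The joining costs shape the proof. With [lam] of order [ln h], the bound for joining a vertex is
    of order [lam ^ 2 / n], from about [lam] edges of weight [O(lam / n)]; the total over a tree is
    [O(1)] only if the tree has [O(n / lam ^ 2)] vertices. The core itself secures this: joining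
    just the terminals to it shows that the Steiner minimum is [O(1 / lam ^ 2)], and long trees
    weigh a constant times their number of edges over [n]. Exceptional vertices are sorted by scales
    [4 ^ i / n]. One hop leaves about [n / 4 ^ i] of them at scale [i], and the costs would diverge
    logarithmically; two hops leave [n / 8 ^ i].

    Joining the root to a terminal by the expander bound alone would cost about [ln n / n] at each
    of about [ln n] steps, since that bound charges for all sets of a given size. The bound
    [O(ln n / n)] comes from charging only for sets explored by light trees.

    The failure probability [n ^ -10] and the tail [n ^ 8 u ^ -2] leave room to truncate the ratio
    at [u = n ^ 9], with errors of order [1 / n] in the mean. *)

Lemma pow_div_fact_le_expR z k : 0 <= z -> z ^+ k / k`!%:R <= expR z.
Proof.
move=> z0; case: k => [|k].
  by rewrite expr0 fact0 divr1 -expR0 ler_expR.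
by apply: le_trans (expR_ge1Dxn k z0); rewrite lerDr.
Qed.

Lemma ln_le_subr1 x : 0 < x -> ln x <= x - 1.
Proof.
move=> x0; have := expR_ge1Dx (ln x); rewrite lnK ?posrE//; lra.
Qed.

Lemma expR1_gt2 : 2 < expR 1 :> R.
Proof. by have := @expR_gt1Dx R 1 (oner_neq0 _); rewrite -natr1. Qed.

Lemma ln2_gt_half : 1 / 2 < ln 2 :> R.
Proof.
have h : - ln 2 != 0 :> R by rewrite oppr_eq0 gt_eqF// ln_gt0// ltr1n.
have := expR_gt1Dx h; rewrite expRN lnK ?posrE//; lra.
Qed.

(* [phi n m / n] is the order of magnitude of the minimum Steiner tree on [m] terminals. *)
Definition phi (N x : R) : R := x * ln (expR 1 * N / x).

Lemma phi_lnE N x : 0 < N -> 0 < x -> phi N x = x * (1 + ln (N / x)).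
Proof.
move=> N0 x0; rewrite /phi -mulrA lnM ?posrE ?expR_gt0 ?divr_gt0//.
by rewrite expRK.
Qed.

Lemma ln_e_ge1 N x : 0 < x -> x <= N -> 1 <= ln (expR 1 * N / x).
Proof.
move=> x0 xn; have N0 : 0 < N by apply: lt_le_trans xn.
rewrite -mulrA lnM ?posrE ?expR_gt0 ?divr_gt0// expRK lerDl ln_ge0//.
by rewrite ler_pdivlMr// mul1r.
Qed.

Lemma phi_ge N x : 0 < x -> x <= N -> x <= phi N x.
Proof. by move=> x0 xn; rewrite /phi ler_peMr ?ln_e_ge1// ltW. Qed.

Lemma phi_le N x : 0 < N -> 0 < x -> phi N x <= N.
Proof.
move=> N0 x0; rewrite phi_lnE//.
have := ln_le_subr1 (divr_gt0 N0 x0) => h.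
have {2}-> : N = x * (1 + (N / x - 1)) by field; rewrite gt_eqF.
by rewrite ler_pM2l// lerD2l.
Qed.

Lemma phi_homo N x y : 0 < x -> x <= y -> y <= N -> phi N x <= phi N y.
Proof.
move=> x0 xy yn.
have y0 : 0 < y by apply: lt_le_trans xy.
have N0 : 0 < N by apply: lt_le_trans yn.
rewrite !phi_lnE//.
have -> : N / x = (N / y) * (y / x) by field; rewrite !gt_eqF.
rewrite lnM ?posrE ?divr_gt0//.
have h1 : 0 <= ln (N / y) by rewrite ln_ge0// ler_pdivlMr// mul1r.
have h2 : x * ln (y / x) <= y - x.
  have -> : y - x = x * (y / x - 1) by field; rewrite gt_eqF.
  by rewrite ler_pM2l// ln_le_subr1 ?divr_gt0.
have : x * ln (N / y) <= y * ln (N / y) by rewrite ler_wpM2r.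
lra.
Qed.

Lemma phi_gt0 N x : 0 < x -> x <= N -> 0 < phi N x.
Proof. by move=> x0 xn; apply: lt_le_trans (phi_ge x0 xn). Qed.

Lemma phi_double N x : 0 < N -> 0 < x -> phi N (2 * x) <= 2 * phi N x.
Proof.
move=> N0 x0; rewrite !phi_lnE// ?mulr_gt0// -mulrA ler_pM2l// ler_pM2l// lerD2l.
by rewrite ler_ln ?posrE ?divr_gt0 ?mulr_gt0// ler_pM2l// lef_pV2 ?posrE ?mulr_gt0//; lra.
Qed.

Lemma ln_le_phi N x : 1 <= x -> x <= N -> ln N <= phi N x.
Proof.
move=> x1 xn; have N0 : 0 < N by lra.
have := phi_homo ltr01 x1 xn; rewrite phi_lnE// divr1; lra.
Qed.

(** The entropy of a [k]-subset plus [ln n]: an event of probability [expR (- c * lnbin n k)] with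
    [c > 1] survives the union bound over all [k]-subsets with a power of [n] to spare. *)
Definition lnbin (n k : nat) : R := ln (n%:R * 'C(n, k)%:R).

Lemma bin_le_pow_div_fact n k : 'C(n, k)%:R <= n%:R ^+ k / k`!%:R :> R.
Proof.
rewrite ler_pdivlMr ?ltr0n ?fact_gt0// -natrM bin_ffact -natrX ler_nat.
elim: k n => [|k IH] [|n]; rewrite ?ffactn0 ?expn0 ?ffact0n//.
rewrite ffactSS expnS leq_mul//; apply: (leq_trans (IH n)).
by case: k {IH} => // k; rewrite leq_exp2r.
Qed.

Lemma bin_le_expR_phi n k : (0 < k)%N -> 'C(n, k)%:R <= expR (phi n%:R k%:R) :> R.
Proof.
move=> k0; have kR : 0 < k%:R :> R by rewrite ltr0n.
case: (posnP n) => [->|n0]; first by rewrite bin0n gtn_eqF// ?ltW ?expR_gt0.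
have nR : 0 < n%:R :> R by rewrite ltr0n.
apply: le_trans (bin_le_pow_div_fact _ _) _.
rewrite /phi expRM_natl lnK; last by rewrite posrE !mulr_gt0 ?invr_gt0 ?expR_gt0.
rewrite -mulrA mulrC exprMn -expRM_natl mulr1 exprMn exprVn.
have h := pow_div_fact_le_expR k (ltW kR).
have -> : k`!%:R^-1 * n%:R ^+ k = (k%:R ^+ k / k`!%:R) * (n%:R ^+ k / k%:R ^+ k) :> R.
  by field; rewrite expf_neq0 ?gt_eqF ?ltr0n ?fact_gt0.
by rewrite ler_wpM2r// divr_ge0 ?exprn_ge0 ?ltW.
Qed.

Lemma lnbin_ge0 n k : (0 < n)%N -> (k <= n)%N -> 0 <= lnbin n k.
Proof.
by move=> n0 kn; rewrite ln_ge0// -natrM ler1n muln_gt0 n0 bin_gt0.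
Qed.

Lemma lnbinE n k : (0 < n)%N -> (k <= n)%N -> lnbin n k = ln n%:R + ln 'C(n, k)%:R.
Proof.
by move=> n0 kn; rewrite /lnbin lnM// posrE ltr0n// bin_gt0.
Qed.

Lemma lnbin_le_phi n k : (0 < k <= n)%N -> lnbin n k <= 2 * phi n%:R k%:R.
Proof.
case/andP=> k0 kn; have n0 := leq_trans k0 kn.
rewrite lnbinE//.
have h1 : ln n%:R <= phi n%:R k%:R :> R by rewrite ln_le_phi ?ler1n ?ler_nat.
have h2 : ln 'C(n, k)%:R <= phi n%:R k%:R :> R.
  by rewrite -ler_expR lnK ?posrE ?ltr0n ?bin_gt0// bin_le_expR_phi.
lra.
Qed.

Lemma lnbin_sub n k : (k <= n)%N -> lnbin n (n - k) = lnbin n k.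
Proof. by move=> kn; rewrite /lnbin bin_sub. Qed.

(** A set and its complement have the same entropy, so the large side of a cut is no more expensive
    than the small one. The upper bound [x >= 1] of [k] also covers [k = 0], where [ln n]
    remains. *)
Lemma lnbin_compl_le_phi n k x : (0 < n)%N -> (k <= n)%N -> k%:R <= x -> 1 <= x -> x <= n%:R ->
  lnbin n (n - k) <= 2 * phi n%:R x.
Proof.
move=> n0 kn kx x1 xn; rewrite lnbin_sub//.
case: (posnP k) => [k0|k0].
  rewrite k0 lnbinE// bin0 ln1 addr0.
  have := ln_le_phi x1 xn; have := phi_ge (lt_le_trans ltr01 x1) xn; lra.
apply: le_trans (lnbin_le_phi _) _; first by rewrite k0.
by rewrite ler_pM2l// phi_homo ?ltr0n.
Qed.

Lemma bin_le_2n n k : ('C(n, k) <= 2 ^ n)%N.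
Proof.
case: (leqP k n) => [kn|nk]; last by rewrite bin_small.
have := expnDn 1 1 n; rewrite addn1 => ->.
have kn1 : (k < n.+1)%N by rewrite ltnS.
by rewrite (bigD1 (Ordinal kn1)) //= !exp1n !muln1 leq_addr.
Qed.

Lemma lnbin_le n k : (0 < n)%N -> (k <= n)%N -> lnbin n k <= 2 * n%:R.
Proof.
move=> n0 kn; rewrite lnbinE//.
have nR : 0 < n%:R :> R by rewrite ltr0n.
have h1 := ln_le_subr1 nR.
have h2 : ln 'C(n, k)%:R <= n%:R :> R.
  rewrite -ler_expR lnK ?posrE ?ltr0n ?bin_gt0//.
  apply: (@le_trans _ _ (2 ^+ n)); first by rewrite -natrX ler_nat bin_le_2n.
  by rewrite -[n%:R]mulr1 expRM_natl lerXn2r ?nnegrE ?ltW ?expR_gt0 ?expR1_gt2.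
lra.
Qed.
End RealBounds.

(** * Trees and breadth-first search *)

Section Graphs.
Variable V : finType.
Implicit Types (G : graph V) (T U : {set V}) (r x y v : V) (F : {set edge V}).

Definition nbr F : rel V := adj (finset.setT, F).
Definition reach F (i : nat) x y : Prop := dist_le (finset.setT, F) i x y.

Lemma reach0 F x : reach F 0 x x.
Proof. by exists [::]. Qed.

Lemma reach_cat F i j x y z : reach F i x y -> reach F j y z -> reach F (i + j) x z.
Proof.
case=> p [pp lp sp] [q [pq lq sq]]; exists (p ++ q); split.
- by rewrite cat_path pp lp.
- by rewrite last_cat lp.
- by rewrite size_cat leq_add.
Qed.

Lemma reach_nbr F x y : nbr F x y -> reach F 1 x y.
Proof. by move=> h; exists [:: y]; split=> //=; rewrite andbT. Qed.

Lemma reach_mono F F' i j x y : F \subset F' -> (i <= j)%N -> reach F i x y -> reach F' j x y.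
Proof.
move=> sF ij [p [pp lp sp]]; exists p; split=> //; last exact: leq_trans ij.
apply: sub_path pp => a b /existsP[e /andP[eF ev]]; apply/existsP; exists e.
by rewrite ev (fintype.subsetP sF).
Qed.

Lemma nbr_sym F : symmetric (nbr F).
Proof. by move=> x y; rewrite /nbr /adj; apply: eq_existsb => e; rewrite finset.setUC. Qed.

Lemma reach_sym F i x y : reach F i x y -> reach F i y x.
Proof.
case=> p [pp lp sp]; exists (rev (belast x p)); split.
- by rewrite -lp rev_path; apply: sub_path pp => a b; have := nbr_sym F a b; rewrite /nbr => ->.
- by case: p pp lp sp => [|a p] //= _ <- _; rewrite rev_cons last_rcons.
- by rewrite size_rev size_belast.
Qed.

Lemma set2_cases x y z t : z != t -> [set x; y]%SET = [set z; t]%SET ->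
  (x = z /\ y = t) \/ (x = t /\ y = z).
Proof.
move=> zt E.
have hz : z \in [set x; y]%SET by rewrite E set21.
have ht : t \in [set x; y]%SET by rewrite E set22.
move: hz ht; rewrite !inE => /orP[]/eqP ez /orP[]/eqP et; auto.
- by rewrite ez et eqxx in zt.
- by rewrite ez et eqxx in zt.
Qed.

Lemma bfs_parent F r : exists (par : V -> V) (dep : V -> nat), dep r = 0%N /\
  forall v i, reach F i r v ->
    [/\ (dep v <= i)%N, reach F (dep v) r v &
        v != r -> nbr F (par v) v /\ dep v = (dep (par v)).+1].
Proof.
pose Q v i := `[< reach F i r v >].
have /boolp.choice[dep depP] : forall v, exists d, forall i, reach F i r v ->
    (d <= i)%N /\ reach F d r v.
  move=> v.
  have [[i ri]|h] := pselect (exists i, reach F i r v); last first.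
    by exists 0%N => i ri; exfalso; apply: h; exists i.
  have ex : exists i, Q v i by exists i; apply/asboolP.
  have [m /asboolP rm mmin] := ex_minnP ex.
  by exists m => j rj; split=> //; apply: mmin; apply/asboolP.
have /boolp.choice[par parP] : forall v, exists y, v != r -> (exists i, reach F i r v) ->
    nbr F y v /\ dep v = (dep y).+1.
  move=> v.
  have [[i ri]|h] := pselect (exists i, reach F i r v); last by exists v.
  have [_ [p [pp lp sp]]] := depP _ _ ri.
  case: (lastP p) pp lp sp => [|q y] /=.
    by move=> _ <-; exists r; rewrite eqxx.
  rewrite rcons_path last_rcons size_rcons => /andP[pq ny] yv sq; subst y.
  exists (last r q) => _ _; split=> //.
  have rq : reach F (size q) r (last r q) by exists q.
  have [d1 rd] := depP _ _ rq.
  apply/eqP; rewrite eqn_leq (leq_ltn_trans d1 sq) andbT.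
  rewrite -addn1; apply: (proj1 (depP v _ _)).
  by apply: reach_cat rd _; apply: reach_nbr.
exists par, dep; split.
  by apply/eqP; rewrite -leqn0; exact: (proj1 (depP _ _ (reach0 F r))).
move=> v i ri; have [? ?] := depP _ _ ri; split=> // vr.
by apply: parP => //; exists i.
Qed.

Lemma adj_in G x y : is_subgraph G -> adj G x y -> x \in G.1 /\ y \in G.1.
Proof.
move=> sG /existsP[e /andP[eG /eqP ev]]; have := sG e eG; rewrite ev => /fintype.subsetP h.
by split; apply: h; rewrite ?set21 ?set22.
Qed.

Section ParentTree.
Variables (U : {set V}) (r : V) (par : V -> V) (dep : V -> nat) (F : {set edge V}).
Hypothesis rU : r \in U.
Hypothesis dep_r : dep r = 0%N.
Hypothesis parU : forall v, v \in U -> v != r -> par v \in U /\ dep v = (dep (par v)).+1.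
Hypothesis F_par : forall e, e \in F -> exists v, [/\ v \in U, v != r & val e = [set v; par v]%SET].
Hypothesis par_F : forall v, v \in U -> v != r -> exists2 e, e \in F & val e = [set v; par v]%SET.

Lemma par_neq v : v \in U -> v != r -> v != par v.
Proof.
move=> vU vr; apply/eqP => E; have [_] := parU vU vr; rewrite -E => /eqP.
by rewrite eqn_leq ltnn andbF.
Qed.

Lemma adj_par x y : adj (U, F) x y ->
  [/\ x \in U, x != r & y = par x] \/ [/\ y \in U, y != r & x = par y].
Proof.
move=> /existsP[e /andP[eF /eqP ev]]; have [v [vU vr]] := F_par eF.
rewrite ev => /(set2_cases (par_neq vU vr))[[-> ->]|[-> ->]]; [left|right]; by split.
Qed.

Lemma par_adj v : v \in U -> v != r -> adj (U, F) (par v) v.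
Proof.
move=> vU vr; have [e eF ev] := par_F vU vr; apply/existsP; exists e.
by rewrite eF ev finset.setUC eqxx.
Qed.

Lemma parent_dist v : v \in U -> dist_le (U, F) (dep v) r v.
Proof.
move E : (dep v) => d; elim: d v E => [|d IH] v dv vU.
  have [->|vr] := eqVneq v r; first by exists [::].
  by have [_] := parU vU vr; rewrite dv.
have vr : v != r by apply/eqP => vr; move: dv; rewrite vr dep_r.
have [pU] := parU vU vr; rewrite dv => -[/esym/IH/(_ pU)[p [pp lp sp]]].
exists (rcons p v); split; rewrite ?last_rcons ?size_rcons//.
by rewrite rcons_path pp lp par_adj.
Qed.

Lemma parent_tree : is_tree (U, F).
Proof.
split.
- move=> e /F_par[v [vU vr ->]]; have [pU _] := parU vU vr.
  by apply/fintype.subsetP => x; rewrite !inE => /orP[]/eqP->.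
- split; first by exists r.
  have cr v : v \in U -> connect (adj (U, F)) r v.
    by move=> vU; have [p [pp lp _]] := parent_dist vU; apply/connectP; exists p.
  have cs : connect_sym (adj (U, F)).
    by apply: sym_connect_sym => x y; exact: (nbr_sym F).
  by move=> x y xU yU; apply: connect_trans (cr y yU); rewrite cs cr.
- move=> c /andP[cc uc]; rewrite leqNgt; apply/negP => sc.
  (* A deepest vertex of the cycle has two distinct neighbours on it. Neither can be a child, which
     would be deeper, so both would be its parent. *)
  have [v0 v0c] : exists v, v \in c by case: c cc uc sc => // a c; exists a; rewrite inE eqxx.
  case: (arg_maxnP (fun v => dep v) v0c) => v vc vmax.
  have [i s Es] := rot_to vc.
  have cc' : cycle (adj (U, F)) (v :: s) by rewrite -Es rot_cycle.
  have uc' : uniq (v :: s) by rewrite -Es rot_uniq.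
  have sc' : (2 < size (v :: s))%N by rewrite -Es size_rot.
  have inc x : x \in v :: s -> x \in c by rewrite -Es mem_rot.
  case: s cc' uc' sc' inc {Es} => [|a s] //= cc' uc' sc' inc.
  case/lastP: s cc' uc' sc' inc => [|s b] //= cc' uc' sc' inc.
  move: cc' => /andP[va]; rewrite rcons_path last_rcons => /andP[_ bv].
  have dm x : x \in c -> (dep x <= dep v)%N by move=> xc; exact: vmax.
  have ac : a \in c by apply: inc; rewrite !inE eqxx orbT.
  have bc : b \in c by apply: inc; rewrite !inE mem_rcons inE eqxx !orbT.
  have up x : x \in c -> adj (U, F) v x -> x = par v.
    move=> xc /adj_par[[//]|[xU xr vx]]; have [_ dx] := parU xU xr.
    by have := dm x xc; rewrite dx -vx ltnn.
  have ap := up a ac va.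
  have bp : b = par v by apply: up => //; move: bv; exact: (etrans (nbr_sym F _ _)).
  by move: uc' => /and3P[_ + _]; rewrite ap bp mem_rcons inE eqxx.
Qed.
End ParentTree.

Lemma tree_parent G r : is_tree G -> r \in G.1 ->
  exists (par : V -> V) (dep : V -> nat), dep r = 0%N /\
  forall v, v \in G.1 -> (dep v <= #|G.1|.-1)%N /\
    (v != r -> [/\ par v \in G.1, adj G (par v) v & dep v = (dep (par v)).+1]).
Proof.
case=> sG [_ cG] _ rG; have [par [dep [d0 h]]] := bfs_parent G.2 r.
exists par, dep; split=> // v vG.
have rv : reach G.2 #|G.1|.-1 r v.
  have /connectP[p pp lp] := cG r v rG vG.
  case: (shortenP pp) lp => q pq uq _ lq; exists q; split=> //.
  have : {subset r :: q <= G.1}.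
    move=> x; rewrite inE => /orP[/eqP->//|].
    move=> xq; move: pq; elim: q (r) xq {uq lq rG} => // y q IH z.
    rewrite inE /= => /orP[/eqP->|xq] /andP[zy yq]; last exact: IH yq.
    by have [] := adj_in sG zy.
  move=> sub; have : (size (r :: q) <= #|G.1|)%N.
    rewrite -(card_uniqP uq); apply: subset_leq_card; exact/fintype.subsetP.
  by case: #|G.1|.
have [dv _ hv] := h _ _ rv; split=> // vr.
have [nv ->] := hv vr; split=> //.
by have [] := adj_in sG nv.
Qed.

End Graphs.

Section ParentPaths.
Variables (V : finType) (U : {set V}) (r : V) (par : V -> V) (dep : V -> nat) (F : {set edge V}).
Hypothesis parU : forall v, v \in U -> v != r -> par v \in U /\ dep v = (dep (par v)).+1.
Hypothesis F_par : forall e, e \in F -> exists v, [/\ v \in U, v != r & val e = [set v; par v]%SET].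

(** A path that has started to descend cannot turn: the next step upwards would lead back to the
    parent it came from. *)
Lemma simple_path_down x a p : path (adj (U, F)) x (a :: p) -> uniq [:: x, a & p] ->
  a \in U -> a != r -> x = par a -> (dep (last a p) = dep x + (size p).+1)%N.
Proof.
elim: p x a => [|b p IH] x a.
  by move=> _ _ aU ar xE; have [_] := parU aU ar; rewrite /= -xE addn1.
move=> /= /andP[_ /andP[ab bp]] /andP[xn /andP[an ub]] aU ar xE.
have [_ da] := parU aU ar; rewrite -xE in da.
have [[_ _ bE]|[bU br aE]] := adj_par parU F_par ab.
  by move: xn; rewrite !inE xE bE eqxx orbT.
rewrite (IH a b)//=; first by rewrite da addSnnS.
- by rewrite ab.
- by rewrite an.
Qed.

(** A simple path climbs and then only descends, so its two halves are bounded by the depths of its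
    ends. *)
Lemma simple_path_size x p : path (adj (U, F)) x p -> uniq (x :: p) ->
  (size p <= dep x + dep (last x p))%N.
Proof.
elim: p x => [//|a p IH] x pp up.
move: (pp) => /= /andP[xa ap].
have [[xU xr aE]|[aU ar xE]] := adj_par parU F_par xa.
  have [_ ->] := parU xU xr; rewrite -aE addSn ltnS IH//.
  by move: up => /= /andP[].
by rewrite (simple_path_down pp up aU ar xE) addnA leq_addl.
Qed.
End ParentPaths.

(** * Weights, optimal trees and shallow trees *)

Section Weights.
Variables (V : finType) (R : realType) (w : edge V -> R) (e0 : edge V).
Hypothesis w_ge0 : forall e, 0 <= w e.
Implicit Types (G : graph V) (T U : {set V}) (r x y v : V) (F : {set edge V}).

Definition eg x y : edge V := insubd e0 [set x; y]%SET.

Lemma val_eg x y : x != y -> val (eg x y) = [set x; y]%SET.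
Proof. by move=> xy; rewrite insubdK// unfold_in cards2 xy. Qed.

Lemma egC x y : eg x y = eg y x.
Proof. by rewrite /eg finset.setUC. Qed.

Lemma eg_eq x y (e : edge V) : val e = [set x; y]%SET -> e = eg x y.
Proof. by move=> h; rewrite /eg -h valKd. Qed.

Lemma edge_neq x y (e : edge V) : val e = [set x; y]%SET -> x != y.
Proof.
by move=> h; have := valP e; rewrite /= h cards2; case: (x != y).
Qed.

Lemma nbrE F x y : nbr F x y = (x != y) && (eg x y \in F).
Proof.
apply/existsP/andP => [[e /andP[eF /eqP ev]]|[xy eF]].
  by rewrite -(eg_eq ev) (edge_neq ev).
by exists (eg x y); rewrite eF val_eg ?eqxx.
Qed.

Lemma eg_inj x y x' y' : x != y -> x' != y' -> eg x y = eg x' y' ->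
  (x = x' /\ y = y') \/ (x = y' /\ y = x').
Proof.
move=> xy xy' /(congr1 val); rewrite !val_eg// => h.
exact: set2_cases h.
Qed.

Definition wt F : R := \sum_(e in F) w e.

Lemma wt_ge0 F : 0 <= wt F.
Proof. by apply: sumr_ge0. Qed.

Lemma wt_sub F F' : F \subset F' -> wt F <= wt F'.
Proof.
move=> sF; rewrite /wt [leRHS](big_setID F)/= (finset.setIidPr sF) lerDl.
by apply: sumr_ge0.
Qed.

Lemma wtU F F' : wt (F :|: F') <= wt F + wt F'.
Proof.
rewrite /wt (big_setID F)/= finset.setUK lerD2l finset.setDUl finset.setDv finset.set0U.
exact/wt_sub/subsetDl.
Qed.

Lemma wt0 : wt finset.set0 = 0.
Proof. by rewrite /wt big_set0. Qed.

Lemma wt1 e : wt [set e]%SET = w e.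
Proof. by rewrite /wt big_set1. Qed.

Lemma wt_bigcup (I : finType) (A : {set I}) (f : I -> {set edge V}) :
  wt (\bigcup_(i in A) f i)%SET <= \sum_(i in A) wt (f i).
Proof.
apply: (big_ind2 (fun F (c : R) => wt F <= c)) => //; first by rewrite wt0.
by move=> F c F' c' h h'; apply: le_trans (wtU _ _) (lerD h h').
Qed.

Lemma min_weight_le (Q : graph V -> Prop) G : Q G -> min_weight w Q <= weight w G.
Proof.
move=> QG; apply: ge_inf; last by exists G.
by exists 0 => _ [G' _ <-]; apply: wt_ge0.
Qed.

Lemma min_weight_attained (Q : graph V -> Prop) G0 : Q G0 ->
  exists2 G, Q G & min_weight w Q = weight w G.
Proof.
move=> QG0.
have h0 : (fun G : {set V} * {set edge V} => `[< Q G >]) G0 by apply/asboolP.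
case: (@Order.TotalTheory.arg_minP _ _ _ G0 (fun G : {set V} * {set edge V} => `[< Q G >]) (weight w) h0)
  => G /asboolP QG Gmin.
exists G => //; apply/eqP; rewrite eq_le min_weight_le//=.
apply: lb_le_inf; first by exists (weight w G); exists G.
by move=> _ [G' QG' <-]; apply: Gmin; apply/asboolP.
Qed.

(* Breadth-first search from [r] extracts the tree from the edge set. *)
Lemma bounded_tree T r k F : (forall t, t \in T -> reach F k r t) ->
  exists G, [/\ steiner_tree T G, depth_le G r k, diameter_le G (2 * k) & weight w G <= wt F].
Proof.
move=> hT; have [par [dep [d0 h]]] := bfs_parent F r.
pose U : {set V} := [set v | `[< reach F k r v >]]%SET.
have UP v : reflect (reach F k r v) (v \in U) by rewrite inE; apply: asboolP.
have dU v : v \in U -> (dep v <= k)%N by move=> /UP/h[].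
pose F' : {set edge V} := [set e in F | [exists v, [&& v \in U, v != r & val e == [set v; par v]]]]%SET.
have rU : r \in U by apply/UP; apply: reach_mono (reach0 F r).
have parU v : v \in U -> v != r -> par v \in U /\ dep v = (dep (par v)).+1.
  move=> /UP rv vr; have [dk rd /(_ vr)[nv dv]] := h _ _ rv; split=> //; apply/UP.
  have [p [pp lp sp]] := rd.
  have r1 : reach F (dep v).+1 r (par v).
    by rewrite -addn1; apply: reach_cat rd _; apply: reach_nbr; rewrite nbr_sym.
  have [_ rp _] := h _ _ r1; apply: reach_mono rp => //.
  by rewrite -ltnS -dv (leq_trans dk).
have F_par e : e \in F' -> exists v, [/\ v \in U, v != r & val e = [set v; par v]%SET].
  by rewrite inE => /andP[_ /existsP[v /and3P[? ? /eqP ?]]]; exists v.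
have par_F v : v \in U -> v != r -> exists2 e, e \in F' & val e = [set v; par v]%SET.
  move=> vU vr; have /UP rv := vU; have [_ _ /(_ vr)[nv _]] := h _ _ rv.
  move: nv => /existsP[e /andP[eF /eqP ev]]; exists e; last by rewrite ev finset.setUC.
  by rewrite inE eF; apply/existsP; exists v; rewrite vU vr ev finset.setUC eqxx.
exists (U, F'); split.
- split; first exact: (parent_tree rU d0 parU F_par par_F).
  by apply/fintype.subsetP => t /hT /UP.
- split=> // v vU; have [p [pp lp sp]] := parent_dist d0 parU par_F vU.
  by exists p; split=> //; apply: leq_trans (dU v vU).
- move=> x p xU pp up; apply: leq_trans (simple_path_size parU F_par pp up) _.
  rewrite mul2n -addnn leq_add// dU//.
  case/lastP: p pp {up} => [//|p y]; rewrite rcons_path last_rcons => /andP[_].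
  by move=> /(adj_par parU F_par)[[zU zr ->]|[]//]; have [] := parU _ zU zr.
- by apply: wt_sub; apply/fintype.subsetP => e; rewrite inE => /andP[].
Qed.

Lemma steiner_depth_le T r k F : (forall t, t \in T -> reach F k r t) ->
  steiner_depth_min w T r k <= wt F.
Proof.
by move=> /bounded_tree[G [h1 h2 _ h4]]; apply: le_trans h4; apply: min_weight_le.
Qed.

Lemma reach_all k r t : (0 < k)%N -> reach finset.setT k r t.
Proof.
move=> k0; have [->|rt] := eqVneq r t; first exact: reach_mono (subxx _) (leq0n k) (reach0 _ t).
have rt' : nbr finset.setT r t by rewrite nbrE rt finset.in_setT.
exact: reach_mono (subxx _) k0 (reach_nbr rt').
Qed.

Lemma steiner_opt T r : exists2 G, steiner_tree T G & steiner_min w T = weight w G.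
Proof.
have [G [h1 _ _ _]] := bounded_tree (fun t (_ : t \in T) => reach_all r t (ltnSn 0)).
exact: min_weight_attained h1.
Qed.

Lemma steiner_depth_opt T r k : (0 < k)%N ->
  exists G, [/\ steiner_tree T G, depth_le G r k & steiner_depth_min w T r k = weight w G].
Proof.
move=> k0; have [G [h1 h2 _ _]] := bounded_tree (fun t (_ : t \in T) => reach_all r t k0).
have [G' [? ?] ?] := @min_weight_attained (fun G => steiner_tree T G /\ depth_le G r k) _ (conj h1 h2).
by exists G'.
Qed.

Lemma steiner_min_le_diam T k : (0 < k)%N -> steiner_min w T <= steiner_diam_min w T (2 * k).
Proof.
move=> k0; case: (pickP (fun x : V => true)) => [r _|V0]; last first.
  have [x _] : exists x, x \in val e0 by apply/card_gt0P; rewrite (eqP (valP e0)).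
  by have := V0 x.
have [G [h1 h2 h3 _]] := bounded_tree (fun t (_ : t \in T) => reach_all r t k0).
have [G' [s1 s2] E] := @min_weight_attained (fun G => steiner_tree T G /\ diameter_le G (2 * k)) _ (conj h1 h3).
rewrite /steiner_diam_min E.
exact: min_weight_le.
Qed.

Lemma steiner_min_le_depth T r k : (0 < k)%N -> steiner_min w T <= steiner_depth_min w T r k.
Proof.
by move=> k0; have [G [s1 s2 ->]] := steiner_depth_opt T r k0; apply: min_weight_le.
Qed.

(** An optimal tree of depth at most [k] is replaced by a breadth-first tree of its edges, which is
    no heavier and whose simple paths have at most [k] edges on either side of their top vertex. *)
Lemma steiner_diam_le_depth T r k : (0 < k)%N ->
  steiner_diam_min w T (2 * k) <= steiner_depth_min w T r k.
Proof.
move=> k0; have [G [[_ /fintype.subsetP sT] [_ s2] ->]] := steiner_depth_opt T r k0.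
have hT t : t \in T -> reach G.2 k r t by move=> /sT /s2.
have [G' [h1 _ h3 h4]] := bounded_tree hT.
by apply: le_trans h4; apply: min_weight_le.
Qed.

(** Encodes a tree on [N.+1] vertices by a parent function with [N] distinct edges, the form needed
    for counting trees and for independence. Two vertices with the same parent edge would be parents
    of each other, against the depths. *)
Lemma tree_parent_weight G r : is_tree G -> r \in G.1 ->
  exists (par : V -> V) (dep : V -> nat),
    [/\ dep r = 0%N,
        forall v, v \in G.1 -> (dep v <= #|G.1|.-1)%N,
        forall v, v \in G.1 -> v != r ->
          [/\ par v \in G.1, v != par v, eg v (par v) \in G.2 & dep v = (dep (par v)).+1],
        {in G.1 :\ r &, injective (fun v => eg v (par v))} &
        \sum_(v in G.1 :\ r) w (eg v (par v)) <= weight w G].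
Proof.
move=> tG rG; have [par [dep [d0 h]]] := tree_parent tG rG.
have hp v : v \in G.1 -> v != r ->
  [/\ par v \in G.1, v != par v, eg v (par v) \in G.2 & dep v = (dep (par v)).+1].
  move=> vG vr; have [_ /(_ vr)[pG ad dv]] := h v vG.
  by have : nbr G.2 (par v) v by []; rewrite nbrE eq_sym egC => /andP[].
have inj : {in G.1 :\ r &, injective (fun v => eg v (par v))}.
  move=> v v'; rewrite !inE => /andP[vr vG] /andP[vr' vG'] E.
  have [_ n d d1] := hp v vG vr; have [_ n' d' d1'] := hp v' vG' vr'.
  have [[]//|[vE v'E]] := eg_inj n n' E.
  by move: d1 d1'; rewrite v'E -vE; lia.
exists par, dep; split=> //; first by move=> v /h[].
rewrite -(big_imset _ inj) /=; apply: wt_sub; apply/fintype.subsetP => e.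
by move=> /imsetP[v]; rewrite !inE => /andP[vr vG] ->; have [] := hp v vG vr.
Qed.

End Weights.

(** * The core *)

Section Expander.
Variables (V : finType) (R : realType) (e0 : edge V).
Implicit Types (A B Q U : {set V}) (F : {set edge V}) (x v r : V).

(** Stated contrapositively: a cut without edges lighter than [s] must be small. The right-hand side
    is the entropy of the two sides, and [t0] delimits the weights at which the law is under
    control. *)
Definition expander (CG t0 : R) (w : edge V -> R) : Prop :=
  forall A B (s : R), A != finset.set0 -> B != finset.set0 -> (forall a, a \in A -> a \notin B) ->
    0 <= s <= t0 -> (forall a b, a \in A -> b \in B -> s <= w (eg e0 a b)) ->
    s * #|A|%:R * #|B|%:R <= CG * (lnbin #|V| #|A| + lnbin #|V| #|B|).

Variables (CG t0 : R) (w : edge V -> R).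
Hypothesis CG1 : 1 <= CG :> R.
Hypothesis w_ge0 : forall e, 0 <= w e.
Hypothesis HG : expander CG t0 w.
Let n := #|V|.

Lemma CG_gt0 : 0 < CG.
Proof. exact: lt_le_trans ltr01 CG1. Qed.

Lemma card_le1n (v : V) : (0 < n)%N.
Proof. by apply/card_gt0P; exists v. Qed.

Definition joined Q (i : nat) (c : R) v : Prop :=
  exists F q, [/\ q \in Q, reach F i q v & wt w F <= c].

Lemma joined0 Q v : v \in Q -> joined Q 0 0 v.
Proof. by move=> vQ; exists finset.set0, v; split; rewrite ?wt0//; apply: reach0. Qed.

Lemma joined_mono Q i j c d v : (i <= j)%N -> c <= d -> joined Q i c v -> joined Q j d v.
Proof.
move=> ij cd [F [q [qQ rF wF]]]; exists F, q; split=> //; last exact: le_trans cd.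
exact: reach_mono rF.
Qed.

Lemma joined_step Q i c s x v : joined Q i c x -> w (eg e0 x v) <= s -> joined Q i.+1 (c + s) v.
Proof.
have [->|xv] := eqVneq x v => jx ws.
  by apply: joined_mono jx => //; rewrite lerDl (le_trans _ ws).
have [F [q [qQ rF wF]]] := jx; exists (F :|: [set eg e0 x v])%SET, q; split=> //.
  rewrite -addn1; apply: (reach_cat (y := x)).
    by apply: reach_mono rF; rewrite ?finset.subsetUl.
  by apply: reach_nbr; rewrite (nbrE e0) xv !inE eqxx orbT.
by apply: le_trans (wtU w_ge0 _ _) _; rewrite wt1 lerD.
Qed.

Lemma exists_subset_card A b : (b <= #|A|)%N -> exists2 B : {set V}, B \subset A & #|B| = b.
Proof.
move=> bA; exists [set x in take b (enum A)]%SET.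
  by apply/fintype.subsetP => x; rewrite inE => /mem_take; rewrite mem_enum.
rewrite cardsE; have /card_uniqP -> : uniq (take b (enum A)) by rewrite take_uniq ?enum_uniq.
by rewrite size_take -cardE; case: ltngtP bA => // ->.
Qed.

(** If fewer than [b] new vertices had an edge lighter than [t] from [A], all other vertices, at
    least [n / 2] of them, would be cut off from [A]. The entropies [2 * phi n b] and [4 * phi n b]
    of the two sides, doubled because of the factor [n / 2], give the constant 12. *)
Lemma growth A b (t : R) : (0 < #|A|)%N -> (#|A| <= b)%N -> (4 * b <= n)%N -> 0 <= t <= t0 ->
  12 * CG * phi n%:R b%:R < t * #|A|%:R * n%:R ->
  exists B : {set V}, #|B| = b /\ forall v, v \in B -> exists2 a, a \in A & w (eg e0 a v) < t.
Proof.
move=> A0 Ab bn t0t tA.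
have b0 : (0 < b)%N by apply: leq_trans Ab.
have n0 : (0 < n)%N by apply: leq_trans (leq_trans A0 Ab) (leq_trans _ bn); rewrite leq_pmull.
have nR : 0 < n%:R :> R by rewrite ltr0n.
have bR : 0 < b%:R :> R by rewrite ltr0n.
pose N := [set v | [exists a in A, w (eg e0 a v) < t]]%SET :\: A.
have [bN|Nb] := leqP b #|N|.
  have [B sB Bb] := exists_subset_card bN; exists B; split=> // v /(fintype.subsetP sB).
  by rewrite !inE => /andP[_ /existsP[a /andP[aA wa]]]; exists a.
exfalso; pose B := ~: (A :|: N)%SET.
have cAN : #|(A :|: N)%SET| = (#|A| + #|N|)%N.
  by rewrite cardsU (_ : A :&: N = finset.set0)%SET ?cards0 ?subn0// /N finset.setDE finset.setIC
    -finset.setIA (finset.setIC _ A) finset.setICr finset.setI0.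
have cB : #|B| = (n - (#|A| + #|N|))%N by rewrite /B cardsCs finset.setCK cAN.
have ANb : (#|A| + #|N| <= 2 * b)%N by lia.
have B0 : B != finset.set0 by rewrite -card_gt0 cB; lia.
have dAB a : a \in A -> a \notin B by move=> aA; rewrite !inE aA.
have hs a v : a \in A -> v \in B -> t <= w (eg e0 a v).
  move=> aA; rewrite !inE leNgt => /norP[vA vN]; apply: contra vN => wa; rewrite vA /=.
  by apply/existsP; exists a; rewrite aA.
have A0' : A != finset.set0 by rewrite -card_gt0.
have := HG A0' B0 dAB t0t hs; rewrite cB -/n.
have h1 : lnbin n #|A| <= 2 * phi n%:R b%:R :> R.
  apply: le_trans (lnbin_le_phi _) _; first by rewrite A0; lia.
  by rewrite ler_pM2l// phi_homo ?ltr0n ?ler_nat//; lia.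
have h2 : lnbin n (n - (#|A| + #|N|)) <= 4 * phi n%:R b%:R :> R.
  apply: le_trans (@lnbin_compl_le_phi _ _ _ (2 * b%:R) n0 _ _ _ _) _; first by lia.
  - by rewrite -natrM ler_nat.
  - by rewrite -natrM ler1n; lia.
  - by rewrite -natrM ler_nat; lia.
  - by have := phi_double nR bR; lra.
have h3 : n%:R <= 2 * (n - (#|A| + #|N|))%:R :> R by rewrite -natrM ler_nat; lia.
have h4 : t * #|A|%:R * n%:R <= 2 * (t * #|A|%:R * (n - (#|A| + #|N|))%:R).
  by rewrite mulrCA ler_wpM2l// mulr_ge0//; case/andP: t0t.
have h5 : CG * (lnbin n #|A| + lnbin n (n - (#|A| + #|N|))) <= CG * (6 * phi n%:R b%:R).
  apply: ler_wpM2l; first exact: le_trans ler01 CG1.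
  by move: h1 h2; lra.
lra.
Qed.

(* The core starts at level [K] and grows towards level [0].  The exponent halves
   at each step, so that about [log_2 log n] levels lead from the root to
   [n * expR (- y)] vertices; the term [2 * j] makes the level costs summable. *)
Definition core_exp (y : R) (j : nat) : R := 2 ^+ j + 2 * j%:R + y.
Definition core_size (y : R) (j : nat) : nat :=
  (Num.truncn (n%:R * expR (- core_exp y j))).+1.
Definition core_cost (y : R) : R := 208 * CG * expR (2 - y) * (1 + y).

Lemma core_exp_homo y j : core_exp y j <= core_exp y j.+1.
Proof.
rewrite /core_exp -natr1 exprS.
have : 0 <= 2 ^+ j :> R by rewrite exprn_ge0. lra.
Qed.

Lemma core_size_gt y j : n%:R * expR (- core_exp y j) < (core_size y j)%:R.
Proof. by rewrite truncnS_gt. Qed.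

Lemma core_size_le y j : (core_size y j)%:R <= n%:R * expR (- core_exp y j) + 1.
Proof. by rewrite -natr1 lerD2r truncn_le ?mulr_ge0 ?expR_ge0. Qed.

Lemma core_size_homo y j : (core_size y j.+1 <= core_size y j)%N.
Proof.
by rewrite ltnS le_truncn// ler_wpM2l// ler_expR lerN2 core_exp_homo.
Qed.

Lemma core_exp_ge (y : R) j : 1 + y <= core_exp y j.
Proof.
rewrite /core_exp lerD2r; have : 1 <= 2 ^+ j :> R by rewrite exprn_ege1// ler1n.
have : 0 <= j%:R :> R by []. lra.
Qed.

(** The ratio of a squared level size to the previous size has exponent [2 - y - 2 * j], as
    [2 ^+ j.+1] cancels. The decay [expR (- 2 * j) <= 4 ^- j] then outweighs [1 + core_exp y j],
    which is of order [2 ^+ j]. *)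
Lemma core_exp_step (y : R) j : 0 <= y ->
  expR (core_exp y j.+1 - 2 * core_exp y j) * (1 + core_exp y j)
    <= 4 * expR (2 - y) * (1 + y) / 2 ^+ j.
Proof.
move=> y0.
have -> : core_exp y j.+1 - 2 * core_exp y j = (2 - y) - 2 * j%:R.
  by rewrite /core_exp -natr1 exprS; ring.
rewrite expRD expRN -mulrA -!mulrA [leRHS]mulrCA ler_pM2l ?expR_gt0//.
have e2 : 4 ^+ j <= expR (2 * j%:R) :> R.
  rewrite mulrC expRM_natl lerXn2r ?nnegrE ?expR_ge0//.
  have -> : 2 = 2%:R * 1 :> R by rewrite mulr1.
  rewrite expRM_natl; have := @expR1_gt2 R; rewrite expr2; nra.
have p2 : 1 <= 2 ^+ j :> R by rewrite exprn_ege1// ler1n.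
have j2 : j.+1%:R <= 2 ^+ j :> R by rewrite -natrX ler_nat ltn_expl.
have -> : 4 * ((1 + y) / 2 ^+ j) = (4 * (1 + y) * 2 ^+ j) / 4 ^+ j.
  have -> : 4 ^+ j = 2 ^+ j * 2 ^+ j :> R by rewrite -exprMn; congr (_ ^+ _); ring.
  by field; rewrite expf_neq0.
rewrite mulrC; apply: ler_pM.
- rewrite /core_exp; have : 0 <= j%:R :> R by []. lra.
- by rewrite invr_ge0 expR_ge0.
- rewrite /core_exp; move: j2; rewrite -natr1 => j2; nra.
- by rewrite lef_pV2 ?posrE ?expR_gt0 ?exprn_gt0.
Qed.

Lemma core_cost_ge0 (y : R) : 0 <= y -> 0 <= core_cost y.
Proof.
by move=> y0; rewrite !mulr_ge0 ?expR_ge0 ?addr_ge0// (le_trans ler01).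
Qed.

Lemma core_level r (y : R) K i : 2 <= y -> core_cost y <= t0 -> ln n%:R <= 2 ^+ K :> R -> (i <= K)%N ->
  exists F Q, [/\ #|Q| = core_size y (K - i), forall q, q \in Q -> reach F i r q &
    wt w F <= core_cost y * (2 / 2 ^+ (K - i) - 2 / 2 ^+ K)].
Proof.
move=> y2 ct lnK'; have n0 := card_le1n r; have nR : 0 < n%:R :> R by rewrite ltr0n.
have y0 : 0 <= y by lra.
have cc0 := core_cost_ge0 y0.
elim: i => [|i IH] iK.
  (* The top level is the root alone: [2 ^+ K >= ln n] makes [n * expR (- core_exp y K)] less than
     1, so its size rounds to 1. *)
  exists finset.set0, [set r]%SET; split; rewrite ?subn0 ?wt0 ?subrr ?mulr0//.
    rewrite cards1 /core_size; congr (_.+1); apply/esym/eqP; rewrite truncn_eq ?mulr_ge0 ?expR_ge0//=.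
    rewrite expRN ltr_pdivrMr ?expR_gt0// mul1r.
    rewrite -[ltLHS]lnK ?posrE// ltr_expR; apply: le_lt_trans lnK' _.
    rewrite /core_exp -addrA ltrDl; have : 0 <= K%:R :> R by []. lra.
  by move=> q; rewrite inE => /eqP->; apply: reach0.
have [F [Q [cQ rQ wF]]] := IH (ltnW iK).
set j := (K - i.+1)%N; have Kj : (K - i)%N = j.+1 by rewrite /j; lia.
rewrite Kj in cQ wF.
have p2 : 0 < 2 ^+ j :> R by rewrite exprn_gt0.
have wE : core_cost y * (2 / 2 ^+ j.+1 - 2 / 2 ^+ K) + core_cost y / 2 ^+ j
    = core_cost y * (2 / 2 ^+ j - 2 / 2 ^+ K).
  by rewrite exprS; field; rewrite !expf_neq0.
(* As long as the prescribed size rounds to 1, the level is kept and no edge is bought. Afterwards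
   rounding up costs at most a factor 2. *)
have [lt1|ge1] := ltP (n%:R * expR (- core_exp y j)) 1.
  have s1 : core_size y j = 1%N.
    by congr (_.+1); apply/eqP; rewrite truncn_eq ?mulr_ge0 ?expR_ge0//=.
  have s1' : core_size y j.+1 = 1%N by have := core_size_homo y j; rewrite s1 /core_size; lia.
  exists F, Q; split; first by rewrite cQ s1 s1'.
    by move=> q qQ; apply: reach_mono (subxx _) (leqnSn i) (rQ q qQ).
  by rewrite -wE; apply: le_trans wF _; rewrite lerDl divr_ge0// ltW.
set b := core_size y j; set a := core_size y j.+1.
have b_le : b%:R <= 2 * (n%:R * expR (- core_exp y j)) :> R by have := core_size_le y j; rewrite -/b; lra.
have b_gt : n%:R * expR (- core_exp y j) < b%:R by apply: core_size_gt.
have a_gt : n%:R * expR (- core_exp y j.+1) < a%:R by apply: core_size_gt.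
have ab : (a <= b)%N by apply: core_size_homo.
have b0 : (0 < b)%N by []. have a0 : (0 < a)%N by [].
rewrite -/a in cQ; clearbody a b.
have bR : 0 < b%:R :> R by rewrite ltr0n.
have aR : 0 < a%:R :> R by rewrite ltr0n.
have e8 : 8 * expR (- core_exp y j) <= 1.
  have h3 : expR 3 <= expR (core_exp y j) by rewrite ler_expR; have := core_exp_ge y j; lra.
  have : 8 <= expR 3 :> R.
    have -> : 3 = 3%:R * 1 :> R by rewrite mulr1.
    rewrite expRM_natl; have := @expR1_gt2 R; rewrite !exprS expr0; nra.
  by move=> h8; rewrite expRN ler_pdivrMr ?expR_gt0// mul1r; lra.
have bn : (4 * b <= n)%N.
  by rewrite -(ler_nat R) natrM; nra.
have lnb : ln (expR 1 * n%:R / b%:R) <= 1 + core_exp y j.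
  rewrite -ler_expR lnK ?posrE ?divr_gt0 ?mulr_gt0 ?expR_gt0//.
  rewrite ler_pdivrMr// expRD -mulrA ler_pM2l ?expR_gt0//.
  apply: ltW; rewrite mulrC -ltr_pdivrMr ?expR_gt0// -expRN//.
have phib : phi n%:R b%:R <= b%:R * (1 + core_exp y j) by rewrite ler_pM2l.
have phib0 : 0 < phi n%:R b%:R :> R by rewrite phi_gt0// ler_nat (leq_trans _ bn)// leq_pmull.
(* The least threshold of this form allowed by [growth], with 13 in place of 12 for the strict
   inequality. *)
pose t := 13 * CG * phi n%:R b%:R / (a%:R * n%:R).
have CG0 := CG_gt0.
have t_ge0 : 0 <= t.
  by apply: divr_ge0; apply: mulr_ge0 => //; last exact: ltW; apply: mulr_ge0 => //; exact: ltW.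
(* Each of the [b] new vertices buys one edge of weight below [t]. The constant 208 of [core_cost]
   is 13 from [t], times 4 from the squared rounding of [b], times 4 from [core_exp_step]. *)
have bt : b%:R * t <= core_cost y / 2 ^+ j.
  have -> : b%:R * t = 13 * CG * ((b%:R * phi n%:R b%:R) / (a%:R * n%:R)) by rewrite /t; field; rewrite !gt_eqF.
  have -> : core_cost y / 2 ^+ j = 13 * CG * (4 * (4 * expR (2 - y) * (1 + y) / 2 ^+ j)).
    by rewrite /core_cost; field; rewrite expf_neq0.
  rewrite ler_pM2l ?mulr_gt0//.
  apply: le_trans (ler_wpM2l _ (core_exp_step j y0)); last by [].
  rewrite ler_pdivrMr ?mulr_gt0//.
  apply: (@le_trans _ _ (b%:R ^+ 2 * (1 + core_exp y j))).
    by rewrite expr2 -mulrA ler_wpM2l.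
  have c1 : 0 < 1 + core_exp y j by have := core_exp_ge y j; lra.
  have : b%:R ^+ 2 <= 4 * (expR (core_exp y j.+1 - 2 * core_exp y j) * (a%:R * n%:R)).
    apply: (@le_trans _ _ ((2 * (n%:R * expR (- core_exp y j))) ^+ 2)); first by rewrite lerXn2r ?nnegrE ?mulr_ge0 ?expR_ge0// ltW.
    have -> : expR (core_exp y j.+1 - 2 * core_exp y j) = expR (core_exp y j.+1) * expR (- core_exp y j) ^+ 2.
      by rewrite -expRM_natl -expRD; congr (expR _); ring.
    have a_gt' : n%:R < a%:R * expR (core_exp y j.+1).
      by move: a_gt; rewrite expRN ltr_pdivrMr ?expR_gt0.
    have -> : (2 * (n%:R * expR (- core_exp y j))) ^+ 2 = 4 * (expR (- core_exp y j) ^+ 2 * n%:R) * n%:R by ring.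
    have -> : 4 * (expR (core_exp y j.+1) * expR (- core_exp y j) ^+ 2 * (a%:R * n%:R))
       = 4 * (expR (- core_exp y j) ^+ 2 * n%:R) * (a%:R * expR (core_exp y j.+1)) by ring.
    by rewrite ler_wpM2l ?ltW// !mulr_gt0 ?exprn_gt0 ?expR_gt0.
  move=> h; have -> : 4 * (expR (core_exp y j.+1 - 2 * core_exp y j) * (1 + core_exp y j)) * (a%:R * n%:R)
     = 4 * (expR (core_exp y j.+1 - 2 * core_exp y j) * (a%:R * n%:R)) * (1 + core_exp y j) by ring.
  by rewrite ler_pM2r.
have tt0 : t <= t0.
  apply: le_trans ct; apply: (@le_trans _ _ (b%:R * t)).
    by rewrite -[leLHS]mul1r ler_wpM2r// ler1n.
  apply: le_trans bt _; rewrite ler_pdivrMr// -[leLHS]mulr1 ler_wpM2l//.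
  by rewrite exprn_ege1// ler1n.
have gr : 12 * CG * phi n%:R b%:R < t * #|Q|%:R * n%:R.
  rewrite cQ.
  have -> : t * a%:R * n%:R = 13 * CG * phi n%:R b%:R by rewrite /t; field; rewrite !gt_eqF.
  by rewrite ltr_pM2r// ltr_pM2r// ltr_nat.
have Q0 : (0 < #|Q|)%N by rewrite cQ.
have Qb : (#|Q| <= b)%N by rewrite cQ.
have tI : 0 <= t <= t0 by rewrite t_ge0.
have [B [cB hB]] := growth Q0 Qb bn tI gr.
have /boolp.choice[f hf] : forall v, exists a0, v \in B -> a0 \in Q /\ w (eg e0 a0 v) < t.
  by move=> v; have [/hB[x xQ xt]|_] := boolP (v \in B); [exists x|exists v].
exists (F :|: \bigcup_(v in B) [set eg e0 (f v) v])%SET, B; split=> //.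
  move=> v vB; have [fQ ft] := hf v vB.
  have [fv|fv] := eqVneq (f v) v.
    apply: (reach_mono _ (leqnSn i)); first exact: finset.subsetUl.
    by apply: rQ; rewrite -fv.
  rewrite -addn1; apply: (reach_cat (y := f v)).
    by apply: reach_mono (rQ _ fQ) => //; apply: finset.subsetUl.
  apply: reach_nbr; rewrite (nbrE e0) fv inE; apply/orP; right.
  by apply/bigcupP; exists v; rewrite ?inE.
apply: le_trans (wtU w_ge0 _ _) _; rewrite -wE lerD//.
apply: le_trans (wt_bigcup w_ge0 _ _) _; apply: le_trans bt.
rewrite -cB mulr_natl -sumr_const; apply: ler_sum => v vB; rewrite wt1.
by apply: ltW; apply: (proj2 (hf v vB)).
Qed.

Lemma core r (y : R) K : 2 <= y -> core_cost y <= t0 -> ln n%:R <= 2 ^+ K :> R ->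
  exists F Q, [/\ n%:R * expR (- (1 + y)) < #|Q|%:R, forall q, q \in Q -> reach F K r q &
    wt w F <= 2 * core_cost y].
Proof.
move=> y2 ct lnK'; have [F [Q [cQ rQ wF]]] := core_level r y2 ct lnK' (leqnn K).
rewrite subnn in cQ wF; exists F, Q; split=> //.
  by rewrite cQ; apply: le_lt_trans (core_size_gt y 0); rewrite /core_exp expr0 mulr0 addr0.
apply: le_trans wF _; rewrite expr0 divr1 mulrC ler_wpM2r ?core_cost_ge0//; first by lra.
by rewrite gerBl divr_ge0.
Qed.

End Expander.

(** * Joining vertices to the core *)

Section Connections.
Variables (V : finType) (R : realType) (e0 : edge V).
Implicit Types (A B Q U : {set V}) (F : {set edge V}) (x v r : V).
Variables (CG t0 : R) (w : edge V -> R).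
Hypothesis CG1 : 1 <= CG :> R.
Hypothesis w_ge0 : forall e, 0 <= w e.
Hypothesis HG : expander e0 CG t0 w.
Let n := #|V|.

Lemma half_sub (p q : nat) : (2 * p <= q)%N -> (q <= 2 * (q - p))%N.
Proof. lia. Qed.

Lemma sub_half_gt0 (p q : nat) : (2 * p <= q)%N -> (0 < q)%N -> (0 < q - p)%N.
Proof. lia. Qed.

Lemma doubling_arith (a b N : nat) : (0 < a)%N -> (4 * a <= N)%N -> (b < 2 * a)%N ->
  [/\ (b <= N)%N, (0 < N - b)%N, (a <= N)%N, (b <= 2 * a)%N & (0 < 2 * a <= N)%N /\ (N <= 2 * (N - b))%N].
Proof. by move=> *; split; lia. Qed.

Lemma card_gt_half (k : nat) : (n <= 2 * (n - k))%N -> n%:R <= 2 * (n - k)%:R :> R.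
Proof. by move=> h; rewrite -natrM ler_nat. Qed.

(** Every set considered has at least [#|Q|] elements, so its entropy is at most [Lam] per element
    and the same threshold [td] serves in all steps. A step that fails to double would contradict
    the expander bound, as 13 exceeds 12. *)
Lemma doubling Q (Lam : R) (td := 13 * CG * Lam / n%:R) i :
  (0 < #|Q|)%N -> ln (expR 1 * n%:R / #|Q|%:R) <= Lam -> td <= t0 ->
  let A := [set v | `[< joined w Q i (i%:R * td) v >]]%SET in
  (n < 4 * #|A|)%N \/ (2 ^ i * #|Q| <= #|A|)%N.
Proof.
move=> Q0 lnQ tdt0; have CG0 := CG_gt0 CG1.
have Qn : (#|Q| <= n)%N by apply: max_card.
have n0 : (0 < n)%N by apply: leq_trans Qn.
have nR : 0 < n%:R :> R by rewrite ltr0n.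
have QR : 0 < #|Q|%:R :> R by rewrite ltr0n.
have Lam1 : 1 <= Lam by apply: le_trans lnQ; rewrite ln_e_ge1// ler_nat.
have td0 : 0 <= td by apply: divr_ge0 => //; rewrite !mulr_ge0// ltW// (lt_le_trans ltr01).
pose A i := [set v | `[< joined w Q i (i%:R * td) v >]]%SET.
have AP k v : reflect (joined w Q k (k%:R * td) v) (v \in A k) by rewrite inE; apply: asboolP.
rewrite /= -/(A i); elim: i => [|i IH].
  right; rewrite mul1n; apply: subset_leq_card; apply/fintype.subsetP => q qQ.
  by apply/AP; rewrite mul0r; apply: joined0.
have sA : A i \subset A i.+1.
  apply/fintype.subsetP => v /AP h; apply/AP.
  by apply: joined_mono h => //; rewrite ler_wpM2r// ler_nat.
have cA := subset_leq_card sA.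
case: IH => [IH|IH]; first by left; apply: leq_trans IH _; rewrite leq_mul.
have [h4|h4] := ltnP n (4 * #|A i|); first by left; apply: leq_trans h4 _; rewrite leq_mul.
right; rewrite expnS -mulnA; apply: leq_trans (leq_mul (leqnn 2) IH) _.
rewrite leqNgt; apply/negP => h2.
have a0 : (0 < #|A i|)%N by apply: leq_trans IH; rewrite muln_gt0 expn_gt0.
have aR : 0 < #|A i|%:R :> R by rewrite ltr0n.
have [bN Nb0 aN b2a [a2N N2b]] := doubling_arith a0 h4 h2.
have /andP[a20 a2N'] := a2N.
pose B := ~: (A i.+1).
have cB : #|B| = (n - #|A i.+1|)%N by rewrite /B cardsCs finset.setCK.
have hs a b : a \in A i -> b \in B -> td <= w (eg e0 a b).
  move=> /AP ja; rewrite finset.in_setC leNgt; apply: contra => wab.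
  apply/AP; rewrite -natr1 mulrDl mul1r.
  exact: (joined_step w_ge0 ja (ltW wab)).
have dAB a : a \in A i -> a \notin B by move=> aA; rewrite finset.in_setC negbK (fintype.subsetP sA).
have Ai0 : A i != finset.set0 by rewrite -card_gt0.
have B0 : B != finset.set0 by rewrite -card_gt0 cB.
have tdI : 0 <= td <= t0 by rewrite td0.
have := HG Ai0 B0 dAB tdI hs; rewrite cB -/n.
move: (#|A i|) h4 h2 a0 aR IH bN Nb0 aN b2a a2N N2b a20 a2N' => a h4 h2 a0 aR IH bN Nb0 aN b2a a2N N2b a20 a2N'.
have aQ : (#|Q| <= a)%N by apply: leq_trans IH; rewrite leq_pmull// expn_gt0.
have pa : phi n%:R a%:R <= a%:R * Lam.
  rewrite ler_pM2l//; apply: le_trans lnQ.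
  rewrite ler_ln ?posrE ?divr_gt0 ?mulr_gt0 ?expR_gt0// ler_pM2l ?mulr_gt0 ?expR_gt0//.
  by rewrite lef_pV2 ?posrE// ler_nat.
have l1 : lnbin n a <= 2 * phi n%:R a%:R :> R by apply: lnbin_le_phi; rewrite a0.
have l2 : lnbin n (n - #|A i.+1|) <= 4 * phi n%:R a%:R :> R.
  apply: le_trans (@lnbin_compl_le_phi _ _ _ (2 * a%:R) n0 bN _ _ _) _.
  - by rewrite -natrM ler_nat.
  - by rewrite -natrM ler1n.
  - by rewrite -natrM ler_nat.
  - by have := phi_double nR aR; lra.
have h5 : CG * (lnbin n a + lnbin n (n - #|A i.+1|)) <= CG * (6 * (a%:R * Lam)).
  by apply: ler_wpM2l; [exact: ltW|lra].
have h6 : n%:R <= 2 * (n - #|A i.+1|)%:R :> R by apply: card_gt_half.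
have aL : 0 < CG * (a%:R * Lam) by rewrite !mulr_gt0// (lt_le_trans ltr01).
have h7 : 13 * (CG * (a%:R * Lam)) <= 2 * (td * a%:R * (n - #|A i.+1|)%:R).
  have -> : 13 * (CG * (a%:R * Lam)) = td * a%:R * n%:R by rewrite /td; field; rewrite gt_eqF.
  by rewrite mulrCA ler_wpM2l// mulr_ge0.
lra.
Qed.

Lemma doubling_quarter Q (Lam : R) (td := 13 * CG * Lam / n%:R) (J : nat) :
  (0 < #|Q|)%N -> ln (expR 1 * n%:R / #|Q|%:R) <= Lam -> td <= t0 -> 2 * Lam <= J%:R ->
  (n < 4 * #|[set v | `[< joined w Q J (J%:R * td) v >]]%SET|)%N.
Proof.
move=> Q0 lnQ tdt0 JL.
case: (doubling J Q0 lnQ tdt0) => // h; apply: leq_trans (leq_mul (leqnn 4) h).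
have Qn : (#|Q| <= n)%N by apply: max_card.
have n0 : (0 < n)%N by apply: leq_trans Qn.
have nR : 0 < n%:R :> R by rewrite ltr0n.
have QR : 0 < #|Q|%:R :> R by rewrite ltr0n.
(* Since [ln 2 > 1 / 2], [J >= 2 * Lam] doublings multiply the size by at least [expR Lam], which
   takes [#|Q|] beyond [n]. *)
have h2J : expR Lam <= 2 ^+ J :> R.
  rewrite -[leRHS]lnK ?posrE ?exprn_gt0// ler_expR lnXn// -[_ *+ J]mulr_natl.
  have := @ln2_gt_half R; have : 0 <= J%:R :> R by []. nra.
have : expR 1 * n%:R / #|Q|%:R <= expR Lam.
  by rewrite -[leLHS]lnK ?posrE ?divr_gt0 ?mulr_gt0 ?expR_gt0// ler_expR.
rewrite ler_pdivrMr// => h3; rewrite -(ltr_nat R) !natrM natrX.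
have := @expR1_gt2 R; nra.
Qed.

Section TwoHops.
Variables (Q : {set V}) (J : nat) (c0 : R).
Hypothesis c0_ge0 : 0 <= c0 :> R.
Hypothesis quarter : (n < 4 * #|[set v | `[< joined w Q J c0 v >]]%SET|)%N.
Let k1 := 16 * CG.
Let k2 := 256 * CG ^+ 2.

Definition bad1 (s : R) : {set V} := [set v | ~~ `[< joined w Q J.+1 (c0 + s / n%:R) v >]]%SET.
Definition bad2 (s : R) : {set V} := [set v | ~~ `[< joined w Q J.+2 (c0 + 2 * s / n%:R) v >]]%SET.

Lemma bad1P s v : reflect (joined w Q J.+1 (c0 + s / n%:R) v) (v \notin bad1 s).
Proof. by rewrite inE negbK; apply: asboolP. Qed.

Lemma bad2P s v : reflect (joined w Q J.+2 (c0 + 2 * s / n%:R) v) (v \notin bad2 s).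
Proof. by rewrite inE negbK; apply: asboolP. Qed.

Lemma card_pos : (0 < n)%N.
Proof.
by have := leq_trans quarter (leq_mul (leqnn 4) (max_card _)); rewrite -/n; case: (n).
Qed.

Lemma bad1_le (s : R) : 0 < s -> s / n%:R <= t0 -> s * #|bad1 s|%:R <= k1 * n%:R.
Proof.
move=> s0 st0; have n0 := card_pos; have nR : 0 < n%:R :> R by rewrite ltr0n.
have CG0 := CG_gt0 CG1.
have q4 := quarter; set A := [set v | `[< joined w Q J c0 v >]]%SET in q4.
have AP a : reflect (joined w Q J c0 a) (a \in A) by rewrite inE; apply: asboolP.
have [->|B0] := eqVneq (bad1 s) finset.set0; first by rewrite cards0 mulr0 !mulr_ge0 ?ltW.
have A0 : A != finset.set0 by rewrite -card_gt0; lia.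
have hs a b : a \in A -> b \in bad1 s -> s / n%:R <= w (eg e0 a b).
  move=> /AP ja; apply: contraTT; rewrite -ltNge => wab; apply/bad1P.
  exact: (joined_step w_ge0 ja (ltW wab)).
have dAB a : a \in A -> a \notin bad1 s.
  move=> /AP ja; apply/bad1P; apply: joined_mono ja => //.
  by rewrite lerDl divr_ge0// ltW.
have sI : 0 <= s / n%:R <= t0 by rewrite st0 divr_ge0// ltW.
have := HG A0 B0 dAB sI hs; rewrite -/n.
have l1 : lnbin n #|A| <= 2 * n%:R :> R by apply: lnbin_le => //; apply: max_card.
have l2 : lnbin n #|bad1 s| <= 2 * n%:R :> R by apply: lnbin_le => //; apply: max_card.
have h5 : CG * (lnbin n #|A| + lnbin n #|bad1 s|) <= CG * (4 * n%:R).
  by apply: ler_wpM2l; [exact: ltW|lra].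
have qA : n%:R <= 4 * #|A|%:R :> R by rewrite -natrM ler_nat ltnW.
have -> : s / n%:R * #|A|%:R * #|bad1 s|%:R = (s * #|bad1 s|%:R) * (#|A|%:R / n%:R) by field; rewrite gt_eqF.
have : 1 / 4 <= #|A|%:R / n%:R :> R by rewrite ler_pdivlMr//; lra.
have : 0 <= s * #|bad1 s|%:R by rewrite mulr_ge0// ltW.
rewrite /k1; move: (s * _) (_ / n%:R) => z u; nra.
Qed.

(** One hop leaves [O(n / s)] vertices, at a cost of order [s / n] each, which does not decay with
    the scale [s]. The second hop starts from the complement of [bad1 s], whose entropy is that of a
    set of size [X = k1 * n / s] instead of order [n]; this gains the further factor [sg], the
    square root of [s]. *)
Lemma bad2_le (sg : R) : 1 <= sg -> 2 * k1 <= sg ^+ 2 -> sg ^+ 2 <= k1 * n%:R ->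
  sg ^+ 2 / n%:R <= t0 -> 4 * CG * (1 + 3 * ln sg) <= sg ^+ 2 / 2 ->
  #|bad2 (sg ^+ 2)|%:R * sg ^+ 3 <= k2 * n%:R.
Proof.
set s := sg ^+ 2 => sg1 s_k1 s_n st0 s_ln.
have n0 := card_pos; have nR : 0 < n%:R :> R by rewrite ltr0n.
have CG0 := CG_gt0 CG1; have k1_0 : 0 < k1 by rewrite mulr_gt0.
have s0 : 0 < s by lra.
have b1 := bad1_le s0 st0.
rewrite leNgt; apply/negP => contr.
have s3 : 0 < sg ^+ 3 by rewrite exprn_gt0//; lra.
have B0 : (0 < #|bad2 s|)%N.
  by rewrite lt0n; apply: contraTN contr => /eqP->; rewrite mul0r -leNgt !mulr_ge0// ltW.
have BR : 0 < #|bad2 s|%:R :> R by rewrite ltr0n.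
have Bn : (#|bad2 s| <= n)%N by apply: max_card.
have b1n : #|bad1 s|%:R <= k1 * n%:R / s by rewrite ler_pdivlMr// mulrC.
have b1h : (2 * #|bad1 s| <= n)%N.
  rewrite -(ler_nat R) natrM; apply: (@le_trans _ _ (2 * (k1 * n%:R / s))); first by rewrite ler_pM2l.
  rewrite mulrA ler_pdivrMr// mulrA; nra.
pose A := ~: bad1 s.
have cA : #|A| = (n - #|bad1 s|)%N by rewrite /A cardsCs finset.setCK.
have A0 : A != finset.set0 by rewrite -card_gt0 cA sub_half_gt0.
have hs a b : a \in A -> b \in bad2 s -> s / n%:R <= w (eg e0 a b).
  rewrite finset.in_setC => /bad1P ja; apply: contraTT; rewrite -ltNge => wab.
  apply/bad2P; have -> : c0 + 2 * s / n%:R = c0 + s / n%:R + s / n%:R by ring.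
  exact: (joined_step w_ge0 ja (ltW wab)).
have dAB a : a \in A -> a \notin bad2 s.
  rewrite finset.in_setC => /bad1P ja; apply/bad2P; apply: joined_mono ja => //.
  by rewrite lerD2l ler_pM2r ?invr_gt0//; lra.
have sI : 0 <= s / n%:R <= t0 by rewrite st0 divr_ge0// ltW.
have B0' : bad2 s != finset.set0 by rewrite -card_gt0.
have := HG A0 B0' dAB sI hs; rewrite cA -/n.
set X := k1 * n%:R / s in b1n.
have X0 : 0 < X by apply: divr_gt0 => //; apply: mulr_gt0.
have X1 : 1 <= X by rewrite ler_pdivlMr// mul1r.
have Xn : X <= n%:R by rewrite ler_pdivrMr//; nra.
have l1 : lnbin n (n - #|bad1 s|) <= 2 * phi n%:R X :> R.
  by apply: lnbin_compl_le_phi => //; apply: max_card.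
have l2 : lnbin n #|bad2 s| <= 2 * phi n%:R #|bad2 s|%:R :> R.
  by apply: lnbin_le_phi; rewrite B0.
have sg0 : 0 < sg by lra.
have lnsg : ln sg <= sg - 1 by apply: ln_le_subr1.
(* The generous bound [ln sg <= sg - 1] suffices: it is what leaves the exponent 3 instead of almost
   4. *)
have p1 : phi n%:R X <= 2 * X * sg.
  rewrite phi_lnE// -mulrA mulrCA ler_pM2l//.
  have -> : n%:R / X = s / k1 by rewrite /X; field; rewrite !gt_eqF.
  rewrite ln_div ?posrE// lnXn// mulr2n.
  have : 0 <= ln k1 by rewrite ln_ge0// /k1; move: CG1; lra.
  lra.
have k2_1 : 1 <= k2 by rewrite /k2; move: CG1; nra.
(* The assumption [contr] that [bad2 s] is large bounds its entropy per element by [1 + 3 * ln sg].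
   The last hypothesis then absorbs this term into the left-hand side of the expander inequality. *)
have p2 : phi n%:R #|bad2 s|%:R <= #|bad2 s|%:R * (1 + 3 * ln sg).
  rewrite phi_lnE// ler_pM2l// lerD2l.
  have : n%:R / #|bad2 s|%:R <= sg ^+ 3.
    rewrite ler_pdivrMr// mulrC; apply: ltW; apply: le_lt_trans contr.
    by rewrite ler_peMl.
  by rewrite -ler_ln ?posrE ?divr_gt0// lnXn// -[_ *+ 3]mulr_natl.
have h5 : CG * (lnbin n (n - #|bad1 s|) + lnbin n #|bad2 s|) <=
    CG * (4 * X * sg + 2 * (#|bad2 s|%:R * (1 + 3 * ln sg))).
  by apply: ler_wpM2l; [exact: ltW|lra].
have h6 : n%:R <= 2 * (n - #|bad1 s|)%:R :> R by apply: card_gt_half; apply: half_sub.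
have h7 : #|bad2 s|%:R * s <= 2 * (s / n%:R * (n - #|bad1 s|)%:R * #|bad2 s|%:R).
  have -> : 2 * (s / n%:R * (n - #|bad1 s|)%:R * #|bad2 s|%:R) =
    (#|bad2 s|%:R * s) * (2 * (n - #|bad1 s|)%:R / n%:R) by field; rewrite gt_eqF.
  apply: ler_peMr; first by apply: mulr_ge0 => //; exact: ltW.
  by rewrite ler_pdivlMr// mul1r.
have h8 : 4 * CG * (1 + 3 * ln sg) * #|bad2 s|%:R <= s / 2 * #|bad2 s|%:R by rewrite ler_pM2r.
move=> h9.
have h10 : #|bad2 s|%:R * s <= 16 * CG * X * sg by lra.
have : #|bad2 s|%:R * sg ^+ 3 <= k2 * n%:R; last by rewrite leNgt contr.
have E1 : #|bad2 s|%:R * sg ^+ 3 = (#|bad2 s|%:R * s) * sg by rewrite /s; ring.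
have E2 : k2 * n%:R = 16 * CG * X * sg * sg.
  by rewrite /X /k2 /k1 /s; field; rewrite gt_eqF.
by rewrite E1 E2 ler_pM2r.
Qed.
End TwoHops.
End Connections.

(** * Total joining cost and the cutting of a tree *)

Section Costs.
Variables (V : finType) (R : realType) (e0 : edge V).
Implicit Types (Q U T : {set V}) (F : {set edge V}) (x v r : V).
Variable w : edge V -> R.
Hypothesis w_ge0 : forall e, 0 <= w e.

Lemma geometric_split (a b : R) (i1 I : nat) : 0 <= a -> 0 <= b ->
  \sum_(0 <= i < I) (if (i < i1)%N then a * 4 ^+ i else b / 2 ^+ i) <= a * 4 ^+ i1 / 3 + 2 * b / 2 ^+ i1.
Proof.
move=> a0 b0.
suff h : \sum_(0 <= i < I) (if (i < i1)%N then a * 4 ^+ i else b / 2 ^+ i)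
    <= a * 4 ^+ (minn I i1) / 3 + 2 * b * (1 / 2 ^+ i1 - 1 / 2 ^+ (maxn I i1)).
  apply: le_trans h _; apply: lerD.
    by rewrite ler_wpM2r// ler_wpM2l// ler_weXn2l// ?geq_minr//; lra.
  by rewrite mulrBr mulrA mulr1 lerBlDr lerDl mulr_ge0 ?mulr_ge0// divr_ge0// exprn_ge0.
elim: I => [|I IH].
  by rewrite big_nil min0n max0n subrr mulr0 addr0 expr0 mulr1 divr_ge0.
rewrite big_nat_recr//=; case: (ltnP I i1) IH => Ii IH.
  rewrite (minn_idPl Ii) (maxn_idPr Ii) exprS.
  have : 0 <= a * 4 ^+ I by rewrite mulr_ge0// exprn_ge0. lra.
rewrite (minn_idPr (leqW Ii)) (maxn_idPl (leqW Ii)) exprS.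
have : b / 2 ^+ I = 2 * b * (1 / 2 ^+ I - 1 / (2 * 2 ^+ I)) by field; rewrite expf_neq0.
lra.
Qed.

(* [bad i] collects the vertices that cannot be joined to [Q] at scale [4 ^ i];
   their number decays like [8 ^ -i], so that the total cost converges. *)
Lemma joining_cost Q h (c0 K N : R) (bad : nat -> {set V}) (i0 I : nat) :
  0 <= c0 -> 0 <= K -> 0 < N -> (i0 <= I)%N -> bad I = finset.set0 ->
  (forall i, (i0 <= i < I)%N -> #|bad i|%:R * 8 ^+ i <= K * N) ->
  (forall i v, (i0 <= i <= I)%N -> v \notin bad i -> joined w Q h (c0 + 2 * 4 ^+ i / N) v) ->
  exists c : V -> R, [/\ forall v, 0 <= c v, forall v, joined w Q h (c v) v &
    forall U (i1 : nat), \sum_(v in U) c v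
      <= #|U|%:R * (c0 + (2 * 4 ^+ i0 + 3 * 4 ^+ i1) / N) + 16 * K / 2 ^+ i1].
Proof.
move=> c0_ge0 K0 N0 i0I badI cbad jbad.
have p4 i : 0 <= 4 ^+ i :> R by rewrite exprn_ge0.
(* A vertex bad at scale [i] is charged for the next scale, [2 * 4 ^+ i.+1 = 8 * 4 ^+ i]; at its
   first good scale the last of these charges alone pays for the connection. *)
pose f v i : R := (v \in bad i)%:R * (8 * 4 ^+ i / N).
have f0 v i : 0 <= f v i by rewrite !mulr_ge0// invr_ge0 ltW.
exists (fun v => c0 + 2 * 4 ^+ i0 / N + \sum_(i0 <= i < I) f v i); split.
- by move=> v; rewrite !addr_ge0 ?sumr_ge0// divr_ge0 ?mulr_ge0// ltW.
- move=> v; have ex : exists i, (i0 <= i)%N && (v \notin bad i).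
    by exists I; rewrite i0I badI finset.in_set0.
  case: (ex_minnP ex) => m /andP[i0m vm] mmin.
  have mI : (m <= I)%N by apply: mmin; rewrite i0I badI finset.in_set0.
  have jm : joined w Q h (c0 + 2 * 4 ^+ m / N) v by apply: jbad; rewrite // i0m.
  apply: joined_mono jm => //; rewrite -addrA lerD2l.
  have [<-|mi0] := eqVneq i0 m; first by rewrite lerDl sumr_ge0.
  have i0m' : (i0 < m)%N by rewrite ltn_neqAle mi0.
  case: m i0m' vm mmin mI {i0m mi0} => // m; rewrite ltnS => i0m vm mmin mI.
  have vb : v \in bad m.
    by apply: contraT => vb; have := mmin m; rewrite i0m vb ltnn => /(_ isT).
  rewrite (@big_cat_nat _ _ _ m)//=; last exact: ltnW.
  rewrite (@big_ltn _ _ _ m I)//= {2}/f vb mul1r exprS.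
  rewrite [leLHS](_ : _ = 8 * 4 ^+ m / N); last by field; rewrite gt_eqF.
  rewrite addrA addrCA lerDl !addr_ge0 ?sumr_ge0// divr_ge0 ?mulr_ge0// ltW//.
- move=> U i1; rewrite big_split/= sumr_const -[_ *+ #|U|]mulr_natl exchange_big/=.
  rewrite [X in _ <= X](_ : _ = #|U|%:R * (c0 + 2 * 4 ^+ i0 / N) +
     (#|U|%:R * (3 * 4 ^+ i1 / N) + 16 * K / 2 ^+ i1)); last by field; rewrite expf_neq0//= gt_eqF.
  rewrite lerD2l.
  (* Below the crossover [i1] all of [U] may be bad; from [i1] on the decay of [bad] is used. The
     crossover is left free, to be adapted to the size of [U]. *)
  pose g i : R := if (i < i1)%N then (8 * #|U|%:R / N) * 4 ^+ i else (8 * K) / 2 ^+ i.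
  have g0 i : 0 <= g i by rewrite /g; case: ifP => _; rewrite !mulr_ge0 ?invr_ge0 ?exprn_ge0// ltW.
  apply: (@le_trans _ _ (\sum_(0 <= i < I) g i)).
    rewrite (@big_cat_nat _ _ _ i0 0 I)//= -[leLHS]add0r lerD ?sumr_ge0//.
    rewrite big_nat [leRHS]big_nat; apply: ler_sum => i ii.
    rewrite -mulr_suml; have -> : \sum_(v in U) (v \in bad i)%:R = #|(U :&: bad i)%SET|%:R :> R.
      rewrite -sumr_const [RHS](eq_bigl (fun v => (v \in U) && (v \in bad i))); last by move=> v; rewrite inE.
      by rewrite [RHS]big_mkcondr; apply: eq_bigr => v _; case: (v \in bad i).
    rewrite /g; case: ifP => _.
      have -> : 8 * #|U|%:R / N * 4 ^+ i = #|U|%:R * (8 * 4 ^+ i / N) by ring.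
      by rewrite ler_wpM2r ?ler_nat ?subset_leq_card ?finset.subsetIl// divr_ge0 ?mulr_ge0// ltW.
    apply: (@le_trans _ _ (#|bad i|%:R * (8 * 4 ^+ i / N))).
      by rewrite ler_wpM2r ?ler_nat ?subset_leq_card ?finset.subsetIr// divr_ge0 ?mulr_ge0// ltW.
    have p2 : 0 < 2 ^+ i :> R by rewrite exprn_gt0.
    rewrite ler_pdivlMr//; have := cbad i ii.
    have -> : 8 ^+ i = 4 ^+ i * 2 ^+ i :> R by rewrite -exprMn; congr (_ ^+ _); ring.
    move=> hb; have -> : #|bad i|%:R * (8 * 4 ^+ i / N) * 2 ^+ i = 8 * (#|bad i|%:R * (4 ^+ i * 2 ^+ i)) / N.
      by ring.
    by rewrite ler_pdivrMr// -mulrA ler_pM2l.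
  apply: le_trans (geometric_split _ _ _ _) _.
  + by rewrite divr_ge0 ?mulr_ge0// ltW.
  + by rewrite mulr_ge0.
  + apply: lerD.
      have : 0 <= #|U|%:R * (4 ^+ i1 / N) by rewrite mulr_ge0// divr_ge0// ltW.
      have -> : 8 * #|U|%:R / N * 4 ^+ i1 / 3 = 8 / 3 * (#|U|%:R * (4 ^+ i1 / N)) by field; rewrite gt_eqF.
      have -> : #|U|%:R * (3 * 4 ^+ i1 / N) = 3 * (#|U|%:R * (4 ^+ i1 / N)) by ring.
      lra.
    by rewrite mulrA -natrM.
Qed.

Lemma residue_class_le (U : {set V}) (c : V -> R) (dep : V -> nat) (D : nat) :
  (forall v, 0 <= c v) -> (0 < D)%N ->
  exists j, \sum_(v in U | (D %| dep v + j)%N) c v <= (\sum_(v in U) c v) / D%:R.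
Proof.
move=> c0 D0; have DR : 0 < D%:R :> R by rewrite ltr0n.
set S := \sum_(v in U) c v.
pose s (j : 'I_D) := \sum_(v in U | (D %| dep v + j)%N) c v.
have hS : \sum_j s j <= S.
  rewrite /s /S (exchange_big_dep (mem U))/=; last by move=> j v _ /andP[].
  apply: ler_sum => v vU; under eq_bigl do rewrite vU.
  case: (pickP (fun j : 'I_D => (D %| dep v + j)%N)) => [j hj|h0]; last first.
    by rewrite big_pred0//= => j; rewrite h0.
  rewrite (big_pred1 j)//= => j'; apply/idP/eqP => [hj'|->//].
  apply/val_inj => /=; have : ((dep v + j') = (dep v + j) %[mod D])%N.
    by move: hj hj'; rewrite /dvdn => /eqP-> /eqP->.
  by move/eqP; rewrite eqn_modDl !modn_small// => /eqP.
apply: contrapT => /forallNP h.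
have : \sum_(j < D) (S / D%:R) < \sum_j s j.
  case: D D0 @s hS h DR => // D _ s hS h DR; apply: ltr_sum => //; last by move=> j _; rewrite ltNge; apply/negP/h.
  by apply/hasP; exists ord0; rewrite ?mem_index_enum.
by rewrite sumr_const card_ord -[_ *+ D]mulr_natr divfK ?gt_eqF// ltNge hS.
Qed.

(** Nothing is removed from [G]: the connections of the cut vertices to the core are added to it,
    and breadth-first search extracts the shallow tree. The part of [G] around its own root [v0],
    above the first cuts, is reached from [r] through [F0] instead of the core. *)
Lemma cut_tree G v0 FQ K Q (c : V -> R) h F0 h0 r T k D :
  is_tree G -> v0 \in G.1 -> T \subset G.1 ->
  (forall q, q \in Q -> reach FQ K r q) -> (forall v, 0 <= c v) ->
  (forall v, joined w Q h (c v) v) -> reach F0 h0 r v0 -> (0 < D)%N ->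
  (K + h + D <= k)%N -> (h0 + D <= k)%N ->
  steiner_depth_min w T r k <= weight w G + wt w FQ + wt w F0 + (\sum_(v in G.1) c v) / D%:R.
Proof.
move=> tG v0G sT rQ c0 jc r0 D0 k1 k2.
have [par [dep [d0 _ hp _ _]]] := tree_parent_weight e0 w_ge0 tG v0G.
have [j hj] := residue_class_le G.1 dep c0 D0.
have /boolp.choice[Fv hF] : forall v, exists F, (exists2 q, q \in Q & reach F h q v) /\ wt w F <= c v.
  by move=> v; have [F [q [? ? ?]]] := jc v; exists F; split=> //; exists q.
pose X : {set V} := [set v in G.1 | (D %| dep v + j)%N]%SET.
pose FX : {set edge V} := (\bigcup_(v in X) Fv v)%SET.
pose F : {set edge V} := (G.2 :|: FQ :|: F0 :|: FX)%SET.
have F1 : G.2 \subset F by apply/fintype.subsetP => e; rewrite !inE => ->.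
have F2 : FQ \subset F by apply/fintype.subsetP => e; rewrite !inE => ->; rewrite !orbT.
have F3 : F0 \subset F by apply/fintype.subsetP => e; rewrite !inE => ->; rewrite !orbT.
have F4 v : v \in X -> Fv v \subset F.
  move=> vX; apply: fintype.subset_trans (finset.subsetUr _ _).
  exact: (finset.bigcup_sup v).
(* Going up from [u] meets a cut vertex or [v0] within [(dep u + j) %% D] steps, since the residue
   falls by 1 at each step and is 0 exactly at the cut levels. *)
have main u : u \in G.1 -> exists x i, [/\ (x == v0) || (x \in X), reach F i x u & (i <= (dep u + j) %% D)%N].
  move E : (dep u) => d; elim: d u E => [|d IH] u du uG.
    exists u, 0%N; split=> //; last exact: reach0.
    by apply/orP; left; apply: contraT => uv; have [_ _ _] := hp u uG uv; rewrite du.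
  have [uX|uX] := boolP (u \in X).
    by exists u, 0%N; split=> //; [rewrite uX orbT|exact: reach0].
  have [->|uv] := eqVneq u v0; first by exists v0, 0%N; split; rewrite ?eqxx//; exact: reach0.
  have [pG un eG] := hp u uG uv; rewrite du => -[/esym dp].
  have [x [i [xX rx ix]]] := IH _ dp pG.
  exists x, i.+1; split=> //.
    rewrite -addn1; apply: reach_cat rx _; apply: reach_nbr.
    by rewrite (nbrE e0) eq_sym un egC (fintype.subsetP F1).
  move: uX; rewrite inE uG /= du addSn /dvdn => uX.
  by rewrite modnS /dvdn (negbTE uX) ltnS.
have hk t : t \in T -> reach F k r t.
  move=> /(fintype.subsetP sT)/main[x [i [xX rx ix]]].
  have iD : (i < D)%N by apply: leq_ltn_trans ix _; rewrite ltn_mod.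
  case/orP: xX => [/eqP xE|xX].
    apply: (reach_mono (subxx F) _ (reach_cat (reach_mono F3 (leqnn _) r0) _)); last by rewrite -xE; exact: rx.
    by apply: leq_trans k2; rewrite leq_add2l ltnW.
  have [[q qQ rq] _] := hF x.
  have rr := reach_cat (reach_mono F2 (leqnn _) (rQ q qQ)) (reach_mono (F4 x xX) (leqnn _) rq).
  apply: (reach_mono (subxx F) _ (reach_cat rr rx)).
  by apply: leq_trans k1; rewrite leq_add2l ltnW.
apply: le_trans (steiner_depth_le w_ge0 hk) _.
rewrite /F; apply: le_trans (wtU w_ge0 _ _) _; apply: lerD.
  apply: le_trans (wtU w_ge0 _ _) _; apply: lerD => //.
  by apply: le_trans (wtU w_ge0 _ _) _; apply: lerD.
apply: le_trans (wt_bigcup w_ge0 _ _) _; apply: le_trans hj.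
rewrite (eq_bigl (fun v => (v \in G.1) && (D %| dep v + j)%N)); last by move=> v; rewrite inE.
by apply: ler_sum => v _; case: (hF v).
Qed.
End Costs.

(** * Elementary estimates for the choice of constants *)

Section Constants.
Context {R : realType}.
Implicit Types x y h : R.

Lemma ler_sqr_nneg x y : 0 <= x -> 0 <= y -> x ^+ 2 <= y ^+ 2 -> x <= y.
Proof. by move=> x0 y0; rewrite ler_sqr. Qed.

Lemma pow2_between x : 1 <= x -> exists i : nat, x <= 2 ^+ i <= 2 * x.
Proof.
move=> x1; have ex : exists i, x <= 2 ^+ i :> R.
  exists (Num.truncn x).+1; apply: ltW; apply: lt_le_trans (truncnS_gt x) _.
  by rewrite -natrX ler_nat ltnW// ltn_expl.
case: (ex_minnP ex) => [[|i]] h hmin.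
  by exists 0%N; rewrite h expr0; lra.
exists i.+1; rewrite h /= exprS ler_pM2l// leNgt; apply/negP => h2.
by have := hmin i (ltW h2); rewrite ltnn.
Qed.

Lemma exp_decay_small (c : R) : 0 < c -> exists2 x : R, 2 <= x & (1 + x) * expR (- x) <= c.
Proof.
move=> c0; exists (2 + 4 / c); first by rewrite lerDl divr_ge0// ltW.
set x := 2 + 4 / c; have x2 : 2 <= x by rewrite lerDl divr_ge0// ltW.
have x0 : 0 <= x by lra.
have h := pow_div_fact_le_expR 2 x0; rewrite expRN ler_pdivrMr ?expR_gt0//.
have cx : 4 <= c * x by rewrite /x mulrDr mulrCA mulfV ?gt_eqF// mulr1 lerDr mulr_ge0// ltW.
have h' : x ^+ 2 / 2 <= expR x by apply: le_trans h; rewrite ler_pM2l ?exprn_gt0//; lra.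
apply: (@le_trans _ _ (c * (x ^+ 2 / 2))); last by rewrite ler_pM2l.
rewrite expr2; nra.
Qed.

(** The sixth power is the product of [lam ^+ 2] and [(lam ^+ 2) ^+ 2] that arises in
    [steiner_scale_bound]. *)
Lemma log_power_bound (C : R) : 2 <= C -> exists2 B : R, 1 <= B &
  forall h, 1 <= h -> (C + 2 * ln h) ^+ 6 <= B * h.
Proof.
move=> C2; exists (C ^+ 6 * (720 * expR 1)).
  have e1 := @expR1_gt2 R.
  have : 1 <= C ^+ 6 by rewrite exprn_ege1//; lra.
  move: (C ^+ 6) => z z1; nra.
move=> h h1; have h0 : 0 < h by lra.
have l0 := ln_ge0 h1.
apply: (@le_trans _ _ ((C * (1 + ln h)) ^+ 6)).
  by apply: lerXn2r; rewrite ?nnegrE; nra.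
rewrite exprMn -[leRHS]mulrA ler_pM2l ?exprn_gt0//; last by lra.
have l1 : 0 <= 1 + ln h by lra.
have := pow_div_fact_le_expR 6 l1; rewrite expRD lnK ?posrE//.
have -> : 6`!%:R = 720 :> R by rewrite (_ : 6`! = 720%N).
by rewrite ler_pdivrMr ?ltr0n//; lra.
Qed.

(** The coefficient 2 of [ln h] produces [h ^- 2]: one factor pays for [1 + C + 2 * ln h], which is
    at most [(1 + C) * (2 * h)], the other is the [1 / h] of the bound. The constant 832 is
    [2 * 208 * 2]. *)
Lemma core_cost_small (CG eta : R) : 1 <= CG -> 0 < eta -> exists2 C : R, 2 <= C &
  forall h, 1 <= h -> 2 * core_cost CG (C + 2 * ln h) <= eta / h.
Proof.
move=> CG1 eta0; have CG0 : 0 < CG by lra.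
have p832 : 0 < 832 * CG * expR 2.
  have : 0 < CG * expR 2 by rewrite mulr_gt0 ?expR_gt0.
  by rewrite -mulrA; move: (CG * _) => z z0; lra.
have c0 : 0 < eta / (832 * CG * expR 2) by apply: divr_gt0.
have [C C2 hC] := exp_decay_small c0; exists C => // h h1.
have h0 : 0 < h by lra.
have l0 := ln_ge0 h1.
rewrite /core_cost.
have -> : expR (2 - (C + 2 * ln h)) = expR 2 * expR (- C) / h ^+ 2.
  have -> : 2 - (C + 2 * ln h) = 2 + - C + 2 * - ln h by ring.
  have e : expR (2 * - ln h) = (h ^+ 2)^-1 by rewrite expRM_natl expRN lnK ?posrE// exprVn.
  by rewrite !expRD e.
have lh : ln h <= h - 1 by apply: ln_le_subr1.
have h2 : 1 + (C + 2 * ln h) <= (1 + C) * (2 * h) by nra.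
move: hC; rewrite ler_pdivlMr// => hC.
rewrite ler_pdivlMr//.
apply: (@le_trans _ _ (2 * (208 * CG * (expR 2 * expR (- C) / h ^+ 2) * ((1 + C) * (2 * h))) * h)).
  have p208 : 0 < 208 * CG * (expR 2 * expR (- C) / h ^+ 2).
    by apply: mulr_gt0; [lra|rewrite divr_gt0 ?mulr_gt0 ?exprn_gt0 ?expR_gt0].
  by rewrite ler_pM2r// ler_pM2l// ler_pM2l.
apply: le_trans hC; rewrite le_eqVlt; apply/orP; left; apply/eqP; field; rewrite gt_eqF//.
Qed.
End Constants.

(** * The core together with the joining costs *)

Section Network.
Variable R : realType.

(* A cheap shallow core [Q] around the root, to which all vertices can be joined
   by [O(lam)] edges at total cost [O(1)], where [lam] is of order [ln h]. *)
Lemma network_exists (CG t0 eta : R) : 1 <= CG -> 0 < t0 -> 0 < eta ->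
  exists C Bl B4 n0 : R, [/\ 2 <= C, 1 <= Bl, 1 <= B4 &
  forall (V : finType) (e0 : edge V) (w : edge V -> R) (r : V) (h : R) (K : nat),
  (forall e, 0 <= w e) -> expander e0 CG t0 w -> n0 <= #|V|%:R -> 1 <= h -> h <= #|V|%:R ->
  ln #|V|%:R <= 2 ^+ K :> R ->
  let lam := 2 + C + 2 * ln h in
  lam ^+ 6 <= Bl * h /\
  exists (FQ : {set edge V}) (Q : {set V}) (J : nat) (c : V -> R),
    [/\ forall q, q \in Q -> reach FQ K r q, wt w FQ <= eta / h, J%:R <= 2 * lam + 3,
        (forall v, 0 <= c v) /\ (forall v, joined w Q J (c v) v) &
        forall (U : {set V}) (i1 : nat), \sum_(v in U) c v <=
          #|U|%:R * (B4 * (lam ^+ 2 + 4 ^+ i1) / #|V|%:R) + B4 / 2 ^+ i1]].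
Proof.
move=> CG1 t00 eta0; have CG0 : 0 < CG by lra.
have m0 : 0 < Num.min eta t0 by rewrite lt_min eta0.
have [C C2 hC] := core_cost_small CG1 m0.
have C4 : 2 <= 2 + C by lra.
have [Bl Bl1 hBl] := log_power_bound C4.
(* From this scale on [sg = 2 ^+ i >= 32 * CG], which yields both lower bounds on [sg] required by
   [bad2_le]: its logarithmic term is at most [16 * CG * sg]. *)
pose i0 := (Num.truncn (32 * CG)).+1.
have hi0 : 32 * CG <= 2 ^+ i0.
  apply: ltW; apply: lt_le_trans (truncnS_gt _) _.
  by rewrite -natrX ler_nat ltnW// ltn_expl.
pose k2 : R := 256 * CG ^+ 2.
have k2_1 : 1 <= k2 by rewrite /k2; nra.
pose t1 := Num.min t0 1.
have t1_0 : 0 < t1 by rewrite lt_min t00 ltr01.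
have t1_1 : t1 <= 1 by rewrite ge_min lexx orbT.
have t1_t0 : t1 <= t0 by rewrite ge_min lexx.
pose B4 := 39 * CG + 2 * 4 ^+ i0 + 3 + 16 * k2.
have p4 i : 1 <= 4 ^+ i :> R by rewrite exprn_ege1//; clear; lra.
(* The summands of the last witness ensure, in this order, [td <= t0], [4 ^+ I <= t1 * N] and
   [i0 <= I]. *)
exists C, Bl, B4, (1 + 169 * CG ^+ 2 * Bl / t0 ^+ 2 + 64 * k2 ^+ 2 / t1 ^+ 3 + 8 ^+ i0).
split=> //; first by have := p4 i0; rewrite /B4; clear -CG0 k2_1; lra.
move=> V e0 w r h K w0 HG nV h1 hn lnK' lam.
set N : R := #|V|%:R in nV hn lnK' *.
have q1 : 0 <= 169 * CG ^+ 2 * Bl / t0 ^+ 2.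
  apply: divr_ge0; last exact: sqr_ge0.
  by apply: mulr_ge0; [apply: mulr_ge0; [exact: ler0n|exact: sqr_ge0]|apply: le_trans Bl1; exact: ler01].
have q2 : 0 <= 64 * k2 ^+ 2 / t1 ^+ 3.
  by apply: divr_ge0; [apply: mulr_ge0; [exact: ler0n|exact: sqr_ge0]|apply: exprn_ge0; exact: ltW].
have q3 : 0 <= 8 ^+ i0 :> R by rewrite exprn_ge0.
have N1 : 1 <= N by clear -nV q1 q2 q3; lra.
have N0 : 0 < N by apply: lt_le_trans N1.
have h0 : 0 < h by apply: lt_le_trans h1.
have l0 := ln_ge0 h1.
have lam6 : lam ^+ 6 <= Bl * h by apply: hBl.
split=> //.
have lam1 : 1 <= lam by rewrite /lam; clear -C2 l0; lra.
set y := C + 2 * ln h.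
have y2 : 2 <= y by rewrite /y; clear -C2 l0; lra.
have cch := hC h h1; rewrite -/y in cch.
have cc0 : 0 <= core_cost CG y by apply: core_cost_ge0 => //; clear -y2; lra.
have cct : core_cost CG y <= t0.
  have mt : Num.min eta t0 / h <= t0.
    by rewrite ler_pdivrMr// ge_min; apply/orP; right; rewrite ler_peMr// ltW.
  by move: cch cc0 mt; move: (core_cost CG y) (_ / h) => u v; clear; lra.
have [FQ [Q [cQ rQ wQ]]] := core (e0 := e0) CG1 w0 HG r y2 cct lnK'.
have QR : 0 < #|Q|%:R :> R by apply: lt_trans cQ; rewrite mulr_gt0 ?expR_gt0.
have Q0 : (0 < #|Q|)%N by rewrite -(ltr0n R).
have lnQ : ln (expR 1 * N / #|Q|%:R) <= lam.
  rewrite -ler_expR lnK ?posrE ?divr_gt0 ?mulr_gt0 ?expR_gt0// ler_pdivrMr//.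
  have -> : lam = 1 + (1 + y) by rewrite /lam /y; ring.
  rewrite (expRD 1) -mulrA ler_pM2l ?expR_gt0//; apply: ltW.
  by move: cQ; rewrite -/N expRN ltr_pdivrMr ?expR_gt0// mulrC.
pose td := 13 * CG * lam / N.
have lamS : lam ^+ 2 <= Bl * N.
  apply: (@le_trans _ _ (lam ^+ 6)); first by rewrite ler_weXn2l.
  by apply: le_trans lam6 _; rewrite ler_pM2l//; clear -Bl1; lra.
have tdt0 : td <= t0.
  rewrite ler_pdivrMr//; apply: ler_sqr_nneg.
  - by apply: mulr_ge0; [apply: mulr_ge0; [exact: ler0n|exact: ltW]|apply: le_trans lam1; exact: ler01].
  - by rewrite mulr_ge0// ltW.
  rewrite !exprMn; have -> : 13 ^+ 2 = 169 :> R by ring.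
  apply: (@le_trans _ _ (169 * CG ^+ 2 * (Bl * N))); first by
    apply: ler_wpM2l; [apply: mulr_ge0; [exact: ler0n|exact: sqr_ge0]|exact: lamS].
  rewrite (_ : t0 ^+ 2 * N ^+ 2 = (t0 ^+ 2 * N) * N); last by ring.
  rewrite mulrA ler_pM2r// [leRHS]mulrC -ler_pdivrMr ?exprn_gt0//; clear -nV q2 q3; lra.
pose J := (Num.truncn (2 * lam)).+1.
have J_ge : 2 * lam <= J%:R by apply: ltW; apply: truncnS_gt.
have J_le : J%:R <= 2 * lam + 1.
  have -> : J%:R = (Num.truncn (2 * lam))%:R + 1 :> R by rewrite natr1.
  by rewrite lerD2r truncn_le; apply: mulr_ge0; [exact: ler0n|apply: le_trans lam1; exact: ler01].
have q4 := doubling_quarter CG1 w0 HG Q0 lnQ tdt0 J_ge.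
set c0 := J%:R * (13 * CG * lam / #|V|%:R) in q4.
have c0E : c0 = J%:R * td by [].
have td0 : 0 <= td.
  apply: divr_ge0; last exact: ltW.
  by apply: mulr_ge0; [apply: mulr_ge0; [exact: ler0n|exact: ltW]|apply: le_trans lam1; exact: ler01].
have c0_ge0 : 0 <= c0 by rewrite c0E mulr_ge0.
have c0_le : c0 <= 39 * CG * lam ^+ 2 / N.
  rewrite c0E; apply: (@le_trans _ _ (3 * lam * td)); first by rewrite ler_wpM2r//; clear -J_le lam1; lra.
  by rewrite /td le_eqVlt; apply/orP; left; apply/eqP; ring.
(* At such a scale the bound on the number of bad vertices drops below 1, so none is left. *)
have exI : exists I, k2 * N < 8 ^+ I.
  exists (Num.truncn (k2 * N)).+1; apply: lt_le_trans (truncnS_gt _) _.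
  by rewrite -natrX ler_nat ltnW// ltn_expl.
case: (ex_minnP exI) => I hI Imin.
have k2N : 1 <= k2 * N by rewrite -[1]mulr1; apply: ler_pM.
have I0 : (0 < I)%N by rewrite lt0n; apply: contraTneq hI => ->; rewrite expr0 -leNgt.
have hI' : 8 ^+ I <= 8 * (k2 * N).
  case: I I0 hI Imin => // I _ hI Imin; rewrite exprS ler_pM2l// leNgt; apply/negP => h8.
  by have := Imin I h8; rewrite ltnn.
have i0I : (i0 <= I)%N.
  rewrite leqNgt; apply/negP => Ii0.
  have : 8 ^+ I <= 8 ^+ i0 :> R by apply: ler_weXn2l; [clear; lra|exact: ltnW].
  have : N <= k2 * N by rewrite ler_peMl// ltW.
  by clear -hI nV q1 q2; lra.
(* Since [8 ^+ I = O(N)], [4 ^+ I] is only of order [N ^ (2 / 3)], and the thresholds of all scales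
   stay below [t0]. *)
have hI4 : 4 ^+ I <= t1 * N.
  have tN : 0 <= t1 * N by apply/ltW/mulr_gt0.
  rewrite -(@ler_pXn2r _ 3)// ?nnegrE ?exprn_ge0//.
  have -> : (4 ^+ I) ^+ 3 = (8 ^+ I) ^+ 2 :> R.
    rewrite -!exprM mulnC exprM (mulnC I) [RHS]exprM; congr (_ ^+ _); ring.
  apply: (@le_trans _ _ ((8 * (k2 * N)) ^+ 2)).
    by apply: lerXn2r; rewrite ?nnegrE ?exprn_ge0//; clear -k2N; lra.
  rewrite (_ : (8 * (k2 * N)) ^+ 2 = 64 * k2 ^+ 2 * N ^+ 2); last by ring.
  rewrite (_ : (t1 * N) ^+ 3 = (N * t1 ^+ 3) * N ^+ 2); last by ring.
  rewrite ler_pM2r ?exprn_gt0// -ler_pdivrMr ?exprn_gt0//; clear -nV q1 q3; lra.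
have cond i : (i0 <= i <= I)%N -> #|bad2 w Q J c0 (4 ^+ i)|%:R * 8 ^+ i <= k2 * N.
  case/andP=> i0i iI.
  have E4 : 4 ^+ i = (2 ^+ i) ^+ 2 :> R by rewrite -exprM mulnC exprM; congr (_ ^+ _); ring.
  have E8 : 8 ^+ i = (2 ^+ i) ^+ 3 :> R by rewrite -exprM mulnC exprM; congr (_ ^+ _); ring.
  have i4 : 4 ^+ i <= t1 * N by apply: le_trans hI4; apply: ler_weXn2l => //; clear; lra.
  have p2 : 32 * CG <= 2 ^+ i by apply: le_trans hi0 _; apply: ler_weXn2l => //; clear; lra.
  have p2_1 : 1 <= 2 ^+ i :> R by clear -p2 CG1; lra.
  rewrite E4 E8; apply: (bad2_le CG1 w0 HG c0_ge0 q4) => //.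
  - by rewrite expr2; clear -p2 p2_1 CG1; nra.
  - rewrite -E4; apply: le_trans i4 _; rewrite -/N ler_pM2r//; clear -t1_1 CG1; lra.
  - by rewrite -E4 ler_pdivrMr//; apply: le_trans i4 _; rewrite ler_pM2r.
  rewrite lnXn// -[_ *+ i]mulr_natl.
  have ln21 : ln 2 <= 1 :> R by have := @ln_le_subr1 R 2 ltac:(clear; lra); clear; lra.
  have ii : i.+1%:R <= 2 ^+ i :> R by rewrite -natrX ler_nat ltn_expl.
  have iR : 0 <= i%:R :> R by [].
  have i3 : 1 + 3 * (i%:R * ln 2) <= 4 * 2 ^+ i :> R.
    have ii' : i%:R + 1 <= 2 ^+ i :> R by rewrite natr1.
    have : i%:R * ln 2 <= i%:R :> R by rewrite ler_piMr.
    by clear -ii' iR p2_1; lra.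
  apply: (@le_trans _ _ (4 * CG * (4 * 2 ^+ i))); first by rewrite ler_pM2l//; clear -CG0; lra.
  by rewrite expr2; move: p2 p2_1; clear -CG0; move: (2 ^+ i) => a; nra.
have badI : bad2 w Q J c0 (4 ^+ I) = finset.set0.
  apply/eqP; rewrite -cards_eq0 -leqn0 -ltnS -(ltr_nat R).
  have p8 : 0 < 8 ^+ I :> R by rewrite exprn_gt0.
  rewrite -(ltr_pM2r p8) mul1r; apply: le_lt_trans hI; apply: cond.
  by rewrite i0I leqnn.
have k20 : 0 <= k2 by apply: le_trans k2_1; exact: ler01.
have cond' i : (i0 <= i < I)%N -> #|bad2 w Q J c0 (4 ^+ i)|%:R * 8 ^+ i <= k2 * N.
  by case/andP=> a b; apply: cond; rewrite a ltnW.
have [c [c_ge0 jc sc]] := @joining_cost V R w Q J.+2 c0 k2 N (fun i => bad2 w Q J c0 (4 ^+ i)) i0 I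
  c0_ge0 k20 N0 i0I badI cond'
  (fun i v _ hv => elimT (bad2P w Q J c0 (4 ^+ i) v) hv).
exists FQ, Q, J.+2, c; split=> //.
- apply: le_trans wQ _; apply: le_trans cch _; rewrite ler_pM2r ?invr_gt0//.
  by rewrite ge_min lexx.
- by have -> : J.+2%:R = J%:R + 2 :> R; [rewrite -addn2 natrD|clear -J_le; lra].
- move=> U i1; apply: le_trans (sc U i1) _.
  have lam2 : 1 <= lam ^+ 2 by rewrite exprn_ege1.
  have := p4 i1; have := p4 i0 => p40 p41.
  apply: lerD.
    rewrite ler_wpM2l//; apply: (@le_trans _ _ (39 * CG * lam ^+ 2 / N + (2 * 4 ^+ i0 + 3 * 4 ^+ i1) / N)).
      by rewrite lerD2r.
    rewrite -mulrDl ler_pM2r ?invr_gt0// /B4.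
    move: (4 ^+ i0) (4 ^+ i1) (lam ^+ 2) p40 p41 lam2 => z1 z2 z3 p40 p41 lam2.
    clear -CG0 k20 p40 p41 lam2; rewrite mulrDr; have : 0 <= k2 * z3 by rewrite mulr_ge0//; lra.
    have : 0 <= k2 * z2 by rewrite mulr_ge0//; lra.
    have : 0 <= CG * z2 by rewrite mulr_ge0//; lra.
    have : z1 <= z1 * z3 by nra.
    have : 0 <= z1 * z2 by nra.
    nra.
  by rewrite ler_pM2r ?invr_gt0 ?exprn_gt0// /B4; have := p40; clear -CG0 k20; lra.
Qed.
End Network.

Ltac nonneg := first [ done | exact: ltW | (apply: divr_ge0; nonneg) | (apply: addr_ge0; nonneg)
  | (apply: mulr_ge0; nonneg) | (apply: exprn_ge0; nonneg) | (rewrite invr_ge0; nonneg) ].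

(** * Numerical estimates behind the ratio *)

Section RatioArith.
Variable R : realType.

(** Here [L2] is [lam ^+ 2], [M] the number of terminals and [P = 2 ^+ i1], [p = 4 ^+ i1] for a
    crossover with [P] of order [L2]. The joining costs of the terminals are then [O(L2 ^+ 2 / h)]
    and [O(1 / L2)], and the former is [O(1 / L2)] too because [lam ^+ 6 = O(h)]. *)
Lemma steiner_scale_bound (eta B4 Bl L2 h N S wq sg M P p : R) :
  0 < h -> 0 < N -> 0 <= eta -> 1 <= B4 -> 1 <= L2 -> L2 * L2 ^+ 2 <= Bl * h -> L2 <= P -> p <= 4 * L2 ^+ 2 ->
  M / N <= 1 / h -> 0 <= M -> S <= wq + sg -> wq <= eta / h -> sg <= M * (B4 * (L2 + p) / N) + B4 / P ->
  L2 * S <= Bl * (eta + 5 * B4) + B4.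
Proof.
move=> h0 N0 eta0 B41 L21 L6 LP p4 Mh M0 hS hw hs.
have L20 : 0 < L2 by lra.
have L24 : L2 <= L2 ^+ 2 by rewrite expr2 ler_peMr//; nonneg.
have L46 : L2 ^+ 2 <= L2 * L2 ^+ 2 by rewrite ler_peMl//; nonneg.
have x6 : (L2 * L2 ^+ 2) / h <= Bl by rewrite ler_pdivrMr.
have x2 : L2 / h <= Bl by apply: le_trans x6; rewrite ler_pM2r ?invr_gt0//; lra.
have P0 : 0 < P by lra.
have xP : L2 / P <= 1 by rewrite ler_pdivrMr// mul1r.
have s1 : M * (B4 * (L2 + p) / N) <= 1 / h * (B4 * (5 * L2 ^+ 2)).
  have -> : M * (B4 * (L2 + p) / N) = (M / N) * (B4 * (L2 + p)) by ring.
  apply: (@le_trans _ _ ((M / N) * (B4 * (5 * L2 ^+ 2)))).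
    by rewrite ler_wpM2l ?ler_pM2l//; [nonneg|lra|lra].
  by rewrite ler_wpM2r// !mulr_ge0 ?exprn_ge0//; lra.
apply: (@le_trans _ _ (L2 * (eta / h + (1 / h * (B4 * (5 * L2 ^+ 2)) + B4 / P)))).
  by rewrite ler_pM2l//; move: hS hw hs s1; clear; lra.
have -> : L2 * (eta / h + (1 / h * (B4 * (5 * L2 ^+ 2)) + B4 / P))
   = (L2 / h) * eta + ((L2 * L2 ^+ 2) / h) * (5 * B4) + (L2 / P) * B4 by ring.
have t1 : (L2 / h) * eta <= Bl * eta by rewrite ler_wpM2r.
have t2 : ((L2 * L2 ^+ 2) / h) * (5 * B4) <= Bl * (5 * B4) by rewrite ler_wpM2r// mulr_ge0//; lra.
have t3 : (L2 / P) * B4 <= 1 * B4 by rewrite ler_wpM2r//; lra.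
by move: t1 t2 t3; clear; lra.
Qed.

(** A tree of weight [O(1 / L2)] has [O(N / L2)] edges: either it has fewer than
    [11 * a = 11 * N / h] edges, or its weight is at least a constant times their number over
    [N]. *)
Lemma tree_size_bound (Bl L2 h N Nt S c' B1 a : R) : 0 < h -> 1 <= L2 -> 0 < a -> 0 < c' -> N = a * h -> L2 <= Bl * h -> 0 <= Bl ->
  0 <= B1 -> L2 * S <= B1 -> (11 * a <= Nt -> c' * Nt / N <= S) -> L2 * (Nt / N) <= 11 * Bl + B1 / c'.
Proof.
move=> h0 L21 a0 c'0 NE L2B Bl0 B10 LS heavy.
have L20 : 0 < L2 by lra.
have q : 0 <= B1 / c' by rewrite divr_ge0// ltW.
have [/heavy hS|lt] := leP (11 * a) Nt.
  have : L2 * (Nt / N) <= B1 / c'.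
    rewrite ler_pdivlMr//; apply: le_trans LS.
    have -> : L2 * (Nt / N) * c' = L2 * (c' * Nt / N) by ring.
    by rewrite ler_pM2l.
  by move: q Bl0; clear; lra.
have : L2 * (Nt / N) <= 11 * Bl.
  apply: (@le_trans _ _ (L2 * (11 / h))).
    rewrite ler_pM2l// NE ler_pdivrMr ?mulr_gt0//.
    have -> : 11 / h * (a * h) = 11 * a by field; rewrite gt_eqF.
    exact: ltW.
  have -> : L2 * (11 / h) = 11 * (L2 / h) by ring.
  by rewrite ler_pM2l// ler_pdivrMr.
by move: q; clear; lra.
Qed.

(** [O(N / L2)] vertices at a cost of order [L2 / N] apiece, with the crossover at scale 0. *)
Lemma joining_sum_bound (B4 Bl L2 h N Nt B2 s : R) : 0 < N -> 1 <= B4 -> 1 <= L2 -> h <= N -> L2 <= Bl * h -> 0 <= Bl -> L2 * (Nt / N) <= B2 ->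
  s <= (Nt + 1) * (B4 * (L2 + 1) / N) + B4 -> 0 <= Nt -> s <= (B2 + Bl) * (2 * B4) + B4.
Proof.
move=> N0 B41 L21 hN L2B Bl0 LN hs Nt0; apply: le_trans hs _; rewrite lerD2r.
have L20 : 0 < L2 by lra.
apply: (@le_trans _ _ ((Nt + 1) * (B4 * (2 * L2) / N))).
  rewrite ler_wpM2l ?addr_ge0//.
  by rewrite ler_pM2r ?invr_gt0// ler_pM2l; lra.
have -> : (Nt + 1) * (B4 * (2 * L2) / N) = (L2 * (Nt / N) + L2 / N) * (2 * B4) by ring.
rewrite ler_wpM2r ?mulr_ge0//; first by lra.
apply: lerD => //; rewrite ler_pdivrMr//; apply: le_trans L2B _.
by rewrite ler_wpM2l.
Qed.

(** Core, link to the root and cutting contribute at most [eps / 4 * S] each; the last because [D']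
    exceeds a large multiple of [h]. *)
Lemma final_bound (eta h S cL eps wQ w0 s B3 D' D Delta B : R) : 0 < h -> eta = eps / 4 * cL -> 0 < eps -> 0 < cL -> 0 <= B3 ->
  D <= S + wQ + w0 + s / D' -> wQ <= eta / h -> w0 <= eps / 4 * (cL / h) -> s <= B3 ->
  cL / h <= S -> Delta / 8 <= D' -> B * h <= Delta -> 8 * (B3 / eta) <= B -> 0 < Delta ->
  D <= (1 + eps) * S.
Proof.
move=> h0 etaE eps0 cL0 B30 hD hQ h00 hs hS hD' BD BB D0.
have e0 : 0 < eta by rewrite etaE mulr_gt0 ?divr_gt0.
have S4 : eta / h <= eps / 4 * S.
  by rewrite etaE -mulrA ler_pM2l// divr_gt0.
have D'0 : 0 < D' by move: hD' D0; clear; lra.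
have sD : s / D' <= eta / h.
  apply: (@le_trans _ _ (B3 / D')); first by rewrite ler_pM2r ?invr_gt0.
  rewrite ler_pdivrMr//.
  have : 8 * B3 <= eta * B.
    by move: BB; rewrite mulrA ler_pdivrMr// [B * _]mulrC.
  have : B * eta <= 8 * D' / h * eta.
    rewrite ler_pM2r// ler_pdivlMr//; move: BD hD'; clear; lra.
  have -> : 8 * D' / h * eta = 8 * (eta / h * D') by ring.
  by clear; lra.
have w04 : w0 <= eps / 4 * S by apply: le_trans h00 _; rewrite ler_pM2l// divr_gt0.
have S0 : 0 <= eps * S by rewrite mulr_ge0 ?ltW//; apply: lt_le_trans hS; rewrite divr_gt0.
move: hD hQ S4 sD w04 S0; clear; lra.
Qed.

(** For a single vertex the crossover [p] is taken of order [h / eta], which makes [B4 / p] a small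
    multiple of [1 / h]. The other term, of order [h ^+ 2 / N], is as small once [N] exceeds a
    multiple of [h ^+ 3]. *)
Lemma single_join_bound (B4 Bl eta h L2 N p q : R) : 0 < N -> 0 < eta -> 1 <= h -> 1 <= B4 -> 0 <= Bl -> L2 <= Bl * h ->
  8 * B4 * (Bl + 8 + 512 * (B4 / eta) ^+ 2) / eta * h ^+ 3 <= N -> 1 + 8 * B4 * h / eta <= p -> p <= 2 * (1 + 8 * B4 * h / eta) ->
  q = p ^+ 2 -> B4 * (L2 + q) / N + B4 / p <= eta / 2 / h.
Proof.
move=> N0 eta0 h1 B41 Bl0 hL h3 p1 p2 ->; have B40 : 0 < B4 by lra.
have h0 : 0 < h by lra.
have e0 : eta != 0 by rewrite gt_eqF.
set P := 8 * B4 * h / eta in p1 p2.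
have P0 : 0 < P by rewrite divr_gt0// !mulr_gt0.
have t1 : B4 / p <= eta / 8 / h.
  have -> : eta / 8 / h = B4 / P by rewrite /P; field; rewrite e0 !gt_eqF.
  by rewrite ler_pM2l// lef_pV2 ?posrE//; move: P0 p1; clear; lra.
have t2 : p ^+ 2 <= 8 + 8 * P ^+ 2.
  apply: (@le_trans _ _ ((2 * (1 + P)) ^+ 2)).
    by rewrite lerXn2r ?nnegrE//; move: P0 p1; clear; lra.
  by have := sqr_ge0 (1 - P); rewrite !expr2; clear; nra.
have h12 : h <= h ^+ 2 by rewrite expr2 ler_peMr// ltW.
have t3 : L2 + p ^+ 2 <= h ^+ 2 * (Bl + 8 + 512 * (B4 / eta) ^+ 2).
  have -> : h ^+ 2 * (Bl + 8 + 512 * (B4 / eta) ^+ 2) = Bl * h ^+ 2 + 8 * h ^+ 2 + 8 * P ^+ 2.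
    by rewrite /P; field.
  have : Bl * h <= Bl * h ^+ 2 by rewrite ler_wpM2l.
  by move: hL t2 h12 h1; clear; lra.
have t4 : B4 * (L2 + p ^+ 2) / N <= eta / 8 / h.
  rewrite ler_pdivrMr//; apply: (@le_trans _ _ (B4 * (h ^+ 2 * (Bl + 8 + 512 * (B4 / eta) ^+ 2)))).
    by rewrite ler_pM2l.
  have -> : B4 * (h ^+ 2 * (Bl + 8 + 512 * (B4 / eta) ^+ 2)) =
     eta / 8 / h * (8 * B4 * (Bl + 8 + 512 * (B4 / eta) ^+ 2) / eta * h ^+ 3) by field; rewrite e0 gt_eqF.
  by rewrite ler_pM2l// !divr_gt0.
have t5 : eta / 2 / h = eta / 8 / h * 4 by field; rewrite gt_eqF.
have : 0 < eta / 8 / h by rewrite !divr_gt0.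
by rewrite t5; move: t1 t4; clear; lra.
Qed.
End RatioArith.

(** * Comparison of the two minima on an expander *)

Section DepthRatio.
Variable R : realType.

Lemma steiner_min_le_joined (V : finType) (e0 : edge V) (w : edge V -> R) (T : {set V}) r
    (FQ : {set edge V}) (Q : {set V}) (K J : nat) (c : V -> R) : (forall e, 0 <= w e) ->
  (forall q, q \in Q -> reach FQ K r q) -> (forall v, joined w Q J (c v) v) ->
  steiner_min w T <= wt w FQ + \sum_(v in T) c v.
Proof.
move=> w0 rQ jc.
have /boolp.choice[Fv hF] : forall v, exists F, (exists2 q, q \in Q & reach F J q v) /\ wt w F <= c v.
  by move=> v; have [F [q [? ? ?]]] := jc v; exists F; split=> //; exists q.
pose FX : {set edge V} := (\bigcup_(v in T) Fv v)%SET.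
have rT t : t \in T -> reach (FQ :|: FX)%SET (K + J).+1 r t.
  move=> tT; have [[q qQ rq] _] := hF t.
  have s1 : FQ \subset (FQ :|: FX)%SET by apply: finset.subsetUl.
  have s2 : Fv t \subset (FQ :|: FX)%SET.
    apply: fintype.subset_trans (finset.subsetUr _ _); exact: (finset.bigcup_sup t).
  apply: (reach_mono (subxx _) (leqnSn _)).
  exact: reach_cat (reach_mono s1 (leqnn _) (rQ q qQ)) (reach_mono s2 (leqnn _) rq).
apply: le_trans (steiner_min_le_depth e0 w0 T r (ltn0Sn (K + J))) _.
apply: le_trans (steiner_depth_le w0 rT) _.
apply: le_trans (wtU w0 _ _) _; rewrite lerD2l.
apply: le_trans (wt_bigcup w0 _ _) _.
by apply: ler_sum => v _; case: (hF v).
Qed.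

Lemma depth_ratio (CG t0 c' cL eps : R) : 1 <= CG -> 0 < t0 -> 0 < c' -> 0 < cL -> 0 < eps ->
  exists B B5 n0 : R, [/\ 0 < B, 0 < B5 &
  forall (V : finType) (e0 : edge V) (w : edge V -> R) (T : {set V}) r v0 (k K : nat) (Delta : R),
  let a := phi #|V|%:R #|T|%:R in let h := #|V|%:R / a in
  (forall e, 0 <= w e) -> expander e0 CG t0 w -> n0 <= #|V|%:R -> v0 \in T ->
  (forall G, steiner_tree T G -> 11 * a <= #|G.1|.-1%:R -> c' * #|G.1|.-1%:R / #|V|%:R <= weight w G) ->
  cL / h <= steiner_min w T -> ln #|V|%:R <= 2 ^+ K :> R -> K%:R + Delta <= k%:R + 1 -> B * h <= Delta ->
  B5 * h ^+ 3 <= #|V|%:R \/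
    (exists F0 h0, [/\ reach F0 h0 r v0, h0%:R <= Delta / 4 & wt w F0 <= eps / 4 * (cL / h)]) ->
  steiner_depth_min w T r k <= (1 + eps) * steiner_min w T].
Proof.
move=> CG1 t00 c'0 cL0 eps0.
have eta0 : 0 < eps / 4 * cL by rewrite mulr_gt0 ?divr_gt0.
have eta20 : 0 < eps / 4 * cL / 2 by rewrite divr_gt0.
have [C [Bl [B4 [n1 [C2 Bl1 B41 net]]]]] := network_exists CG1 t00 eta20.
set eta := eps / 4 * cL in eta0 eta20 net *.
pose B1 := Bl * (eta + 5 * B4) + B4.
pose B2 := 11 * Bl + B1 / c'.
pose B3 := (B2 + Bl) * (2 * B4) + B4.
have Bl_0 : 0 <= Bl by apply: le_trans Bl1.
have B4_0 : 0 <= B4 by apply: le_trans B41.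
have B1_0 : 0 <= B1 by rewrite addr_ge0// mulr_ge0// addr_ge0 ?mulr_ge0// ltW.
have B2_0 : 0 <= B2 by apply: addr_ge0; [exact: mulr_ge0|apply: divr_ge0 => //; exact: ltW].
have B3_0 : 0 <= B3 by nonneg.
(* The 16 absorbs rounding, [4 * Bl] makes room for [4 * lam] levels and so for the [J] joining
   edges, and [8 * B3 / eta] makes the averaged cutting cost negligible. *)
pose B := 16 + 4 * Bl + 8 * B3 / eta.
have q0 : 0 <= B3 / eta by rewrite divr_ge0// ltW.
have BE : B = 16 + 4 * Bl + 8 * (B3 / eta) by rewrite /B mulrA.
pose P (h : R) := 8 * B4 * h / eta.
pose B5 := 8 * B4 * (Bl + 8 + 512 * (B4 / eta) ^+ 2) / eta.
have b4e : 0 <= B4 / eta by rewrite divr_ge0// ltW.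
have B5_0 : 0 < B5.
  have b1 : 0 < B4 by apply: lt_le_trans B41.
  have b2 : 0 <= 512 * (B4 / eta) ^+ 2 by apply: mulr_ge0; [exact: ler0n|exact: exprn_ge0].
  have b3 : 0 < Bl + 8 + 512 * (B4 / eta) ^+ 2 by move: b2 Bl_0; clear; lra.
  apply: divr_gt0; last exact: eta0.
  apply: mulr_gt0; last exact: b3.
  by apply: mulr_gt0; [rewrite ltr0n|exact: b1].
exists B, B5, (1 + n1); split=> //; first by rewrite BE; move: q0 Bl_0; clear; lra.
move=> V e0 w T r v0 k K Delta a h w0 HG nV v0T heavy Sge lnK' kD BD hjoin.
set N : R := #|V|%:R in a h nV lnK' heavy Sge BD hjoin *.
have n0 : (0 < #|V|)%N by apply/card_gt0P; exists v0.
have N0 : 0 < N by rewrite ltr0n.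
have N1 : 1 <= N by rewrite ler1n.
have m0 : (0 < #|T|)%N by apply/card_gt0P; exists v0.
have mR : 1 <= #|T|%:R :> R by rewrite ler1n.
have mn : #|T|%:R <= N by rewrite ler_nat max_card.
have m_0 : 0 < #|T|%:R :> R by rewrite ltr0n.
have am : #|T|%:R <= a by apply: phi_ge.
have aN : a <= N by apply: phi_le.
have a0 : 0 < a by apply: lt_le_trans am.
have hE : N = a * h by rewrite /h mulrCA divff ?gt_eqF// mulr1.
have h1 : 1 <= h by rewrite ler_pdivlMr// mul1r.
have hpos : 0 < h by apply: lt_le_trans h1.
have hN : h <= N by rewrite ler_pdivrMr// ler_peMr//; exact: le_trans mR am.
have nV1 : n1 <= N by move: nV; clear; lra.
have [lam6] := net V e0 w r h K w0 HG nV1 h1 hN lnK'.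
set lam := 2 + C + 2 * ln h in lam6 *.
have lam1 : 1 <= lam by have := ln_ge0 h1; rewrite /lam; move: C2; clear; lra.
move=> [FQ [Q [J [c [rQ wQ2 J_le [c_ge0 jc] sc]]]]].
have wQ : wt w FQ <= eta / h.
  by apply: le_trans wQ2 _; rewrite ler_pM2r ?invr_gt0//; move: eta0; clear; lra.
have lam_pow i : (i <= 6)%N -> lam ^+ i <= Bl * h.
  by move=> i6; apply: le_trans lam6; apply: ler_weXn2l.
have lam2_1 : 1 <= lam ^+ 2 by rewrite exprn_ege1.
have lam2_0 : 0 < lam ^+ 2 by apply: lt_le_trans lam2_1.
set S := steiner_min w T in Sge *.
have S0 : 0 < S by apply: lt_le_trans Sge; rewrite divr_gt0.
have SB : lam ^+ 2 * S <= B1.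
  have [i1 /andP[i1a i1b]] := pow2_between lam2_1.
  have E4 : 4 ^+ i1 = (2 ^+ i1) ^+ 2 :> R by rewrite -exprM mulnC exprM; congr (_ ^+ _); ring.
  have p4 : 4 ^+ i1 <= 4 * (lam ^+ 2) ^+ 2.
    have -> : 4 * (lam ^+ 2) ^+ 2 = (2 * lam ^+ 2) ^+ 2 by ring.
    by rewrite E4; apply: lerXn2r; rewrite ?nnegrE ?exprn_ge0// mulr_ge0// ltW.
  have hS := steiner_min_le_joined e0 T w0 rQ jc; rewrite -/S in hS.
  have mh : #|T|%:R / N <= 1 / h.
    rewrite ler_pdivrMr//; have -> : 1 / h * N = a by rewrite hE mulrCA div1r mulVf ?gt_eqF// mulr1.
    exact: am.
  apply: (steiner_scale_bound hpos N0 (ltW eta0) B41 lam2_1 _ i1a p4 mh _ hS wQ (sc T i1)) => //.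
  by rewrite -exprM -exprD.
have [G [tG sG] SG] := steiner_opt e0 w0 T v0; rewrite -/S in SG.
have v0G : v0 \in G.1 by apply: (fintype.subsetP sG).
have Bl0 : 0 <= Bl by apply: le_trans Bl1.
have NB : lam ^+ 2 * (#|G.1|.-1%:R / N) <= B2.
  apply: (@tree_size_bound _ Bl (lam ^+ 2) h N _ S c' B1 a) => //.
    exact: lam_pow.
  by rewrite SG; apply: heavy.
have G1 : #|G.1|%:R = #|G.1|.-1%:R + 1 :> R.
  by rewrite natr1 prednK//; apply/card_gt0P; exists v0.
have sB : \sum_(v in G.1) c v <= B3.
  apply: (joining_sum_bound N0 B41 lam2_1 hN _ Bl0 NB) => //.
    exact: lam_pow.
  by have := sc G.1 0%N; rewrite G1 !expr0 divr1.
have Dpos : 16 <= Delta.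
  apply: le_trans BD; rewrite BE; apply: (@le_trans _ _ (16 * h)); first by rewrite ler_pMr.
  by rewrite ler_pM2r//; move: q0 Bl0; clear; lra.
have D4 : 4 * lam + 16 <= Delta.
  apply: le_trans BD; rewrite BE.
  have l1 : lam <= Bl * h by rewrite -[lam]expr1; exact: lam_pow.
  have : 0 <= 8 * (B3 / eta) * h by nonneg.
  by move: l1 h1; clear; lra.
(* A quarter of the spare depth separates consecutive cuts. As [4 * lam + 16 <= Delta], the rest
   holds both the [J <= 2 * lam + 3] joining edges and the alternative link of at most [Delta / 4]
   edges. *)
pose D' := Num.truncn (Delta / 4).
have D'le : D'%:R <= Delta / 4 by rewrite truncn_le; move: Dpos; clear; lra.
have D'ge : Delta / 8 <= D'%:R.
  have := truncnS_gt (Delta / 4); rewrite -/D' -(natr1 D'); move: Dpos; clear; lra.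
have D'0 : (0 < D')%N by rewrite -(ltr0n R); move: D'ge Dpos; clear; lra.
have kk1 : (K + J + D' <= k)%N.
  by rewrite -(ler_nat R) !natrD; move: kD J_le D'le D4 Dpos; clear; lra.
have [F0 [h0 [r0 kk2 wF0]]] : exists F0 h0, [/\ reach F0 h0 r v0, (h0 + D' <= k)%N & wt w F0 <= eta / h].
  case: hjoin => [h3|[F0 [h0 [r0 h0D wF0]]]]; last first.
    exists F0, h0; split=> //; last by move: wF0; rewrite mulrA.
    rewrite -(ler_nat R) !natrD; have : 0 <= K%:R :> R by [].
    by move: kD h0D D'le Dpos; clear; lra.
  have [F [q [qQ rq wF]]] := jc v0.
  exists (FQ :|: F)%SET, (K + J)%N; split=> //.
    apply: (reach_cat (y := q)); first by apply: reach_mono (rQ q qQ) => //; apply: finset.subsetUl.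
    by apply: reach_mono rq => //; apply: finset.subsetUr.
  apply: le_trans (wtU w0 _ _) _.
  have cv0 : c v0 <= eta / 2 / h.
    have P1 : 1 <= 1 + P h by rewrite lerDl divr_ge0 ?(ltW eta0)// mulr_ge0 ?(ltW hpos)// mulr_ge0.
    have [i1 /andP[i1a i1b]] := pow2_between P1.
    have := sc [set v0]%SET i1; rewrite big_set1 cards1 mul1r => /le_trans; apply.
    have E4 : 4 ^+ i1 = (2 ^+ i1) ^+ 2 :> R by rewrite -exprM mulnC exprM; congr (_ ^+ _); ring.
    have l2 := lam_pow 2%N isT.
    exact: (single_join_bound N0 eta0 h1 B41 Bl_0 l2 h3 i1a _ E4).
  have -> : eta / h = eta / 2 / h + eta / 2 / h by field; rewrite gt_eqF.
  apply: lerD; [exact: wQ2|exact: le_trans wF cv0].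
have hD := cut_tree e0 w0 tG v0G sG rQ c_ge0 jc r0 D'0 kk1 kk2.
rewrite -SG in hD.
have {}wF0 : wt w F0 <= eps / 4 * (cL / h) by move: wF0; rewrite /eta -mulrA.
apply: (final_bound hpos (erefl eta) eps0 cL0 B3_0 hD wQ wF0 sB Sge D'ge BD).
  by rewrite BE; move: Bl0; clear; lra.
by move: Dpos; clear; lra.
Qed.
End DepthRatio.

(** * Union bounds *)

Section Small.
Variables (R : realType) (d : measure_display) (Omega : measurableType d) (P : probability Omega R).
Implicit Types (A B : set Omega) (p q : R).

(* An outer-measure bound: it makes the union bounds below independent of the
   measurability of the events involved. *)
Definition small A p : Prop := exists2 B, measurable B & A `<=` B /\ (P B <= p%:E)%E.

Lemma small_sub A B p q : A `<=` B -> p <= q -> small B p -> small A q.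
Proof.
move=> AB pq [C mC [BC hC]]; exists C => //; split; first exact: subset_trans BC.
by apply: le_trans hC _; rewrite lee_fin.
Qed.

Lemma small_prob A p : measurable A -> (P A <= p%:E)%E -> small A p.
Proof. by move=> mA h; exists A => //; split. Qed.

Lemma prob_small A p : measurable A -> small A p -> (P A <= p%:E)%E.
Proof. by move=> mA [B mB [AB h]]; apply: le_trans h; apply: le_measure; rewrite ?inE. Qed.

Lemma small_ge0 A p : small A p -> 0 <= p.
Proof. by move=> [B mB [_ h]]; rewrite -lee_fin; apply: le_trans h. Qed.

Lemma small_set0 : small set0 0.
Proof. by apply: small_prob => //; rewrite measure0. Qed.

Lemma smallU A B p q : small A p -> small B q -> small (A `|` B) (p + q).
Proof.
move=> [C mC [AC hC]] [C' mC' [BC' hC']]; exists (C `|` C'); first exact: measurableU.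
split; first exact: setUSS.
by apply: (le_trans (measureU2 P mC mC')); rewrite EFinD leeD.
Qed.

Lemma small_exists (I : finType) (Q : pred I) (A : I -> set Omega) (p : I -> R) :
  (forall i, Q i -> small (A i) (p i)) ->
  small [set x | exists i, Q i /\ A i x] (\sum_(i | Q i) p i).
Proof.
move=> h; have : forall s : seq I, small [set x | exists i, [/\ i \in s, Q i & A i x]] (\sum_(i <- s | Q i) p i).
  elim=> [|i s IH].
    by rewrite big_nil; apply: small_sub small_set0 => // x [i []].
  rewrite big_cons; case: ifP => Qi.
    apply: small_sub (smallU (h i Qi) IH) => // x [j []].
    by rewrite inE => /orP[/eqP->|js] Qj Aj; [left|right; exists j].
  apply: small_sub IH => // x [j []]; rewrite inE => /orP[/eqP->|js] Qj Aj; first by rewrite Qi in Qj.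
  by exists j.
move=> /(_ (index_enum I)); apply: small_sub => // x [i [Qi Ai]]; by exists i; split.
Qed.

Lemma small_exists_nat (n : nat) (Q : pred nat) (A : nat -> set Omega) (p : nat -> R) :
  (forall i, (i < n)%N -> Q i -> small (A i) (p i)) ->
  small [set x | exists i, [/\ (i < n)%N, Q i & A i x]] (\sum_(i < n | Q i) p i).
Proof.
move=> h; apply: small_sub (@small_exists 'I_n (fun i => Q i) (fun i => A i) (fun i => p i) _) => //.
  by move=> x [i [ilt Qi Ai]]; exists (Ordinal ilt).
by move=> i; apply: h.
Qed.

Variables (E : finType) (w : E -> {RV P >-> R}).
Hypothesis w_indep : mutually_independent w.

Lemma small_rect (I : finType) (D : {set I}) (f : I -> E) (B : I -> set R) (q : I -> R) :
  {in D &, injective f} -> (forall i, measurable (B i)) ->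
  (forall i, i \in D -> (P (w (f i) @^-1` B i) <= (q i)%:E)%E) ->
  small [set x | forall i, i \in D -> B i (w (f i) x)] (\prod_(i in D) q i).
Proof.
move=> finj mB hq.
(* Independence speaks of one set per edge: [A] transports [B] along [f] and is the whole line off
   the image of [D]. *)
pose A e : set R := [set z | forall i, i \in D -> f i = e -> B i z].
have AE i : i \in D -> A (f i) = B i.
  move=> iD; apply/seteqP; split=> z; first by move=> /(_ i iD erefl).
  by move=> Bz j jD /(finj _ _ jD iD) ->.
have mA e : measurable (A e).
  have [[i [iD <-]]|h] := pselect (exists i, i \in D /\ f i = e); first by rewrite AE.
  rewrite (_ : A e = setT); first exact: measurableT.
  by apply/seteqP; split=> // z _ i iD fi; exfalso; apply: h; exists i.
have mw e : measurable (w e @^-1` A e).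
  by rewrite -[X in measurable X]setTI; apply: measurable_funPT.
have E1 : [set x | forall e, e \in (f @: D)%SET -> A e (w e x)]
    = [set x | forall i, i \in D -> B i (w (f i) x)].
  apply/seteqP; split=> x /= h; first by move=> i iD; rewrite -AE//; apply: h; apply: imset_f.
  by move=> e /imsetP[i iD ->]; rewrite AE//; apply: h.
have := w_indep (f @: D)%SET mA; rewrite E1 => PE.
apply: small_prob.
  rewrite -E1 (_ : [set x | _] = \bigcap_(e in [set e | e \in (f @: D)%SET]) (w e @^-1` A e)) //.
  by apply: fin_bigcap_measurable => // e _.
rewrite PE big_imset//= -prodEFin.
under eq_bigr => i iD do rewrite (AE i iD).
have fP i : i \in D -> P (w (f i) @^-1` B i) = (fine (P (w (f i) @^-1` B i)))%:E.
  by move=> iD; rewrite fineK// fin_num_measure// -(AE i iD).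
rewrite (eq_bigr _ fP) !prodEFin lee_fin; apply: ler_prod => i iD.
rewrite fine_ge0//= -lee_fin -fP//; exact: hq.
Qed.
End Small.

(** The sets of each size contribute 1. Hence an event whose probability carries the inverse of the
    number of sets of its size costs only [#|V|.+1] in a union bound over all sets. *)
Lemma sum_card_bin (R : realType) (V : finType) :
  \sum_(A : {set V}) ('C(#|V|, #|A|)%:R)^-1 = #|V|.+1%:R :> R.
Proof.
have ltA (A : {set V}) : (#|A| < #|V|.+1)%N by rewrite ltnS max_card.
rewrite (partition_big (fun A : {set V} => Ordinal (ltA A)) xpredT)//=.
transitivity (\sum_(k < #|V|.+1) (1 : R)); last by rewrite sumr_const card_ord.
apply: eq_bigr => k _.
rewrite (eq_bigr (fun=> ('C(#|V|, k)%:R)^-1 : R)); last by move=> A /eqP <-.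
rewrite (eq_bigl (fun A => A \in [set A : {set V} | #|A| == k]%SET)); last by move=> A; rewrite inE.
rewrite sumr_const card_draws -[_ *+ _]mulr_natr.
by rewrite mulVf// pnatr_eq0 -lt0n bin_gt0 -ltnS.
Qed.

Section Events.
Variables (R : realType) (d : measure_display) (Omega : measurableType d) (P : probability Omega R).
Variables (V : finType) (e0 : edge V) (w : edge V -> {RV P >-> R}).
Hypothesis w_indep : mutually_independent w.
Variables (C1 t0 : R).
Hypothesis w_up : forall e (t : R), 0 <= t -> (P [set x | (w e x < t)%R] <= (C1 * t)%:E)%E.
Hypothesis w_lo : forall e (t : R), 0 <= t <= t0 -> (P [set x | (t <= w e x)%R] <= (expR (- (t / 2)))%:E)%E.
Let n := #|V|.

Lemma itv_lt (t : R) : [set z : R | z < t] = `]-oo, t[%classic.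
Proof. by apply/seteqP; split=> z /=; rewrite in_itv/=. Qed.

Lemma itv_ge (t : R) : [set z : R | t <= z] = `[t, +oo[%classic.
Proof. by apply/seteqP; split=> z /=; rewrite in_itv/= andbT. Qed.

Lemma measurable_lt (t : R) : measurable [set z : R | z < t].
Proof. by rewrite itv_lt. Qed.

Lemma measurable_ge (t : R) : measurable [set z : R | t <= z].
Proof. by rewrite itv_ge. Qed.

Lemma eg_cross_inj (A B : {set V}) : (forall a, a \in A -> a \notin B) ->
  {in finset.setX A B &, injective (fun p : V * V => eg e0 p.1 p.2)}.
Proof.
move=> dAB [a b] [a' b']; rewrite !inE /= => /andP[aA bB] /andP[a'A b'B] E.
have ab : a != b by apply: contraTneq bB => <-; exact: dAB.
have ab' : a' != b' by apply: contraTneq b'B => <-; exact: dAB.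
have [[-> ->]//|[aE _]] := eg_inj ab ab' E.
by have := dAB a aA; rewrite aE b'B.
Qed.

Lemma small_no_edge_between (A B : {set V}) (t : R) : (forall a, a \in A -> a \notin B) -> 0 <= t <= t0 ->
  small P [set x | forall a b, a \in A -> b \in B -> t <= w (eg e0 a b) x]
    (expR (- (t / 2) * (#|A| * #|B|)%:R)).
Proof.
move=> dAB tt.
have := small_rect w_indep (eg_cross_inj dAB) (fun=> measurable_ge t)
  (fun p _ => w_lo (eg e0 p.1 p.2) tt).
apply: small_sub.
  by move=> x h [a b]; rewrite !inE /= => /andP[aA bB]; apply: h.
by rewrite prodr_const cardsX -expRM_natr.
Qed.

Lemma small_not_expander : (0 < n)%N ->
  small P [set x | ~ expander e0 22 t0 (fun e => w e x)] (4 / n%:R ^+ 20).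
Proof.
move=> n0; have nR : 0 < n%:R :> R by rewrite ltr0n.
(* A violation at some [s] is a violation at the critical threshold [tau], so each pair of sets is
   tested once. With 22 = 2 * 11 its probability is the eleventh power of the inverse of [n ^+ 2]
   times both binomials, more than the union bound over pairs needs. *)
pose tau (AB : {set V} * {set V}) : R := 22 * (lnbin n #|AB.1| + lnbin n #|AB.2|) / (#|AB.1|%:R * #|AB.2|%:R).
pose Q (AB : {set V} * {set V}) := [&& AB.1 != finset.set0, AB.2 != finset.set0,
   [forall a in AB.1, a \notin AB.2] & tau AB <= t0].
pose bad (AB : {set V} * {set V}) := [set x | forall a b, a \in AB.1 -> b \in AB.2 -> tau AB <= w (eg e0 a b) x].
pose p (AB : {set V} * {set V}) : R := (n%:R ^+ 22)^-1 * (('C(n, #|AB.1|)%:R)^-1 * ('C(n, #|AB.2|)%:R)^-1).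
have hb AB : Q AB -> small P (bad AB) (p AB).
  move=> /and4P[A0 B0 /forall_inP dAB tt0].
  have cA : (#|AB.1| <= n)%N by apply: max_card.
  have cB : (#|AB.2| <= n)%N by apply: max_card.
  have t_ge0 : 0 <= tau AB by rewrite divr_ge0// mulr_ge0// addr_ge0// lnbin_ge0.
  have tI : 0 <= tau AB <= t0 by rewrite t_ge0.
  apply: small_sub (small_no_edge_between dAB tI) => //.
  have aR : 0 < #|AB.1|%:R :> R by rewrite ltr0n card_gt0.
  have bR : 0 < #|AB.2|%:R :> R by rewrite ltr0n card_gt0.
  have -> : - (tau AB / 2) * (#|AB.1| * #|AB.2|)%:R = 11%:R * (- (lnbin n #|AB.1| + lnbin n #|AB.2|)).
    by rewrite /tau natrM; field; rewrite !gt_eqF.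
  rewrite expRM_natl expRN expRD /lnbin.
  have bA : (0 < 'C(n, #|AB.1|))%N by rewrite bin_gt0.
  have bB : (0 < 'C(n, #|AB.2|))%N by rewrite bin_gt0.
  rewrite !lnK ?posrE ?mulr_gt0 ?ltr0n//.
  set x := 'C(n, _)%:R; set y := 'C(n, _)%:R.
  have x1 : 1 <= x :> R by rewrite /x ler1n.
  have y1 : 1 <= y :> R by rewrite /y ler1n.
  have -> : n%:R * x * (n%:R * y) = n%:R ^+ 2 * (x * y) by rewrite expr2; ring.
  rewrite exprVn exprMn invfM -exprM ler_pM2l ?invr_gt0 ?exprn_gt0// -invfM.
  have xy : 0 < x * y by rewrite mulr_gt0 ?(lt_le_trans ltr01).
  have xy1 : 1 <= x * y by rewrite -[1]mulr1 ler_pM.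
  by rewrite lef_pV2 ?posrE ?exprn_gt0// ler_eXnr.
apply: small_sub (small_exists hb).
  move=> x /= nexp; apply: contrapT => h; apply: nexp => A B s A0 B0 dAB /andP[s0 st0] hs.
  have aR : 0 < #|A|%:R :> R by rewrite ltr0n card_gt0.
  have bR : 0 < #|B|%:R :> R by rewrite ltr0n card_gt0.
  rewrite leNgt; apply/negP => lt; apply: h; exists (A, B).
  have ts : tau (A, B) <= s.
    by rewrite /tau /= ler_pdivrMr ?mulr_gt0// mulrA ltW.
  split; last by move=> a b aA bB; apply: le_trans ts (hs a b aA bB).
  by rewrite /Q /= A0 B0 (le_trans ts st0) andbT; apply/forall_inP.
apply: (@le_trans _ _ (\sum_AB p AB)).
  rewrite [leRHS](bigID Q)/= lerDl sumr_ge0// => AB _.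
  by rewrite mulr_ge0 ?invr_ge0 ?exprn_ge0// mulr_ge0 ?invr_ge0.
rewrite /p -mulr_sumr.
have -> : \sum_(i : {set V} * {set V}) ('C(n, #|i.1|)%:R^-1 / 'C(n, #|i.2|)%:R) = n.+1%:R * n.+1%:R :> R.
  rewrite -(pair_bigA _ (fun A B : {set V} => ('C(n, #|A|)%:R)^-1 * ('C(n, #|B|)%:R)^-1 : R))/=.
  under eq_bigr do rewrite -mulr_sumr sum_card_bin.
  by rewrite -mulr_suml sum_card_bin.
have n1 : n.+1%:R <= 2 * n%:R :> R by rewrite -natrM ler_nat; lia.
rewrite mulrC ler_pdivrMr ?exprn_gt0// (_ : n%:R ^+ 22 = n%:R ^+ 20 * (n%:R * n%:R)); last by rewrite -expr2 -exprD.
have -> : 4 / n%:R ^+ 20 * (n%:R ^+ 20 * (n%:R * n%:R)) = (2 * n%:R) * (2 * n%:R) :> R.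
  by field; rewrite gt_eqF.
by rewrite ler_pM.
Qed.
End Events.

(** * Light trees *)

Section LightTrees.
Variables (R : realType) (d : measure_display) (Omega : measurableType d) (P : probability Omega R).

Lemma sum_succ_pow2 (N : nat) : \sum_(k < N) (k.+1%:R / 2 ^+ k) <= 4 :> R.
Proof.
suff -> : \sum_(k < N) (k.+1%:R / 2 ^+ k) = 4 - (2 * N%:R + 4) / 2 ^+ N :> R.
  by rewrite gerBl divr_ge0// addr_ge0.
elim: N => [|N IH]; first by rewrite big_ord0 expr0 mulr0 add0r divr1 subrr.
rewrite big_ord_recr /= IH exprS -!natr1; field.
by rewrite expf_neq0.
Qed.

Variables (E : finType) (w : E -> {RV P >-> R}).
Hypothesis w_indep : mutually_independent w.
Variable C1 : R.
Hypothesis C1_ge0 : 0 <= C1 :> R.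
Hypothesis w_up : forall e (t : R), 0 <= t -> (P [set x | (w e x < t)%R] <= (C1 * t)%:E)%E.

(* Rounding the weights up to multiples of [x / N] leaves [4 ^ N] profiles. *)
Lemma small_sum_le (I : finType) (D : {set I}) (f : I -> E) (N : nat) (x : R) :
  {in D &, injective f} -> #|D| = N -> (0 < N)%N -> 0 < x ->
  small P [set y | (forall e, 0 <= w e y) /\ \sum_(i in D) w (f i) y <= x] ((8 * C1 * x / N%:R) ^+ N).
Proof.
move=> finj cD N0 x0; have NR : 0 < N%:R :> R by rewrite ltr0n.
pose dl := x / N%:R; have dl0 : 0 < dl by rewrite divr_gt0.
pose Q (j : {ffun I -> 'I_N.+1}) := (j \in pffun_on ord0 D predT) && (\sum_(i in D) j i <= N)%N.
pose bad (j : {ffun I -> 'I_N.+1}) := [set y | forall i, i \in D -> w (f i) y < (j i).+1%:R * dl].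
have hb j : Q j -> small P (bad j) (\prod_(i in D) (C1 * ((j i).+1%:R * dl))).
  move=> _; apply: (small_rect w_indep finj (fun i => measurable_lt ((j i).+1%:R * dl))).
  by move=> i iD; apply: w_up; rewrite mulr_ge0// ltW.
apply: small_sub (small_exists hb).
  move=> y [w0 hs] /=.
  pose g i : nat := Num.truncn (w (f i) y / dl).
  have g_le i : (g i)%:R * dl <= w (f i) y.
    by rewrite -ler_pdivlMr// truncn_le divr_ge0// ltW.
  have sg : (\sum_(i in D) g i <= N)%N.
    rewrite -(ler_nat R) -(ler_pM2r dl0) natr_sum mulr_suml.
    apply: (@le_trans _ _ x); first by apply: le_trans hs; apply: ler_sum => i _.
    by rewrite /dl mulrC divfK ?gt_eqF.
  have gN i : i \in D -> (g i < N.+1)%N.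
    by move=> iD; rewrite ltnS; apply: leq_trans sg; rewrite (bigD1 i)//= leq_addr.
  pose j : {ffun I -> 'I_N.+1} := [ffun i => if i \in D then inord (g i) else ord0].
  have jE i : i \in D -> j i = g i :> nat by move=> iD; rewrite ffunE iD inordK// gN.
  exists j; split.
    apply/andP; split; last by rewrite (eq_bigr _ jE).
    apply/pffun_onP; split=> //; apply/supportP => i iD.
    by rewrite ffunE (negbTE iD).
  move=> i iD; rewrite jE// -ltr_pdivrMr//; exact: truncnS_gt.
(* The factor [2 ^+ N / 2 ^+ (\sum_(i in D) j i)] is at least 1 on the admissible profiles.
   Inserting it allows the restriction on the sum to be dropped, after which the sum over profiles
   factorises into series bounded by 4; hence [8 = 2 * 4]. *)
apply: (@le_trans _ _ (\sum_(j in pffun_on (ord0 : 'I_N.+1) D predT)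
     \prod_(i in D) (2 * C1 * dl * ((j i).+1%:R / 2 ^+ (j i))))).
  rewrite big_mkcond/= [leRHS]big_mkcond/=; apply: ler_sum => j _; rewrite /Q.
  case: (j \in _) => //=; case: ifP => sj; last first.
    by rewrite prodr_ge0// => i _; rewrite !mulr_ge0 ?invr_ge0 ?exprn_ge0// ltW.
  have -> : \prod_(i in D) (C1 * ((j i).+1%:R * dl)) =
     (2 ^+ (\sum_(i in D) j i)) * \prod_(i in D) (C1 * dl * ((j i).+1%:R / 2 ^+ (j i))).
    rewrite -prodrXr -big_split/=; apply: eq_bigr => i _.
    by field; rewrite expf_neq0.
  have -> : \prod_(i in D) (2 * C1 * dl * ((j i).+1%:R / 2 ^+ (j i))) =
     2 ^+ N * \prod_(i in D) (C1 * dl * ((j i).+1%:R / 2 ^+ (j i))).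
    have -> : 2 ^+ N = \prod_(i in D) (2 : R) by rewrite prodr_const cD.
    by rewrite -big_split/=; apply: eq_bigr => i _; ring.
  rewrite ler_wpM2r//; last by apply: ler_weXn2l => //; lra.
  by rewrite prodr_ge0// => i _; rewrite !mulr_ge0 ?invr_ge0 ?exprn_ge0// ltW.
rewrite -(big_distr_big (ord0 : 'I_N.+1) (mem D) predT
   (fun i k => 2 * C1 * dl * (k.+1%:R / 2 ^+ k)))/=.
rewrite prodr_const cD; apply: lerXn2r; rewrite ?nnegrE.
- by rewrite sumr_ge0// => k _; rewrite !mulr_ge0 ?invr_ge0 ?exprn_ge0// ltW.
- by rewrite !mulr_ge0 ?invr_ge0// ltW.
rewrite -mulr_sumr (_ : 8 * C1 * x / N%:R = 2 * C1 * dl * 4); last by rewrite /dl; ring.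
by rewrite ler_wpM2l ?sum_succ_pow2// !mulr_ge0// ltW.
Qed.
End LightTrees.

Section SteinerCount.
Variables (R : realType) (d : measure_display) (Omega : measurableType d) (P : probability Omega R).
Variables (V : finType) (e0 : edge V) (w : edge V -> {RV P >-> R}).
Hypothesis w_indep : mutually_independent w.
Variable C1 : R.
Hypothesis C1_ge0 : 0 <= C1 :> R.
Hypothesis w_up : forall e (t : R), 0 <= t -> (P [set x | (w e x < t)%R] <= (C1 * t)%:E)%E.
Let n := #|V|.

(** The binomial chooses the further vertices and the power a parent for every vertex but [t].
    Parent functions that describe no tree are counted as well; only the distinctness of the edges
    matters for their probability. *)
Lemma small_steiner_tree (T : {set V}) (N : nat) (x : R) : (0 < #|T|)%N -> (#|T| <= N.+1)%N -> (0 < N)%N -> 0 < x ->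
  small P [set y | (forall e, 0 <= w e y) /\
      exists G, [/\ steiner_tree T G, #|G.1| = N.+1 & weight (fun e => w e y) G <= x]]
    ('C(n - #|T|, N.+1 - #|T|)%:R * (N.+1 ^ N)%:R * (8 * C1 * x / N%:R) ^+ N).
Proof.
move=> T0 TN N0 x0; have [t tT] : exists t, t \in T by apply/card_gt0P.
pose Q (A : {set V}) := (A \subset ~: T) && (#|A| == N.+1 - #|T|)%N.
pose D (A : {set V}) : {set V} := (T :|: A) :\ t.
have cU A : Q A -> #|(T :|: A)%SET| = N.+1.
  move=> /andP[sA /eqP cA]; rewrite cardsU cA (_ : T :&: A = finset.set0)%SET ?cards0 ?subn0.
    by rewrite subnKC.
  by apply/eqP; rewrite -finset.subset0; apply/fintype.subsetP => v; rewrite !inE => /andP[vT /(fintype.subsetP sA)]; rewrite inE vT.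
have cD A : Q A -> #|D A| = N.
  by move=> /cU; rewrite /D (cardsD1 t) !inE tT => -[].
pose g (f : {ffun V -> V}) v := eg e0 v (f v).
pose Qf A (f : {ffun V -> V}) := (f \in pffun_on t (D A) (mem (T :|: A)%SET)) &&
   `[< {in D A &, injective (g f)} >].
pose bad A f := [set y | (forall e, 0 <= w e y) /\ \sum_(v in D A) w (g f v) y <= x].
have hb A : Q A -> small P [set y | exists f, Qf A f /\ bad A f y] (\sum_(f | Qf A f) (8 * C1 * x / N%:R) ^+ N).
  move=> QA; apply: small_exists => f /andP[_ /asboolP inj].
  exact: (small_sum_le w_indep C1_ge0 w_up inj (cD A QA) N0 x0).
apply: small_sub (small_exists hb).
  move=> y [w0 [G [[tG sG] cG wG]]] /=.
  have tG1 : t \in G.1 by apply: (fintype.subsetP sG).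
  have [par [dep [_ _ hp inj hs]]] := tree_parent_weight e0 w0 tG tG1.
  pose A := G.1 :\: T.
  have TA : (T :|: A)%SET = G.1 by rewrite /A finset.setDE finset.setUIr finset.setUCr finset.setIT; apply/finset.setUidPr.
  exists A; split.
    rewrite /Q /A finset.setDE finset.subsetIr /= -cG -finset.setDE cardsD.
    by rewrite (finset.setIidPr sG).
  pose f : {ffun V -> V} := [ffun v => if v \in D A then par v else t].
  have fE v : v \in D A -> f v = par v by rewrite ffunE => ->.
  have gE v : v \in D A -> g f v = eg e0 v (par v) by move=> vD; rewrite /g fE.
  have DE : D A = G.1 :\ t by rewrite /D TA.
  exists f; split.
    apply/andP; split; last first.
      by apply/asboolP => v v' vD v'D; rewrite gE// gE//; apply: inj; rewrite -DE.
    apply/pffun_onP; split; first by apply/supportP => v vD; rewrite ffunE (negbTE vD).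
    move=> z /fintype.imageP[v vD zE]; rewrite zE fE//.
    rewrite TA; have : v \in G.1 :\ t by rewrite -DE.
    by rewrite finset.in_setD1 => /andP[vt vG]; have [] := hp v vG vt.
  split=> //; rewrite (eq_bigr (fun v => w (eg e0 v (par v)) y)); last by move=> v vD; rewrite gE.
  by rewrite DE; apply: le_trans hs wG.
set p := (_ / _) ^+ N.
have p0 : 0 <= p by rewrite exprn_ge0// !mulr_ge0 ?invr_ge0// ltW.
apply: (@le_trans _ _ (\sum_(A | Q A) (N.+1 ^ N)%:R * p)).
  apply: ler_sum => A QA; rewrite sumr_const -[_ *+ _]mulr_natl ler_wpM2r// ler_nat.
  rewrite -{2}(cD A QA) -(cU A QA) -(card_pffun_on t).
  by apply: subset_leq_card; apply/fintype.subsetP => f; rewrite inE => /andP[].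
rewrite sumr_const -[_ *+ _]mulr_natl mulrA ler_wpM2r// ler_wpM2r// ler_nat.
rewrite (_ : (n - #|T|)%N = #|~: T|); last by rewrite [RHS]cardsCs finset.setCK.
rewrite -cards_draws; apply: subset_leq_card; apply/fintype.subsetP => A.
by rewrite !inE.
Qed.

(** Isolates the effect of the prescribed vertices: each of the [M] terminals besides the root of
    the encoding yields a factor [N / n]. The factor [expR 1] bounds [(1 + 1 / N) ^ N], the excess
    of [N.+1 ^ N] over [N ^ N]. *)
Lemma steiner_count_le (M N : nat) (x : R) : (0 < n)%N -> (M <= N)%N -> (0 < N)%N -> 0 < x ->
  'C(n - M.+1, N - M)%:R * (N.+1 ^ N)%:R * (8 * C1 * x / N%:R) ^+ N
  <= expR 1 * (N%:R / n%:R) ^+ M * ((8 * C1 * n%:R * x) ^+ N / N`!%:R).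
Proof.
move=> n0 MN N0 x0; have NR : 0 < N%:R :> R by rewrite ltr0n.
have nR : 0 < n%:R :> R by rewrite ltr0n.
have fN : 0 < N`!%:R :> R by rewrite ltr0n fact_gt0.
have h1 : 'C(n - M.+1, N - M)%:R <= n%:R ^+ (N - M) * N%:R ^+ M / N`!%:R :> R.
  apply: (@le_trans _ _ ('C(n, N - M)%:R)); first by rewrite ler_nat leq_bin2l// leq_subr.
  apply: le_trans (bin_le_pow_div_fact _ _) _; rewrite -mulrA ler_pM2l ?exprn_gt0//.
  rewrite ler_pdivlMr// mulrC ler_pdivrMr ?ltr0n ?fact_gt0//.
  rewrite -natrX -natrM ler_nat -(ffact_fact MN) leq_mul//.
  elim: (M) => [|k IH]; first by rewrite ffactn0.
  by rewrite ffactnSr expnSr leq_mul// leq_subr.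
have h2 : (N.+1 ^ N)%:R <= expR 1 * N%:R ^+ N :> R.
  have : (1 + N%:R^-1) ^+ N <= expR 1 :> R.
    apply: (@le_trans _ _ (expR (N%:R^-1) ^+ N)).
      by apply: lerXn2r; rewrite ?nnegrE ?expR_ge0 ?addr_ge0 ?invr_ge0// expR_ge1Dx.
    by rewrite -expRM_natl mulfV ?gt_eqF.
  rewrite -(ler_pM2r (exprn_gt0 N NR)); apply: le_trans.
  by rewrite natrX -exprMn mulrDl mul1r mulVf ?gt_eqF// natr1.
have z0 : 0 <= 8 * C1 * x by rewrite !mulr_ge0// ltW.
have p0 : 0 <= (8 * C1 * x / N%:R) ^+ N by rewrite exprn_ge0// divr_ge0// ltW.
apply: (@le_trans _ _ (n%:R ^+ (N - M) * N%:R ^+ M / N`!%:R * (expR 1 * N%:R ^+ N) * (8 * C1 * x / N%:R) ^+ N)).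
  by rewrite ler_wpM2r// ler_pM.
rewrite le_eqVlt; apply/orP; left; apply/eqP.
have -> : 8 * C1 * n%:R * x = n%:R * (8 * C1 * x) by ring.
move: (8 * C1 * x) => z; rewrite !expr_div_n exprMn.
have -> : n%:R ^+ N = n%:R ^+ (N - M) * n%:R ^+ M :> R by rewrite -exprD subnK.
move: (n%:R ^+ (N - M)) (z ^+ N) => u v; field.
by rewrite !expf_neq0 ?gt_eqF.
Qed.
End SteinerCount.

Section Weights.
Variables (R : realType) (d : measure_display) (Omega : measurableType d) (P : probability Omega R).
Variables (V : finType) (e0 : edge V) (w : edge V -> {RV P >-> R}).
Hypothesis w_indep : mutually_independent w.
Variable C1 : R.
Hypothesis C1_gt0 : 0 < C1 :> R.
Hypothesis w_up : forall e (t : R), 0 <= t -> (P [set x | (w e x < t)%R] <= (C1 * t)%:E)%E.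
Let n := #|V|.
Variable T : {set V}.
Hypothesis T2 : (2 <= #|T|)%N.
Let a : R := phi n%:R #|T|%:R.
Let M := #|T|.-1.

Lemma n_gt1 : (1 < n)%N.
Proof. exact: leq_trans T2 (max_card _). Qed.

Lemma steiner_scale_pos : 0 < a.
Proof.
by apply: phi_gt0; rewrite ?ltr0n ?ler_nat ?max_card// (leq_trans _ T2).
Qed.

Lemma ln_le_scale : ln n%:R <= a.
Proof. by apply: ln_le_phi; rewrite ?ler1n ?ler_nat ?max_card// (leq_trans _ T2). Qed.

Lemma small_light_trees (Q : pred nat) (x : nat -> R) :
  (forall N, (0 < N < n)%N -> (M <= N)%N -> Q N -> 0 < x N /\
     expR 1 * (N%:R / n%:R) ^+ M * ((8 * C1 * n%:R * x N) ^+ N / N`!%:R) <= expR 1 / n%:R ^+ 11) ->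
  small P [set y | (forall e, 0 <= w e y) /\
      exists G, [/\ steiner_tree T G, Q #|G.1|.-1 & weight (fun e => w e y) G <= x #|G.1|.-1]]
    (expR 1 / n%:R ^+ 10).
Proof.
move=> h; have n1 := n_gt1; have n0 : (0 < n)%N by apply: leq_trans n1.
have nR : 0 < n%:R :> R by rewrite ltr0n.
pose Q' N := [&& (0 < N)%N, (M <= N)%N & Q N].
pose bad N := [set y | (forall e, 0 <= w e y) /\
      exists G, [/\ steiner_tree T G, #|G.1| = N.+1 & weight (fun e => w e y) G <= x N]].
have T0 : (0 < #|T|)%N by apply: leq_trans T2.
have TM : #|T| = M.+1 by rewrite /M prednK.
have hb N : (N < n)%N -> Q' N -> small P (bad N) (expR 1 / n%:R ^+ 11).
  move=> Nn /and3P[N0 MN QN].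
  have N0n : (0 < N < n)%N by rewrite N0.
  have [x0 hx] := h N N0n MN QN.
  have TN : (#|T| <= N.+1)%N by rewrite TM.
  have := small_steiner_tree e0 w_indep (ltW C1_gt0) w_up T0 TN N0 x0.
  apply: small_sub => //; apply: le_trans hx.
  by rewrite TM subSS; apply: steiner_count_le => //; exact: ltW.
apply: small_sub (small_exists_nat hb).
  move=> y [w0 [G [tG QG wG]]].
  have sT : (#|T| <= #|G.1|)%N by apply: subset_leq_card; case: tG.
  have Gn : (#|G.1| <= n)%N by apply: max_card.
  have G2 : (2 <= #|G.1|)%N by apply: leq_trans sT.
  exists #|G.1|.-1; split.
  - by move: Gn G2; clear; lia.
  - by rewrite /Q' QG andbT /M; move: sT G2; clear; lia.
  - split=> //; exists G; split=> //; rewrite prednK//; exact: leq_trans G2.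
apply: (@le_trans _ _ (\sum_(i < n) (expR 1 / n%:R ^+ 11))).
  have F0 : 0 <= expR 1 / n%:R ^+ 11 :> R by apply: divr_ge0; rewrite ?expR_ge0 ?exprn_ge0.
  by rewrite [leRHS](bigID (fun i : 'I_n => Q' i))/= lerDl; apply: sumr_ge0.
rewrite sumr_const card_ord -[_ *+ n]mulr_natr.
have -> : expR 1 / n%:R ^+ 11 * n%:R = expR 1 / n%:R ^+ 10 :> R by field; rewrite gt_eqF.
by [].
Qed.

(** The constant [c'] turns the count into [(N / expR 2) ^+ N / N!], at most [expR (- N)], which is
    below [n ^- 11] because [N >= 11 * a >= 11 * ln n]. One of the eleven powers is spent on the
    union over [N]. *)
Lemma small_light_long_trees (c' := (8 * C1 * expR 2)^-1) :
  small P [set y | (forall e, 0 <= w e y) /\ exists G, [/\ steiner_tree T G,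
      11 * a <= #|G.1|.-1%:R & weight (fun e => w e y) G <= c' * #|G.1|.-1%:R / n%:R]]
    (expR 1 / n%:R ^+ 10).
Proof.
have n0 : (0 < n)%N by apply: leq_trans n_gt1.
have nR : 0 < n%:R :> R by rewrite ltr0n.
apply: (small_light_trees (Q := fun N => 11 * a <= N%:R) (x := fun N => c' * N%:R / n%:R)) => N /andP[N0 Nn] MN aN.
have NR : 0 < N%:R :> R by rewrite ltr0n.
have c0 : 0 < c' by rewrite invr_gt0 mulr_gt0 ?expR_gt0// mulr_gt0.
split; first by rewrite divr_gt0 ?mulr_gt0.
rewrite -mulrA ler_pM2l ?expR_gt0//.
have h1 : (N%:R / n%:R) ^+ M <= 1 :> R.
  by apply: exprn_ile1; [rewrite divr_ge0|rewrite ler_pdivrMr// mul1r ler_nat ltnW].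
have h2 : (8 * C1 * n%:R * (c' * N%:R / n%:R)) ^+ N / N`!%:R <= (n%:R ^+ 11)^-1.
  have -> : 8 * C1 * n%:R * (c' * N%:R / n%:R) = N%:R / expR 2.
    by rewrite /c'; field; rewrite !gt_eqF ?expR_gt0.
  rewrite expr_div_n mulrAC; apply: (@le_trans _ _ (expR N%:R / expR 2 ^+ N)).
    by rewrite ler_pM2r ?invr_gt0 ?exprn_gt0 ?expR_gt0// pow_div_fact_le_expR.
  rewrite -expRM_natl -expRN -expRD (_ : N%:R + - (N%:R * 2) = - N%:R); last by ring.
  rewrite expRN lef_pV2 ?posrE ?exprn_gt0 ?expR_gt0//.
  have -> : n%:R ^+ 11 = expR (11%:R * ln n%:R) :> R by rewrite expRM_natl lnK.
  by rewrite ler_expR; apply: le_trans aN; rewrite ler_pM2l// ln_le_scale.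
rewrite -[leRHS]mul1r; apply: ler_pM => //; apply/ltW.
apply: divr_gt0; last by rewrite ltr0n fact_gt0.
by apply: exprn_gt0; apply: mulr_gt0; [rewrite !mulr_gt0|rewrite divr_gt0 ?mulr_gt0].
Qed.

(** The gain [(N / n) ^+ M] weakens as [N] grows. By [(th * N) ^+ M / M! <= E ^+ N], with
    [th = expR 2] and [E = expR th], it is traded for a gain independent of [N], at most
    [expR (- a / 2)], and a factor [E ^+ N] that [cL] compensates up to [expR (a / 10)]. With
    [a >= 28 * ln n] the net exponent is below [- 11 * ln n]. *)
Lemma small_light_steiner (cL := (80 * C1 * expR (expR 2))^-1) : 28 * ln n%:R <= a ->
  small P [set y | (forall e, 0 <= w e y) /\ exists G, [/\ steiner_tree T G, true &
      weight (fun e => w e y) G <= cL * a / n%:R]]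
    (expR 1 / n%:R ^+ 10).
Proof.
move=> a28; have n0 : (0 < n)%N by apply: leq_trans n_gt1.
have nR : 0 < n%:R :> R by rewrite ltr0n.
have a0 := steiner_scale_pos.
have mR : 0 < #|T|%:R :> R by rewrite ltr0n (leq_trans _ T2).
apply: (small_light_trees (Q := xpredT) (x := fun=> cL * a / n%:R)) => N /andP[N0 Nn] MN _.
have NR : 0 < N%:R :> R by rewrite ltr0n.
have c0 : 0 < cL by rewrite invr_gt0 mulr_gt0 ?expR_gt0// mulr_gt0.
split; first by apply: divr_gt0 => //; apply: mulr_gt0.
rewrite -mulrA ler_pM2l ?expR_gt0//.
pose th : R := expR 2; pose E : R := expR th.
have th0 : 0 < th by apply: expR_gt0.
have E0 : 0 < E by apply: expR_gt0.
have yE : 8 * C1 * n%:R * (cL * a / n%:R) = a / (10 * E).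
  by rewrite /cL -/th -/E; field; rewrite !gt_eqF.
rewrite yE; set z := a / (10 * E).
have z0 : 0 <= z by apply: divr_ge0; [exact: ltW|rewrite mulr_ge0// ltW].
have MT : M%:R <= #|T|%:R :> R by rewrite ler_nat leq_pred.
have h1 : (N%:R / n%:R) ^+ M <= (#|T|%:R / (th * n%:R)) ^+ M * E ^+ N.
  have tN : 0 <= th * N%:R by rewrite mulr_ge0// ltW.
  have := pow_div_fact_le_expR M tN.
  rewrite ler_pdivrMr ?ltr0n ?fact_gt0// expRM_natr -/E [_ * M`!%:R]mulrC => hM.
  have fM : M`!%:R <= #|T|%:R ^+ M :> R.
    rewrite -natrX ler_nat; apply: leq_trans (_ : (M ^ M <= _)%N); last first.
      by rewrite leq_exp2r ?leq_pred// /M; move: T2; clear; lia.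
    elim: (M) => // k IH; rewrite factS expnS leq_mul//; apply: leq_trans IH _.
    by case: k => // k; rewrite leq_exp2r.
  have -> : (N%:R / n%:R) ^+ M = (th * N%:R) ^+ M / (th * n%:R) ^+ M :> R.
    by rewrite -expr_div_n; congr (_ ^+ _); field; rewrite !gt_eqF.
  rewrite expr_div_n mulrAC ler_pM2r ?invr_gt0 ?exprn_gt0 ?mulr_gt0//.
  by apply: le_trans hM _; rewrite ler_wpM2r// exprn_ge0// ltW.
have h2 : E ^+ N * (z ^+ N / N`!%:R) <= expR (a / 10).
  rewrite mulrA -exprMn (_ : E * z = a / 10); last by rewrite /z; field; rewrite gt_eqF.
  by apply: pow_div_fact_le_expR; rewrite divr_ge0// ltW.
have mn : #|T|%:R <= n%:R :> R by rewrite ler_nat max_card.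
have l0 : 0 <= ln (n%:R / #|T|%:R) :> R by rewrite ln_ge0// ler_pdivlMr// mul1r.
have h3 : (#|T|%:R / (th * n%:R)) ^+ M = expR (- (M%:R * (2 + ln (n%:R / #|T|%:R)))) :> R.
  rewrite -mulrN expRM_natl; congr (_ ^+ _).
  rewrite expRN expRD lnK ?posrE ?divr_gt0// -/th; field; rewrite !gt_eqF//.
apply: (@le_trans _ _ (expR (- (M%:R * (2 + ln (n%:R / #|T|%:R)))) * expR (a / 10))).
  rewrite -h3; apply: (@le_trans _ _ ((#|T|%:R / (th * n%:R)) ^+ M * E ^+ N * (z ^+ N / N`!%:R))).
    by rewrite ler_wpM2r// divr_ge0// exprn_ge0.
  by rewrite -mulrA ler_wpM2l// exprn_ge0// divr_ge0// mulr_ge0// ltW.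
have -> : (n%:R ^+ 11)^-1 = expR (- (11%:R * ln n%:R)) :> R by rewrite expRN expRM_natl lnK.
rewrite -expRD ler_expR.
have aE : a = #|T|%:R * (1 + ln (n%:R / #|T|%:R)) by apply: phi_lnE.
have m2M : #|T|%:R <= 2 * M%:R :> R by rewrite -natrM ler_nat /M; move: T2; clear; lia.
have ln0 : 0 <= ln n%:R :> R by rewrite ln_ge0// ler1n.
have h4 : a <= 2 * (M%:R * (2 + ln (n%:R / #|T|%:R))).
  rewrite aE mulrA; apply: ler_pM => //; first by rewrite addr_ge0.
  by rewrite lerD2r; lra.
by move: h4 a28 ln0; move: (M%:R * _) => b; lra.
Qed.
End Weights.

(** Terms of the exponential series far before its maximum are much smaller than [expR X]: write
    [X = delta ^- 2 * (delta ^+ 2 * X)] and use [delta^-1 <= expR (delta^-1 - 1)]. *)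
Lemma pow_div_fact_le_small (R : realType) (delta X : R) (j : nat) : 0 < delta -> delta <= 1 -> 0 <= X ->
  j%:R <= delta ^+ 2 * X -> X ^+ j / j`!%:R <= expR (2 * delta * X).
Proof.
move=> d0 d1 X0 jX.
have d2 : 0 < delta ^+ 2 by rewrite exprn_gt0.
have h1 := @pow_div_fact_le_expR R (delta ^+ 2 * X) j (mulr_ge0 (ltW d2) X0).
have -> : X ^+ j / j`!%:R = (delta ^+ 2 * X) ^+ j / j`!%:R * ((delta ^- 1) ^+ 2) ^+ j.
  rewrite mulrAC -exprMn; congr (_ ^+ j / _); field; by rewrite gt_eqF.
have h2 : ((delta ^- 1) ^+ 2) ^+ j <= expR (j%:R * (2 * (delta^-1 - 1))).
  rewrite expRM_natl lerXn2r ?nnegrE ?expR_ge0 ?exprn_ge0 ?invr_ge0 ?(ltW d0)//.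
  rewrite expRM_natl lerXn2r ?nnegrE ?expR_ge0 ?exprn_ge0 ?invr_ge0 ?(ltW d0)//.
  by have := expR_ge1Dx (delta^-1 - 1); rewrite addrC subrK expr1.
apply: (@le_trans _ _ (expR (delta ^+ 2 * X) * expR (j%:R * (2 * (delta^-1 - 1))))).
  by apply: ler_pM => //; rewrite ?divr_ge0 ?exprn_ge0 ?mulr_ge0 ?invr_ge0 ?(ltW d0) ?(ltW d2)//.
rewrite -expRD ler_expR.
have d3 : 0 <= delta^-1 - 1 by rewrite subr_ge0 invf_ge1.
have : j%:R * (2 * (delta^-1 - 1)) <= delta ^+ 2 * X * (2 * (delta^-1 - 1)).
  by rewrite ler_wpM2r// mulr_ge0.
have -> : delta ^+ 2 * X * (2 * (delta^-1 - 1)) = 2 * delta * X - 2 * (delta ^+ 2 * X).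
  by field; rewrite gt_eqF.
have : 0 <= delta ^+ 2 * X by rewrite mulr_ge0// ltW.
clear; lra.
Qed.

(** * Joining the root to a terminal *)

Section Spread.
Variables (V : finType) (R : realType) (e0 : edge V).
Implicit Types (A C : {set V}) (v x y : V) (p : {ffun V -> V}).
Variables (v : V) (t1 t2 : R).

(* The root [v] gets the larger threshold, of order [ln n / n], since with
   threshold [O(1 / n)] it may well have no neighbour at all. *)
Definition thr x : R := if x == v then t1 else t2.

(** The explored set is kept together with a light tree that explored it. The expected number of
    such trees grows only exponentially with their size, whereas all ['C(n, #|A|)] sets would cost
    an additional logarithm per vertex; this is what permits thresholds [O(1 / n)] away from [v]. *)
Definition spread_tree (w : edge V -> R) A p : Prop :=
  [/\ v \in A, {in A :\ v &, injective (fun x => eg e0 x (p x))} &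
   forall x, x \in A :\ v -> [/\ p x \in A, x != p x & w (eg e0 x (p x)) < thr (p x)]].

Definition frontier (w : edge V -> R) A : {set V} :=
  [set y | (y \notin A) && [exists a in A, w (eg e0 a y) < thr a]]%SET.

Definition stuck (w : edge V -> R) : Prop :=
  exists A p, [/\ spread_tree w A p, (4 * #|A| <= #|V|)%N & (#|frontier w A| < #|A|)%N].

Lemma spread_extend (w : edge V -> R) A p : spread_tree w A p ->
  exists p', [/\ spread_tree w (A :|: frontier w A)%SET p',
    forall y, y \in (A :|: frontier w A)%SET :\ v -> p' y \in A &
    forall y, y \in frontier w A -> p' y \in A /\ w (eg e0 (p' y) y) < thr (p' y)].
Proof.
move=> [vA inj hp].
have /boolp.choice[f hf] : forall y, exists a, y \in frontier w A -> a \in A /\ w (eg e0 a y) < thr a.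
  move=> y; have [|_] := boolP (y \in frontier w A); last by exists y.
  by rewrite inE => /andP[_ /existsP[a /andP[? ?]]]; exists a.
pose p' : {ffun V -> V} := [ffun x => if x \in A then p x else f x].
have pA x : x \in A -> p' x = p x by rewrite ffunE => ->.
have pF x : x \in frontier w A -> p' x = f x.
  by rewrite ffunE inE => /andP[/negbTE->].
have FA x : x \in frontier w A -> x \notin A by rewrite inE => /andP[].
have cases x : x \in (A :|: frontier w A)%SET :\ v -> x \in A :\ v \/ x \in frontier w A.
  by rewrite !finset.in_setD1 finset.in_setU => /andP[-> /orP[]]; auto.
exists p'; split; last by move=> y yF; rewrite pF//; apply: hf.
  2: move=> y /cases[yA|yF]; last by rewrite pF//; have [] := hf y yF.
  2: have yA' : y \in A by move: yA; rewrite inE => /andP[].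
  2: by rewrite pA//; have [] := hp y yA.
have nF x : x \in frontier w A -> x != f x.
  by move=> xF; apply: contraNneq (FA x xF) => ->; have [] := hf x xF.
split.
- by rewrite inE vA.
- move=> x y /cases[xA|xF] /cases[yA|yF] /=.
  + have xA' : x \in A by move: xA; rewrite inE => /andP[].
    have yA' : y \in A by move: yA; rewrite inE => /andP[].
    by rewrite (pA _ xA') (pA _ yA'); apply: inj.
  + have xA' : x \in A by move: xA; rewrite inE => /andP[].
    rewrite (pA _ xA') (pF _ yF); have [pxA nx _] := hp x xA.
    move=> E; have [[xy _]|[_ py]] := eg_inj nx (nF y yF) E.
      by move: (FA y yF); rewrite -xy xA'.
    by move: (FA y yF); rewrite -py pxA.
  + have yA' : y \in A by move: yA; rewrite inE => /andP[].
    rewrite (pA _ yA') (pF _ xF); have [pyA ny _] := hp y yA.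
    move=> E; have [[xy _]|[xy _]] := eg_inj (nF x xF) ny E.
      by move: (FA x xF); rewrite xy yA'.
    by move: (FA x xF); rewrite xy pyA.
  + rewrite (pF _ xF) (pF _ yF) => E.
    have [[]//|[xy _]] := eg_inj (nF x xF) (nF y yF) E.
    by move: (FA x xF); rewrite xy; have [-> _] := hf y yF.
- move=> x /cases[xA|xF].
    have xA' : x \in A by move: xA; rewrite inE => /andP[].
    by rewrite (pA _ xA') inE; have [-> ? ?] := hp x xA.
  by rewrite (pF _ xF) inE (nF x xF) egC; have [-> ?] := hf x xF.
Qed.

Lemma spread_grow (w : edge V -> R) (i : nat) : (forall e, 0 <= w e) -> 0 <= t1 -> 0 <= t2 -> ~ stuck w ->
  exists A p, [/\ spread_tree w A p, (#|V| < 4 * #|A|)%N \/ (2 ^ i <= #|A|)%N &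
    forall x, x \in A -> joined w [set v]%SET i (t1 + i%:R * t2) x].
Proof.
move=> w0 t10 t20 ns; elim: i => [|i [A [p [sA cA jA]]]].
  exists [set v]%SET, [ffun x => x]; split.
  - split; first by rewrite inE.
      by move=> x y; rewrite !inE => /andP[/negbTE->].
    by move=> x; rewrite !inE => /andP[/negbTE->].
  - by right; rewrite cards1.
  - move=> x xv; apply: joined_mono (joined0 w xv) => //.
    by rewrite mul0r addr0.
have jA' x : x \in A -> joined w [set v]%SET i.+1 (t1 + i.+1%:R * t2) x.
  by move=> xA; apply: joined_mono (jA x xA) => //; rewrite lerD2l ler_wpM2r// ler_nat.
have [lt|ge] := ltnP #|V| (4 * #|A|).
  by exists A, p; split=> //; left.
have [p' [sA' _ hF]] := spread_extend sA.
exists (A :|: frontier w A)%SET, p'; split=> //.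
  right; have cF : (#|A| <= #|frontier w A|)%N.
    by rewrite leqNgt; apply/negP => lt; apply: ns; exists A, p; split.
  have {}cA : (2 ^ i <= #|A|)%N by case: cA => // h; rewrite ltnNge ge in h.
  rewrite cardsU (_ : A :&: _ = finset.set0)%SET ?cards0 ?subn0; last first.
    by apply/finset.setP => x; rewrite !inE; case: (x \in A).
  by rewrite expnS mul2n -addnn leq_add// (leq_trans cA).
move=> x; rewrite finset.in_setU => /orP[/jA'//|xF].
have [pA wp] := hF x xF.
(* If the parent is [v] itself, a single edge from [v] suffices; so the large threshold [t1] enters
   every path cost only once. *)
have [pv|pv] := eqVneq (p' x) v.
  have j1 : joined w [set v]%SET 1 (0 + t1) x.
    apply: (joined_step (e0 := e0) w0 (x := p' x)); first by apply: joined0; rewrite pv inE.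
    by apply: ltW; move: wp; rewrite /thr pv eqxx.
  by apply: joined_mono j1 => //; rewrite add0r lerDl mulr_ge0.
rewrite -natr1 mulrDl mul1r addrA; apply: (joined_step (e0 := e0) w0 (jA _ pA)).
by apply: ltW; move: wp; rewrite /thr (negbTE pv).
Qed.
End Spread.


(** Both ends spread to more than a quarter of the vertices, and the expander supplies an edge
    between the two sets: their entropies add up to at most [4 * n], and [64 = 4 * 16] with 16 from
    the two quarters. *)
Lemma spread_connect (V : finType) (R : realType) (e0 : edge V) (w : edge V -> R) (CG t0 t1 t2 : R) (J : nat) r t :
  (forall e, 0 <= w e) -> 0 < CG -> expander e0 CG t0 w -> 0 <= t1 -> 0 <= t2 ->
  (#|V| <= 2 ^ J)%N -> 64 * CG / #|V|%:R <= t0 -> ~ stuck e0 r t1 t2 w -> ~ stuck e0 t t1 t2 w ->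
  exists2 F, reach F (J + J.+1) r t & wt w F <= 2 * (t1 + J%:R * t2) + 64 * CG / #|V|%:R.
Proof.
move=> w0 CG0 HG t10 t20 nJ st0 nr nt; set N : R := #|V|%:R; set s := 64 * CG / N.
have n0 : (0 < #|V|)%N by apply/card_gt0P; exists r.
have N0 : 0 < N by rewrite ltr0n.
have s0 : 0 <= s by rewrite divr_ge0// mulr_ge0// ltW.
have half v : ~ stuck e0 v t1 t2 w -> exists2 A : {set V}, (#|V| < 4 * #|A|)%N &
    forall x, x \in A -> joined w [set v]%SET J (t1 + J%:R * t2) x.
  move=> nv; have [A [p [_ cA jA]]] := spread_grow J w0 t10 t20 nv; exists A => //.
  case: cA => // cA; have := leq_trans nJ cA; move: n0; clear; lia.
have [A cA jA] := half r nr; have [B cB jB] := half t nt.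
have [x [y [xA yB xy]]] : exists x y, [/\ x \in A, y \in B & (x == y) || (w (eg e0 x y) <= s)].
  apply: contrapT => h.
  have dAB a : a \in A -> a \notin B.
    by move=> aA; apply/negP => aB; apply: h; exists a, a; rewrite eqxx.
  have big a b : a \in A -> b \in B -> s <= w (eg e0 a b).
    move=> aA bB; rewrite leNgt; apply/negP => lt; apply: h; exists a, b; split=> //.
    by rewrite (ltW lt) orbT.
  have ne (X : {set V}) : (#|V| < 4 * #|X|)%N -> X != finset.set0.
    by move=> h1; rewrite -card_gt0; move: h1; clear; lia.
  have sI : 0 <= s <= t0 by rewrite s0.
  have := HG A B s (ne A cA) (ne B cB) dAB sI big.
  have lA := @lnbin_le R #|V| #|A| n0 (max_card _).
  have lB := @lnbin_le R #|V| #|B| n0 (max_card _).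
  have cR (X : {set V}) : (#|V| < 4 * #|X|)%N -> N / 4 < #|X|%:R.
    by rewrite -(ltr_nat R) natrM -/N => h1; rewrite ltr_pdivrMr// mulrC.
  have N4 : 0 <= N / 4 by rewrite divr_ge0// ltW.
  have AB : N / 4 * (N / 4) < #|A|%:R * #|B|%:R by apply: ltr_pM => //; exact: cR.
  apply/negP; rewrite -ltNge -mulrA.
  apply: (@le_lt_trans _ _ (CG * (4 * N))).
    by rewrite ler_pM2l//; move: lA lB; rewrite -/N; clear; lra.
  have -> : CG * (4 * N) = s * (N / 4 * (N / 4)) by rewrite /s; field; rewrite gt_eqF.
  by rewrite ltr_pM2l// /s divr_gt0// mulr_gt0.
have [F1 [r' [+ r1 w1]]] := jA x xA; rewrite inE => /eqP rE; rewrite rE in r1.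
have [F2 [t' [+ r2 w2]]] := jB y yB; rewrite inE => /eqP tE; rewrite tE in r2.
have c0 : 0 <= t1 + J%:R * t2 by rewrite addr_ge0// mulr_ge0.
pose F3 : {set edge V} := if x == y then finset.set0 else [set eg e0 x y]%SET.
have w3 : wt w F3 <= s.
  by move: xy; rewrite /F3; case: eqP => [_ _|_]; rewrite ?wt0// wt1.
have r3 : reach F3 1 x y.
  rewrite /F3; case: eqVneq => [->|nxy]; first by apply: (reach_mono _ (leq0n _) (reach0 _ _)).
  by apply: reach_nbr; rewrite (nbrE e0) nxy inE eqxx.
exists (F1 :|: (F3 :|: F2))%SET.
  apply: (reach_cat (y := x)); first by apply: reach_mono r1 => //; apply: finset.subsetUl.
  apply: (reach_cat (i := 1) (j := J) (y := y)).
    apply: reach_mono r3 => //; apply: fintype.subset_trans (finset.subsetUr _ _); exact: finset.subsetUl.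
  apply: reach_sym; apply: reach_mono r2 => //.
  apply: fintype.subset_trans (finset.subsetUr _ _); exact: finset.subsetUr.
apply: le_trans (wtU w0 _ _) _; have := wtU w0 F3 F2; move: w1 w2 w3; clear; lra.
Qed.

(** [t2] is chosen so that [alpha.-1] and [b] are at most [delta ^+ 2 * X]; the light edges then
    contribute at most [expR (4 * delta * X) = expR (n * sg / 8)], the heavy ones at most
    [expR (- n * sg / 4)]. The difference [n * sg / 8] exceeds [14 * ln n] by [112 = 8 * 14], where
    14 is the required 13 plus one for the position of the root. *)
Lemma config_bound (R : realType) (n alpha b N : nat) (C1 t1 t2 sg : R) : 1 <= C1 -> (0 < n)%N ->
  t1 = 112 * ln n%:R / n%:R -> t2 = 1024 * C1 / n%:R -> (0 < alpha)%N -> (b < alpha)%N -> (4 * alpha <= n)%N -> (n <= 2 * N)%N ->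
  sg = t1 + alpha.-1%:R * t2 ->
  (C1 * sg) ^+ (alpha.-1 + b) * expR (- (sg / 2) * N%:R) <=
  (n%:R ^+ 13)^-1 * (('C(n, alpha)%:R)^-1 * ('C(n, b)%:R)^-1).
Proof.
move=> C11; have C1_gt0 : 0 < C1 by apply: lt_le_trans C11.
move=> n0 t1E t2E a0 ba a4 nN sgE.
have nR : 0 < n%:R :> R by rewrite ltr0n.
have n1 : 1 <= n%:R :> R by rewrite ler1n.
have ln0 : 0 <= ln n%:R :> R by rewrite ln_ge0.
pose X : R := n%:R * C1 * sg.
pose delta : R := (32 * C1)^-1.
have C10 : C1 != 0 by rewrite gt_eqF.
have d0 : 0 < delta by rewrite invr_gt0 mulr_gt0.
have d1 : delta <= 1 by rewrite invf_le1 ?mulr_gt0//; apply: le_trans C11 _; apply: ler_peMl; [exact: ltW|by rewrite (ler_nat R 1 32)].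
have XE : X = C1 * (112 * ln n%:R) + alpha.-1%:R / delta ^+ 2.
  by rewrite /X sgE t1E t2E /delta; field; rewrite C10 gt_eqF.
have Xa : alpha.-1%:R <= delta ^+ 2 * X.
  have -> : delta ^+ 2 * X = delta ^+ 2 * (C1 * (112 * ln n%:R)) + alpha.-1%:R.
    by rewrite XE; field; rewrite gt_eqF.
  rewrite lerDr; apply: mulr_ge0; first by rewrite exprn_ge0// ltW.
  by apply: mulr_ge0; [exact: ltW|apply: mulr_ge0].
have Xl : 112 * ln n%:R <= X.
  rewrite XE; apply: (@le_trans _ _ (C1 * (112 * ln n%:R))); first by rewrite ler_peMl// mulr_ge0.
  by rewrite lerDl divr_ge0// exprn_ge0// ltW.
have X0 : 0 <= X by apply: le_trans Xl; rewrite mulr_ge0.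
have Xb : b%:R <= delta ^+ 2 * X by apply: le_trans Xa; rewrite ler_nat -ltnS prednK.
have ca : 'C(n, alpha)%:R <= n%:R * (n%:R ^+ alpha.-1 / (alpha.-1)`!%:R) :> R.
  apply: le_trans (@bin_le_pow_div_fact R n alpha) _.
  rewrite mulrA -exprS prednK// ler_pM2l ?exprn_gt0// lef_pV2 ?posrE ?ltr0n ?fact_gt0// ler_nat.
  by rewrite -{2}(prednK a0) factS leq_pmull.
have cb : 'C(n, b)%:R <= n%:R ^+ b / b`!%:R :> R by apply: bin_le_pow_div_fact.
have ha := pow_div_fact_le_small d0 d1 X0 Xa.
have hb := pow_div_fact_le_small d0 d1 X0 Xb.
have pa : 0 < 'C(n, alpha)%:R :> R by rewrite ltr0n bin_gt0 (leq_trans _ a4)// leq_pmull.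
have pb : 0 < 'C(n, b)%:R :> R by rewrite ltr0n bin_gt0 (leq_trans (ltnW ba))// (leq_trans _ a4)// leq_pmull.
rewrite -[X in _ <= X]mul1r -!invfM ler_pdivlMr// ?mulr_gt0 ?exprn_gt0//.
have sg0 : 0 <= sg by rewrite -(pmulr_lge0 _ (mulr_gt0 nR C1_gt0)) mulrC.
have CE : (C1 * sg) ^+ (alpha.-1 + b) * expR (- (sg / 2) * N%:R) * (n%:R ^+ 13 * ('C(n, alpha)%:R * 'C(n, b)%:R))
  <= n%:R ^+ 14 * (X ^+ alpha.-1 / (alpha.-1)`!%:R * (X ^+ b / b`!%:R)) * expR (- (sg / 2) * N%:R).
  rewrite mulrAC ler_wpM2r ?expR_ge0//.
  apply: (@le_trans _ _ ((C1 * sg) ^+ (alpha.-1 + b) * (n%:R ^+ 13 *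
     ((n%:R * (n%:R ^+ alpha.-1 / (alpha.-1)`!%:R)) * (n%:R ^+ b / b`!%:R))))).
    apply: ler_wpM2l; first by apply: exprn_ge0; apply: mulr_ge0 => //; exact: ltW.
    apply: ler_wpM2l; first by apply: exprn_ge0; exact: ltW.
    by apply: ler_pM => //; exact: ltW.
  rewrite /X exprD (exprS _ 13) !exprMn le_eqVlt; apply/orP; left; apply/eqP.
  move: (alpha.-1)`!%:R^-1 (b`!%:R^-1) => u1 u2.
  by move: (n%:R ^+ 13) (n%:R ^+ alpha.-1) (n%:R ^+ b) (C1 ^+ alpha.-1) (C1 ^+ b) (sg ^+ alpha.-1) (sg ^+ b) => *; ring.
apply: le_trans CE _.
apply: (@le_trans _ _ (n%:R ^+ 14 * (expR (2 * delta * X) * expR (2 * delta * X)) * expR (- (sg / 2) * N%:R))).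
  rewrite ler_wpM2r ?expR_ge0// ler_wpM2l ?exprn_ge0//.
  by apply: ler_pM => //; rewrite divr_ge0// exprn_ge0.
have -> : n%:R ^+ 14 = expR (14%:R * ln n%:R) :> R by rewrite expRM_natl lnK.
rewrite -!expRD expR_le1.
have e1 : 4 * delta * X = n%:R * sg / 8 by rewrite /X /delta; field; rewrite C10.
have e2 : 14 * ln n%:R <= n%:R * sg / 8.
  have : n%:R * t1 <= n%:R * sg.
    rewrite ler_pM2l// sgE lerDl; apply: mulr_ge0; first exact: ler0n.
    rewrite t2E; apply: divr_ge0; last exact: ler0n; apply: mulr_ge0; [exact: ler0n|exact: ltW].
  have -> : n%:R * t1 = 112 * ln n%:R by rewrite t1E; field; rewrite gt_eqF.
  by clear; lra.
have e3 : n%:R * sg <= 2 * (sg * N%:R).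
  have -> : 2 * (sg * N%:R) = (2 * N%:R) * sg by ring.
  by rewrite ler_wpM2r// -natrM ler_nat.
by move: e1 e2 e3; clear; lra.
Qed.

Section SmallStuck.
Variables (R : realType) (d : measure_display) (Omega : measurableType d) (P : probability Omega R).
Variables (V : finType) (e0 : edge V) (w : edge V -> {RV P >-> R}).
Hypothesis w_indep : mutually_independent w.
Variables (C1 t0 : R).
Hypothesis C1_gt0 : 0 < C1 :> R.
Hypothesis w_up : forall e (t : R), 0 <= t -> (P [set x | (w e x < t)%R] <= (C1 * t)%:E)%E.
Hypothesis w_lo : forall e (t : R), 0 <= t <= t0 -> (P [set x | (t <= w e x)%R] <= (expR (- (t / 2)))%:E)%E.
Let n := #|V|.

(** The parent edges and the edges leaving [A :|: C] are distinct, so the upper and lower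
    constraints are independent. Summation over all parent functions turns the product of thresholds
    into a power of their sum [sg] over [A], which is also the exponent per outside vertex of the
    heavy part. *)
Lemma small_config (v : V) (t1 t2 : R) (A C : {set V}) :
  0 <= t1 <= t0 -> 0 <= t2 <= t0 -> v \in A -> (forall a, a \in A -> a \notin C) ->
  let D := ((A :\ v) :|: C)%SET in
  let sg := t1 + #|A|.-1%:R * t2 in
  small P [set y | exists p : {ffun V -> V}, p \in pffun_on v D (mem A) /\
    [/\ {in D &, injective (fun x => eg e0 x (p x))}, forall x, x \in D -> x != p x,
        forall x, x \in D -> w (eg e0 x (p x)) y < thr v t1 t2 (p x) &
        forall a x, a \in A -> x \notin (A :|: C)%SET -> thr v t1 t2 a <= w (eg e0 a x) y]]
   ((C1 * sg) ^+ #|D| * expR (- (sg / 2) * #|~: (A :|: C)%SET|%:R)).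
Proof.
move=> t1I t2I vA dAC D sg.
pose th := thr v t1 t2.
have thI x : 0 <= th x <= t0 by rewrite /th /thr; case: ifP.
have th0 x : 0 <= th x by case/andP: (thI x).
have sumth : \sum_(a in A) th a = sg.
  rewrite (bigD1 v)//= {1}/th /thr eqxx; congr (_ + _).
  rewrite (eq_bigr (fun=> t2)); last by move=> a /andP[_ av]; rewrite /th /thr (negbTE av).
  rewrite sumr_const -[_ *+ _]mulr_natl; congr (_%:R * _).
  by rewrite (cardsD1 v A) vA /=; apply: eq_card => a; rewrite !inE andbC.
pose I : finType := (V + V * V)%type.
pose DI : {set I} := [set i | match i with inl x => x \in D | inr q => (q.1 \in A) && (q.2 \notin (A :|: C)%SET) end]%SET.
pose f (p : {ffun V -> V}) (i : I) := match i with inl x => eg e0 x (p x) | inr q => eg e0 q.1 q.2 end.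
pose B (p : {ffun V -> V}) (i : I) : set R :=
  match i with inl x => [set z | z < th (p x)] | inr q => [set z | th q.1 <= z] end.
pose q (p : {ffun V -> V}) (i : I) : R :=
  match i with inl x => C1 * th (p x) | inr q => expR (- (th q.1 / 2)) end.
pose Q (p : {ffun V -> V}) := [&& p \in pffun_on v D (mem A),
   `[< {in D &, injective (fun x => eg e0 x (p x))} >] & [forall x in D, x != p x]].
have hb p : Q p -> small P [set y | forall i, i \in DI -> B p i (w (f p i) y)] (\prod_(i in DI) q p i).
  move=> /and3P[/pffun_onP[supp pA] /asboolP inj /forall_inP neq].
  have pinA x : x \in D -> p x \in A by move=> xD; apply: pA; apply: fintype.image_f.
  apply: (small_rect w_indep).
  - have DU x : x \in D -> x \in (A :|: C)%SET.
      by rewrite !inE => /orP[/andP[_ ->]//|->]; rewrite orbT.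
    have AU x : x \in A -> x \in (A :|: C)%SET by rewrite inE => ->.
    have cross x a b : x \in D -> a \in A -> b \notin (A :|: C)%SET -> eg e0 x (p x) <> eg e0 a b.
      move=> xD aA bU E.
      have ab : a != b by apply: contraNneq bU => <-; apply: AU.
      have [[_ E2]|[E2 _]] := eg_inj (neq x xD) ab E.
        by move: bU; rewrite -E2 (AU _ (pinA x xD)).
      by move: bU; rewrite -E2 DU.
    move=> [x|[a b]] [x'|[a' b']]; rewrite !inE /=.
    + by rewrite -!finset.in_setD1 -!finset.in_setU => xD xD' E; congr inl; apply: inj.
    + rewrite -!finset.in_setD1 -!finset.in_setU => xD /andP[aA bU] E.
      by exfalso; apply: cross xD aA bU E.
    + rewrite -!finset.in_setD1 -!finset.in_setU => /andP[aA bU] xD E.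
      by exfalso; apply: cross xD aA bU (esym E).
    + rewrite -!finset.in_setU => abD abD' E; congr inr.
      have dd a0 : a0 \in A -> a0 \notin (~: (A :|: C))%SET by move=> ?; rewrite !inE negbK; apply/orP; left.
      have inX a1 b1 : (a1 \in A) && (b1 \notin (A :|: C)%SET) -> (a1, b1) \in finset.setX A (~: (A :|: C))%SET.
        by rewrite finset.in_setX finset.in_setC.
      by move: (@eg_cross_inj V e0 A _ dd (a, b) (a', b') (inX _ _ abD) (inX _ _ abD')); apply.
  - by move=> [x|[a b]] /=; [exact: measurable_lt|exact: measurable_ge].
  - by move=> [x|[a b]] _ /=; [exact: w_up|exact: w_lo].
apply: small_sub (small_exists hb).
  move=> y [p [pp [inj neq lo up]]] /=; exists p; split.
    by rewrite /Q pp /=; apply/andP; split; [exact/asboolP|exact/forall_inP].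
  move=> [x|[a b]]; rewrite inE /=; first exact: lo.
  by move=> /andP[aA bU]; apply: up.
apply: (@le_trans _ _ (\sum_(p in pffun_on v D (mem A))
    ((\prod_(x in D) (C1 * th (p x))) * expR (- (sg / 2) * #|~: (A :|: C)%SET|%:R)))).
  rewrite big_mkcond/= [leRHS]big_mkcond/=; apply: ler_sum => p _; rewrite /Q.
  have pos : 0 <= (\prod_(x in D) (C1 * th (p x))) * expR (- (sg / 2) * #|~: (A :|: C)%SET|%:R).
    by rewrite mulr_ge0 ?expR_ge0// prodr_ge0// => x _; rewrite mulr_ge0// ltW.
  case: (p \in _) => //=; case: ifP => // _.
  rewrite big_sumType/= le_eqVlt; apply/orP; left; apply/eqP; congr (_ * _).
    by apply: eq_bigl => x; rewrite inE.
  rewrite (eq_bigl (mem (finset.setX A (~: (A :|: C)%SET)))); last first.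
    by move=> [a b]; rewrite !inE.
  rewrite -expR_sum; congr (expR _).
  rewrite (eq_bigl (fun q : V * V => (q.1 \in A) && (q.2 \in ~: (A :|: C)%SET))); last by move=> [a b]; rewrite /= finset.in_setX.
  rewrite -(pair_big (mem A) (mem (~: (A :|: C)%SET)) (fun a b => - (th a / 2)))/=.
  rewrite (eq_bigr (fun a => (- #|~: (A :|: C)%SET|%:R / 2) * th a)); last first.
    by move=> a _; rewrite sumr_const -[_ *+ _]mulr_natl; ring.
  by rewrite -mulr_sumr sumth; ring.
rewrite -mulr_suml ler_wpM2r ?expR_ge0//.
rewrite -(big_distr_big v (mem D) (mem A) (fun i a => C1 * th a))/=.
by rewrite prodr_const -mulr_sumr sumth.
Qed.

Lemma stuck_config (y : Omega) (v : V) (t1 t2 : R) : stuck e0 v t1 t2 (fun e => w e y) ->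
  exists A C : {set V}, [/\ v \in A, forall a, a \in A -> a \notin C, (4 * #|A| <= n)%N, (#|C| < #|A|)%N &
  let D := ((A :\ v) :|: C)%SET in
  exists p : {ffun V -> V}, p \in pffun_on v D (mem A) /\
    [/\ {in D &, injective (fun x => eg e0 x (p x))}, forall x, x \in D -> x != p x,
        forall x, x \in D -> w (eg e0 x (p x)) y < thr v t1 t2 (p x) &
        forall a x, a \in A -> x \notin (A :|: C)%SET -> thr v t1 t2 a <= w (eg e0 a x) y]].
Proof.
move=> [A [p [sA A4 FA]]]; have [p' [[vA' inj hp] pA hF]] := spread_extend sA.
set F := frontier e0 v t1 t2 (fun e => w e y) A in FA inj hp pA hF.
have [vA _ _] := sA.
have dF x : x \in F -> x \notin A by rewrite inE => /andP[].
exists A, F; split=> //; first by move=> a aA; apply: contraL aA; exact: dF.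
move=> D.
have DE : D = (A :|: F)%SET :\ v.
  apply/finset.setP => x; rewrite /D finset.in_setU !finset.in_setD1 finset.in_setU.
  have [->|//] := eqVneq x v; rewrite /=; apply/negbTE; apply: contraL vA; exact: dF.
(* The value [v] off [D] normalises the parent function, so that it belongs to the finite family
   [pffun_on v D (mem A)] that is counted. *)
pose q : {ffun V -> V} := [ffun x => if x \in D then p' x else v].
have qE x : x \in D -> q x = p' x by rewrite ffunE => ->.
exists q; split.
  apply/pffun_onP; split.
    by apply/fintype.subsetP => x; rewrite inE /= ffunE; case: ifP => //; rewrite eqxx.
  move=> _ /fintype.imageP[x xD ->]; rewrite qE//; apply: pA; rewrite -DE; exact: xD.
split.
- move=> x x' xD x'D; rewrite (qE _ xD) (qE _ x'D); apply: inj; rewrite -DE//.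
- by move=> x xD; rewrite qE//; move: xD; rewrite DE => /hp[].
- by move=> x xD; rewrite qE//; move: xD; rewrite DE => /hp[].
- move=> a x aA; rewrite finset.in_setU negb_or => /andP[xA xF]; rewrite leNgt; apply/negP => lt.
  by move: xF; rewrite inE xA /=; apply/negP; rewrite negbK; apply/existsP; exists a; rewrite aA.
Qed.

Lemma small_stuck (v : V) (t1 t2 : R) : 1 <= C1 -> t1 = 112 * ln n%:R / n%:R -> t2 = 1024 * C1 / n%:R ->
  t1 <= t0 -> t2 <= t0 ->
  small P [set y | stuck e0 v t1 t2 (fun e => w e y)] (4 / n%:R ^+ 11).
Proof.
move=> C11 t1E t2E t1t0 t2t0; have n0 : (0 < n)%N by apply/card_gt0P; exists v.
have nR : 0 < n%:R :> R by rewrite ltr0n.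
have t10 : 0 <= t1 <= t0 by rewrite t1t0 t1E divr_ge0// mulr_ge0// ln_ge0// ler1n.
have t20 : 0 <= t2 <= t0.
  rewrite t2t0 andbT t2E; apply: divr_ge0; last exact: ler0n; apply: mulr_ge0; [exact: ler0n|exact: ltW].
pose Q (AC : {set V} * {set V}) := [&& v \in AC.1, [forall a in AC.1, a \notin AC.2],
   (4 * #|AC.1| <= n)%N & (#|AC.2| < #|AC.1|)%N].
pose bad (AC : {set V} * {set V}) := [set y | let A := AC.1 in let C := AC.2 in let D := ((A :\ v) :|: C)%SET in
  exists p : {ffun V -> V}, p \in pffun_on v D (mem A) /\
    [/\ {in D &, injective (fun x => eg e0 x (p x))}, forall x, x \in D -> x != p x,
        forall x, x \in D -> w (eg e0 x (p x)) y < thr v t1 t2 (p x) &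
        forall a x, a \in A -> x \notin (A :|: C)%SET -> thr v t1 t2 a <= w (eg e0 a x) y]].
pose p (AB : {set V} * {set V}) : R := (n%:R ^+ 13)^-1 * (('C(n, #|AB.1|)%:R)^-1 * ('C(n, #|AB.2|)%:R)^-1).
have hb AC : Q AC -> small P (bad AC) (p AC).
  move=> /and4P[vA /forall_inP dAC A4 CA].
  apply: small_sub (small_config t10 t20 vA dAC) => //.
  have cD : #|((AC.1 :\ v) :|: AC.2)%SET| = (#|AC.1|.-1 + #|AC.2|)%N.
    rewrite cardsU (_ : _ :&: _ = finset.set0)%SET; last first.
      apply/finset.setP => x; rewrite !inE; case: (boolP (x \in AC.1)) => [xA|]; last by rewrite andbF.
      by rewrite (negbTE (dAC x xA)) andbF.
    by rewrite cards0 subn0 (cardsD1 v AC.1) vA.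
  rewrite cD; apply: config_bound => //; [by apply/card_gt0P; exists v| |by rewrite t1E t2E].
  have := cardsC (AC.1 :|: AC.2)%SET; have := cardsU AC.1 AC.2; rewrite -/n; move: A4 CA; clear; lia.
apply: small_sub (small_exists hb).
  move=> y /stuck_config[A [C [vA dAC A4 CA h]]]; exists (A, C); split=> //.
  by rewrite /Q /= vA A4 CA !andbT; apply/forall_inP.
apply: (@le_trans _ _ (\sum_AB p AB)).
  rewrite [leRHS](bigID Q)/= lerDl sumr_ge0// => AB _.
  by rewrite mulr_ge0 ?invr_ge0 ?exprn_ge0// mulr_ge0 ?invr_ge0.
rewrite /p -mulr_sumr.
have -> : \sum_(i : {set V} * {set V}) ('C(n, #|i.1|)%:R^-1 / 'C(n, #|i.2|)%:R) = n.+1%:R * n.+1%:R :> R.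
  rewrite -(pair_bigA _ (fun A B : {set V} => ('C(n, #|A|)%:R)^-1 * ('C(n, #|B|)%:R)^-1 : R))/=.
  under eq_bigr do rewrite -mulr_sumr sum_card_bin.
  by rewrite -mulr_suml sum_card_bin.
have n1 : n.+1%:R <= 2 * n%:R :> R by rewrite -natrM ler_nat; lia.
rewrite mulrC ler_pdivrMr ?exprn_gt0// (_ : n%:R ^+ 13 = n%:R ^+ 11 * (n%:R * n%:R)); last by rewrite -expr2 -exprD.
have -> : 4 / n%:R ^+ 11 * (n%:R ^+ 11 * (n%:R * n%:R)) = (2 * n%:R) * (2 * n%:R) :> R.
  by field; rewrite gt_eqF.
by rewrite ler_pM.
Qed.
End SmallStuck.

Lemma expn_ln_le (R : realType) (C : R) (p : nat) : exists n0 : R, 1 <= n0 /\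
  forall N : R, n0 <= N -> C * ln N ^+ p <= N.
Proof.
pose D := `|C| * (p.+1)`!%:R.
have D0 : 0 <= D by rewrite mulr_ge0.
exists (expR D); split; first by rewrite -expR0 ler_expR.
move=> N hN; have N0 : 0 < N by apply: lt_le_trans hN; apply: expR_gt0.
have L0 : D <= ln N by rewrite -ler_expR lnK.
have lp : 0 <= ln N ^+ p by rewrite exprn_ge0// (le_trans D0).
have := @pow_div_fact_le_expR R (ln N) p.+1 (le_trans D0 L0); rewrite lnK//; apply: le_trans.
apply: (@le_trans _ _ (`|C| * ln N ^+ p)); first by rewrite ler_wpM2r// ler_norm.
rewrite ler_pdivlMr ?ltr0n ?fact_gt0//.
have -> : `|C| * ln N ^+ p * (p.+1)`!%:R = D * ln N ^+ p by rewrite /D; ring.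
by rewrite exprS ler_wpM2r.
Qed.

(** * The depth ratio in all regimes *)

Section DepthBounds.
Variables (V : finType) (R : realType) (e0 : edge V) (w : edge V -> R).
Hypothesis w_ge0 : forall e, 0 <= w e.

Lemma steiner_depth_le_size (T : {set V}) G r k : steiner_tree T G -> r \in G.1 -> (#|G.1|.-1 <= k)%N ->
  steiner_depth_min w T r k <= weight w G.
Proof.
move=> [tG sG] rG Gk; have [par [dep [d0 dle hp _ _]]] := tree_parent_weight e0 w_ge0 tG rG.
apply: (@steiner_depth_le _ _ w w_ge0 T r k G.2) => t tT.
have tG1 : t \in G.1 by apply: (fintype.subsetP sG).
apply: (reach_mono (subxx _) (leq_trans (dle t tG1) Gk)).
move E : (dep t) => i; elim: i t E tG1 {tT} => [|i IH] t dt tG1.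
  have [->|tr] := eqVneq t r; first exact: reach0.
  by have [_ _ _] := hp t tG1 tr; rewrite dt.
have [tr|tr] := eqVneq t r; first by move: dt; rewrite tr d0.
have [pG np eG dp] := hp t tG1 tr.
rewrite -addn1; apply: (reach_cat (y := par t)).
  by apply: IH => //; move: dp; rewrite dt => -[].
by apply: reach_nbr; rewrite (nbrE e0) eq_sym np egC.
Qed.
End DepthBounds.

Section DepthMain.
Variable R : realType.

(* In the regime [h^3 > N / B5] the number of terminals is at most [N / h],
   so each contributes [ln (N / m) >= ln h] to [a]. *)
Lemma scale_ge_ln (B5 N m : R) : 0 < B5 -> 0 < m -> m <= N -> 1 <= N -> B5 ^+ 2 <= N -> N < B5 * (N / phi N m) ^+ 3 ->
  m * ln N / 6 <= phi N m.
Proof.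
move=> B50 m0 mN N1 BN; set a := phi N m => h3.
have N0 : 0 < N by lra.
have a0 : 0 < a by apply: phi_gt0.
have am : m <= a by apply: phi_ge.
have h0 : 0 < N / a by rewrite divr_gt0.
have : ln N <= ln (B5 * (N / a) ^+ 3) by rewrite ler_ln ?posrE//; [exact: ltW|rewrite mulr_gt0// exprn_gt0].
rewrite lnM ?posrE ?exprn_gt0// lnXn// -[ln (N / a) *+ 3]mulr_natl => l1.
have : ln (B5 ^+ 2) <= ln N by rewrite ler_ln ?posrE ?exprn_gt0.
rewrite lnXn// -[ln B5 *+ 2]mulr_natl => l2.
have l3 : ln (N / a) <= ln (N / m).
  by rewrite ler_ln ?posrE ?divr_gt0// ler_pM2l// lef_pV2.
rewrite /a phi_lnE// -mulrA ler_pM2l//.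
by move: l1 l2 l3; clear; lra.
Qed.

Lemma depth_main (CG t0 c' cL eps C9 : R) : 1 <= CG -> 0 < t0 -> 0 < c' -> 0 < cL -> 0 < eps -> 0 < C9 ->
  exists (B n0 : R) (M : nat), 0 < B /\
  forall (V : finType) (e0 : edge V) (w : edge V -> R) (T : {set V}) r t (k K : nat) (Delta : R),
  let N : R := #|V|%:R in let a := phi N #|T|%:R in let h := N / a in
  (forall e, 0 <= w e) -> expander e0 CG t0 w -> n0 <= N -> t \in T ->
  (forall G, steiner_tree T G -> 11 * a <= #|G.1|.-1%:R -> c' * #|G.1|.-1%:R / N <= weight w G) ->
  (28 * ln N <= a -> cL / h <= steiner_min w T) ->
  ln N <= 2 ^+ K -> K%:R + Delta <= k%:R + 1 -> B * h <= Delta ->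
  r \in T \/ ((M <= #|T|)%N /\ exists F0 h0, [/\ reach F0 h0 r t, h0%:R <= C9 * ln N & wt w F0 <= C9 * ln N / N]) ->
  steiner_depth_min w T r k <= (1 + eps) * steiner_min w T.
Proof.
move=> CG1 t00 c'0 cL0 eps0 C90.
pose cM := Num.min cL (11 * c').
have cM0 : 0 < cM by rewrite lt_min cL0 mulr_gt0.
have [B [B5 [n1 [B0 B50 ratio]]]] := depth_ratio CG1 t00 c'0 cM0 eps0.
pose eta := eps / 4 * cM.
have eta0 : 0 < eta by rewrite mulr_gt0// divr_gt0.
have [p1 [p1_1 hp1]] := @expn_ln_le R (28 * 309) 2.
have [p2 [p2_1 hp2]] := @expn_ln_le R (28 ^+ 3 / B5 + 1) 3.
have [p3 [p3_1 hp3]] := @expn_ln_le R (B5 * (4 * C9) ^+ 3 + 1) 3.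
(* [168 = 6 * 28] terminals force [a >= 28 * ln N] through [scale_ge_ln], and [6 * (C9 / eta)] of
   them make the link of the root, of cost at most [C9 * ln N / N], negligible against [a / N]. *)
pose M := (Num.truncn (168 + 6 * (C9 / eta))).+1.
have hM : 168 + 6 * (C9 / eta) <= M%:R by apply/ltW/truncnS_gt.
have q0 : 0 < C9 / eta by rewrite divr_gt0.
exists (B + 1), (n1 `|` p1 `|` p2 `|` p3 `|` expR 2 `|` B5 ^+ 2)%O, M; split; first by rewrite addr_gt0.
move=> V e0 w T r t k K Delta N a h w0 HG; rewrite !leUx => /andP[/andP[/andP[/andP[/andP[N1 N2] N3] N4] N5] N6].
move=> tT heavy Sge lnK2 kD BD hr.
have Npos : (0 < #|V|)%N by apply/card_gt0P; exists t.
have N_1 : 1 <= N by rewrite ler1n.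
have N0 : 0 < N by rewrite ltr0n.
have m0 : (0 < #|T|)%N by apply/card_gt0P; exists t.
have mR : 0 < #|T|%:R :> R by rewrite ltr0n.
have m1 : 1 <= #|T|%:R :> R by rewrite ler1n.
have mN : #|T|%:R <= N by rewrite ler_nat max_card.
have a0 : 0 < a by apply: phi_gt0.
have am : #|T|%:R <= a by apply: phi_ge.
have aN : a <= N by apply: phi_le.
have h1 : 1 <= h by rewrite ler_pdivlMr// mul1r.
have h0 : 0 < h by apply: lt_le_trans h1.
have L2 : 2 <= ln N by rewrite -ler_expR lnK.
have L0 : 0 < ln N by apply: lt_le_trans L2.
have Dh : h <= Delta.
  by apply: le_trans BD; rewrite ler_pMl// lerDr ltW.
have BD' : B * h <= Delta.
  by apply: le_trans BD; rewrite ler_pM2r// lerDl.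
(* A small [a] means that [h] exceeds [N / (28 * ln N)], whose cube is far larger than [N]. *)
have small_a : a < 28 * ln N -> B5 * h ^+ 3 <= N -> False.
  move=> a28 h3.
  have hh : N / (28 * ln N) < h by rewrite ltr_pM2l// ltf_pV2 ?posrE//; apply: mulr_gt0.
  have : B5 * (N / (28 * ln N)) ^+ 3 < N.
    apply: lt_le_trans h3; rewrite ltr_pM2l// ltrXn2r//.
    by apply/ltW; apply: divr_gt0 => //; apply: mulr_gt0.
  have := hp2 N N3.
  set q := 28 ^+ 3 / B5; have q1 : 0 < q by rewrite divr_gt0// exprn_gt0.
  have -> : B5 * (N / (28 * ln N)) ^+ 3 = N ^+ 3 / (q * ln N ^+ 3) by rewrite /q; field; rewrite !gt_eqF.
  have l3 : 0 < ln N ^+ 3 by rewrite exprn_gt0.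
  rewrite ltr_pdivrMr; last by apply: mulr_gt0.
  move=> i1 i2.
  have i3 : N ^+ 2 < q * ln N ^+ 3 by rewrite -(ltr_pM2l N0) -exprS.
  have i4 : N <= N ^+ 2 by rewrite expr2 ler_peMr// ltW.
  by move: i1 i3 i4 l3; clear; lra.
have joinC : r \in T \/ 28 * ln N <= a.
  have [|hr'] := hr; [by left|right]; move: hr' => [hm _].
  rewrite leNgt; apply/negP => lt.
  have [h3|h3] := leP (B5 * h ^+ 3) N; first exact: (small_a lt h3).
  have := scale_ge_ln B50 mR mN N_1 N6 h3; rewrite -/a.
  have : 168 * ln N <= #|T|%:R * ln N.
    rewrite ler_pM2r//; have : M%:R <= #|T|%:R :> R by rewrite ler_nat.
    by move: hM q0; clear; lra.
  by move: lt; clear; lra.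
have S0 : 0 <= steiner_min w T.
  by have [G _ ->] := steiner_opt e0 w0 T t; apply: wt_ge0.
have [le|lb] : steiner_depth_min w T r k <= steiner_min w T \/ cM / h <= steiner_min w T.
- have [a28|a28] := leP (28 * ln N) a.
    right; apply: le_trans (Sge a28); rewrite ler_pM2r ?invr_gt0// /cM ge_min lexx//.
  have rT : r \in T by case: joinC => //; rewrite leNgt a28.
  have [G sG SE] := steiner_opt e0 w0 T t.
  have rG : r \in G.1 by case: sG => _ /fintype.subsetP; apply.
  have [big|sm] := leP (11 * a) #|G.1|.-1%:R.
    right; rewrite SE; apply: le_trans (heavy G sG big).
    have -> : cM / h = cM * a / N by rewrite /h invf_div mulrA.
    rewrite ler_pM2r ?invr_gt0//; apply: (@le_trans _ _ (c' * (11 * a))); last by rewrite ler_pM2l.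
    by rewrite mulrA ler_pM2r// [c' * _]mulrC /cM ge_min lexx orbT.
  left; rewrite SE; apply: (steiner_depth_le_size e0 w0 sG rG).
  rewrite -(ler_nat R); apply/ltW; apply: lt_le_trans sm _.
  (* The optimal tree has fewer than [11 * 28 * ln N = 308 * ln N] edges; the extra [ln N] absorbs
     the 1 in [K + Delta <= k + 1]. Hence the tree fits into depth [k] as it stands. *)
  have hh : 309 * ln N <= h.
    rewrite ler_pdivlMr//; apply: le_trans (hp1 N N2).
    have -> : 28 * 309 * ln N ^+ 2 = 309 * ln N * (28 * ln N) by ring.
    by apply: ler_wpM2l; [apply: mulr_ge0; [exact: ler0n|exact: ltW]|exact: ltW].
  have K0 : 0 <= K%:R :> R by [].
  by move: a28 hh Dh kD K0 L2; clear; lra.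
- by apply: le_trans le _; rewrite mulrDl mul1r lerDl mulr_ge0// ltW.
case: hr => [rT|[hm [F0 [h' [r0 h'le wF0]]]]].
  apply: (ratio V e0 w T r r k K Delta) => //; right; exists finset.set0, 0%N.
  by split; [exact: reach0|rewrite divr_ge0// (le_trans (ltW h0))|rewrite wt0 mulr_ge0// divr_ge0// ltW].
apply: (ratio V e0 w T r t k K Delta) => //.
have [h3|h3] := leP (B5 * h ^+ 3) N; [by left|right].
have Dh4 : 4 * C9 * ln N <= h.
  rewrite leNgt; apply/negP => lt.
  have : B5 * h ^+ 3 < B5 * (4 * C9 * ln N) ^+ 3.
    by rewrite ltr_pM2l// ltrXn2r// ltW.
  have := hp3 N N4; have l3 : 0 < ln N ^+ 3 by rewrite exprn_gt0.
  have -> : B5 * (4 * C9 * ln N) ^+ 3 = B5 * (4 * C9) ^+ 3 * ln N ^+ 3 by ring.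
  by move: h3 l3; clear; lra.
exists F0, h'; split=> //.
  by apply: le_trans h'le _; move: Dh4 Dh; clear; lra.
apply: le_trans wF0 _; have aL := scale_ge_ln B50 mR mN N_1 N6 h3; rewrite -/a in aL.
have -> : eps / 4 * (cM / h) = eta * a / N by rewrite /h /eta invf_div; ring.
rewrite ler_pM2r ?invr_gt0//.
have -> : C9 * ln N = eta * ((C9 / eta) * ln N) by field; rewrite gt_eqF.
rewrite ler_pM2l//; apply: le_trans aL.
have : 6 * (C9 / eta) * ln N <= #|T|%:R * ln N.
  rewrite ler_pM2r//; have : M%:R <= #|T|%:R :> R by rewrite ler_nat.
  by move: hM; clear; lra.
by clear; lra.
Qed.
End DepthMain.

Lemma exists_hops (R : realType) (n : nat) : 2 <= ln n%:R :> R ->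
  exists2 J : nat, (n <= 2 ^ J)%N & J%:R <= 3 * ln n%:R :> R.
Proof.
move=> L2; have n1 : 1 <= n%:R :> R.
  by rewrite ler1n lt0n; apply/eqP => n0; move: L2; rewrite n0 ln0//; lra.
have n0 : 0 < n%:R :> R by apply: lt_le_trans n1.
have [J /andP[h1 h2]] := pow2_between n1; exists J; first by rewrite -(ler_nat R) natrX.
have : ln (2 ^+ J) <= ln (2 * n%:R) :> R by rewrite ler_ln ?posrE ?exprn_gt0 ?mulr_gt0.
rewrite lnXn// lnM ?posrE// -[ln 2 *+ J]mulr_natl => h3.
have := @ln2_gt_half R; have : 0 <= J%:R :> R by [].
have : ln 2 <= 2 - 1 :> R by apply: ln_le_subr1.
by move: h3 L2; move: (J%:R) (ln 2) => j l; clear; nra.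
Qed.

Lemma steiner_min_gt0 (V : finType) (R : realType) (e0 : edge V) (w : edge V -> R) (T : {set V}) :
  (forall e, 0 < w e) -> (2 <= #|T|)%N -> 0 < steiner_min w T.
Proof.
move=> w0 T2; have w0' e : 0 <= w e by exact: ltW.
have /card_gt0P[t tT] : (0 < #|T|)%N by apply: leq_trans T2.
have /card_gt0P[t' t'T] : (0 < #|T :\ t|)%N by move: T2; rewrite (cardsD1 t T) tT ltnS.
have [G [tG sG] ->] := steiner_opt e0 w0' T t.
move: t'T; rewrite finset.in_setD1 => /andP[t't t'T].
have tG1 := fintype.subsetP sG t tT; have t'G1 := fintype.subsetP sG t' t'T.
have [par [dep [_ _ hp _ _]]] := tree_parent_weight e0 w0' tG tG1.
have [_ _ eG _] := hp t' t'G1 t't.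
by apply: lt_le_trans (w0 (eg e0 t' (par t'))) _; rewrite /weight (bigD1 _ eG)/= lerDl sumr_ge0.
Qed.

Lemma ler_div_swap (R : realType) (x y z : R) : 0 < y -> 0 < z -> x / z <= y -> x / y <= z.
Proof. by move=> y0 z0; rewrite !ler_pdivrMr// [z * y]mulrC. Qed.

(** * The depth ratio with high probability *)

Section Good.
Variables (R : realType) (d : measure_display) (Omega : measurableType d) (P : probability Omega R).
Variables (V : finType) (e0 : edge V) (w : edge V -> {RV P >-> R}).
Variable C1 : R.
Hypothesis w_up : forall e (t : R), 0 <= t -> (P [set x | (w e x < t)%R] <= (C1 * t)%:E)%E.

(** Division by zero yields 0, so the ratios are meaningful only where the minimum is positive. This
    bound confines the exception to a null event. *)
Lemma small_nonpos : 0 < C1 -> small P [set y | exists e, w e y <= 0] 0.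
Proof.
move=> C10; have h e : true -> small P [set y | w e y <= 0] 0.
  move=> _; have mle : measurable [set y | w e y <= 0].
    rewrite -[X in measurable X]setTI; have := @measurable_funPT _ _ _ _ (w e) measurableT [set z | z <= 0].
    by apply; rewrite (_ : [set z | z <= 0] = `]-oo, 0]%classic)//; apply/seteqP; split=> z; rewrite /= in_itv.
  apply: small_prob => //; apply/lee_addgt0Pr => eps eps0; rewrite add0e.
  have e1 : 0 < eps / C1 by rewrite divr_gt0.
  have := w_up e (ltW e1); rewrite mulrCA divff ?gt_eqF// mulr1; apply: le_trans.
  apply: le_measure; rewrite ?inE//; last by move=> y /= ly; apply: le_lt_trans ly e1.
  rewrite -[X in measurable X]setTI; have := @measurable_funPT _ _ _ _ (w e) measurableT [set z | z < eps / C1].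
  by apply; exact: measurable_lt.
by apply: small_sub (small_exists h); [move=> y [e we]; exists e|rewrite big1].
Qed.
End Good.

Section Whp.
Variable R : realType.

Lemma depth_ratio_whp (C1 t0 eps : R) : 1 <= C1 -> 0 < t0 -> 0 < eps ->
  exists (B n0 C : R) (M : nat), 0 < B /\
  forall d (Omega : measurableType d) (P : probability Omega R) (V : finType) (e0 : edge V) (w : edge V -> {RV P >-> R}),
  mutually_independent w ->
  (forall e (t : R), 0 <= t -> (P [set x | (w e x < t)%R] <= (C1 * t)%:E)%E) ->
  (forall e (t : R), 0 <= t <= t0 -> (P [set x | (t <= w e x)%R] <= (expR (- (t / 2)))%:E)%E) ->
  forall (T : {set V}) r (k K : nat) (Delta : R),
  let N : R := #|V|%:R in let a := phi N #|T|%:R in let h := N / a in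
  (2 <= #|T|)%N -> n0 <= N -> ln N <= 2 ^+ K -> K%:R + Delta <= k%:R + 1 -> B * h <= Delta ->
  r \in T \/ (M <= #|T|)%N ->
  small P [set y | ~ (0 < steiner_min (fun e => w e y) T /\
    steiner_depth_min (fun e => w e y) T r k <= (1 + eps) * steiner_min (fun e => w e y) T)] (C / N ^+ 10).
Proof.
move=> C11 t00 eps0; have C10 : 0 < C1 by apply: lt_le_trans C11.
pose c' := (8 * C1 * expR 2)^-1; pose cL := (80 * C1 * expR (expR 2))^-1.
have c'0 : 0 < c' by rewrite invr_gt0; apply: mulr_gt0; [exact: mulr_gt0|exact: expR_gt0].
have cL0 : 0 < cL by rewrite invr_gt0; apply: mulr_gt0; [exact: mulr_gt0|exact: expR_gt0].
(* [6144 = 3 * 2048] accounts for at most [3 * ln N] hops from either end at threshold [t2]; 2000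
   covers both first edges, the middle edge and the number of hops. *)
pose C9 : R := 2000 + 6144 * C1.
have C90 : 0 < C9 by apply: addr_gt0; [rewrite ltr0n|apply: mulr_gt0; [rewrite ltr0n|exact: C10]].
have CG1 : 1 <= 22 :> R by rewrite ler1n.
have [B [n1 [M [B0 main]]]] := depth_main CG1 t00 c'0 cL0 eps0 C90.
have [p1 [p1_1 hp1]] := @expn_ln_le R (112 / t0) 1.
exists B, (n1 `|` p1 `|` expR 2 `|` (1024 * C1 / t0) `|` (64 * 22 / t0))%O, (20 + 2 * expR 1), M; split=> //.
move=> d Omega P V e0 w w_indep w_up w_lo T r k K Delta N a h T2.
rewrite !leUx => /andP[/andP[/andP[/andP[N1 N2] N3] N4] N5] lnK2 kD BD hr.
have Tpos : (0 < #|T|)%N by apply: leq_trans T2.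
have [t tT] : exists t, t \in T by apply/card_gt0P.
have Npos : (0 < #|V|)%N by apply/card_gt0P; exists t.
have N0 : 0 < N by rewrite ltr0n.
have N_1 : 1 <= N by rewrite ler1n.
have L2 : 2 <= ln N by rewrite -ler_expR lnK.
have L0 : 0 < ln N by apply: lt_le_trans L2.
have a0 : 0 < a by apply: steiner_scale_pos.
pose t1 : R := 112 * ln N / N; pose t2 : R := 1024 * C1 / N.
have t1t0 : t1 <= t0.
  have -> : t1 = (112 / t0 * ln N ^+ 1) * t0 / N by rewrite /t1; field; rewrite !gt_eqF.
  by rewrite ler_pdivrMr// [t0 * N]mulrC; apply: ler_wpM2r; [exact: ltW|exact: hp1].
have t2t0 : t2 <= t0 by exact: ler_div_swap.
have s_t0 : 64 * 22 / N <= t0 by exact: ler_div_swap.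
have t10 : 0 <= t1 by apply: divr_ge0; [apply: mulr_ge0; [exact: ler0n|exact: ltW]|exact: ltW].
have t20 : 0 <= t2 by apply: divr_ge0; [apply: mulr_ge0; [exact: ler0n|exact: ltW]|exact: ltW].
have [J nJ JL] := exists_hops L2.
have bad1 := small_nonpos w_up C10.
have bad2 := small_not_expander e0 w_indep w_lo Npos.
have bad3 := small_light_long_trees e0 w_indep C10 w_up T2.
have bad4 : small P [set y | 28 * ln N <= a /\ ((forall e, 0 <= w e y) /\ exists G, [/\ steiner_tree T G, true &
      weight (fun e => w e y) G <= cL * a / N])] (expR 1 / N ^+ 10).
  have [a28|a28] := leP (28 * ln N) a.
    by apply: small_sub (small_light_steiner e0 w_indep C10 w_up T2 a28) => // y [].
  by apply: small_sub (small_set0 P) => [y [] //|]; rewrite divr_ge0 ?expR_ge0// exprn_ge0// ltW.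
have bad5 := small_stuck e0 w_indep C10 w_up w_lo r C11 (erefl t1) (erefl t2) t1t0 t2t0.
have bad6 := small_stuck e0 w_indep C10 w_up w_lo t C11 (erefl t1) (erefl t2) t1t0 t2t0.
apply: small_sub (smallU (smallU (smallU (smallU (smallU bad1 bad2) bad3) bad4) bad5) bad6).
  move=> y /= hy; apply: contrapT => /not_orP[/not_orP[/not_orP[/not_orP[/not_orP[g1 g2] g3] g4] g5] g6].
  apply: hy; have wpos e : 0 < w e y.
    by rewrite ltNge; apply/negP => le; apply: g1; exists e.
  have w0 e : 0 <= w e y by exact: ltW.
  have HG : expander e0 22 t0 (fun e => w e y) by apply: contrapT.
  split.
    exact: (steiner_min_gt0 e0 wpos T2).
  apply: (main V e0 (fun e => w e y) T r t k K Delta) => //.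
  - move=> G sG big; rewrite leNgt; apply/negP => lt; apply: g3; split=> //; exists G; split=> //; exact: ltW.
  - move=> a28; rewrite leNgt; apply/negP => lt; apply: g4; split=> //; split=> //.
    have [G sG SE] := steiner_opt e0 w0 T t; exists G; split=> //.
    by rewrite -SE; apply/ltW; move: lt; rewrite invf_div mulrA.
  - case: hr => [rT|mM]; [by left|right; split=> //].
    have CG0 : 0 < 22 :> R by rewrite ltr0n.
    have [F rF wF] := spread_connect w0 CG0 HG t10 t20 nJ s_t0 g5 g6.
    exists F, (J + J.+1)%N; split=> //.
      rewrite natrD -natr1; have : 0 <= 6144 * C1 * ln N.
        by apply: mulr_ge0; [apply: mulr_ge0; [exact: ler0n|exact: ltW]|exact: ltW].
      by rewrite /C9; move: JL L2; clear; lra.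
    apply: le_trans wF _.
    have -> : 2 * (t1 + J%:R * t2) + 64 * 22 / N = (224 * ln N + J%:R * (2048 * C1) + 1408) / N.
      by rewrite /t1 /t2; field; rewrite gt_eqF.
    rewrite ler_pM2r ?invr_gt0//.
    have : J%:R * (2048 * C1) <= (3 * ln N) * (2048 * C1).
      by apply: ler_wpM2r; [apply: mulr_ge0; [exact: ler0n|exact: ltW]|exact: JL].
    by rewrite /C9; move: L2; clear; lra.
have i10 : 0 < N ^+ 10 by rewrite exprn_gt0.
have i11 : 4 / N ^+ 11 <= 4 / N ^+ 10.
  by rewrite ler_pM2l// lef_pV2 ?posrE ?exprn_gt0// exprS ler_peMl// ltW.
have i20 : 4 / N ^+ 20 <= 4 / N ^+ 10.
  by rewrite ler_pM2l// lef_pV2 ?posrE ?exprn_gt0//; apply: ler_weXn2l.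
have : 0 <= 1 / N ^+ 10 by rewrite divr_ge0// ltW.
by move: i11 i20; rewrite -/N; clear; lra.
Qed.
End Whp.

Lemma bin_le_pow (R : realType) (n k : nat) : 'C(n, k)%:R <= n%:R ^+ k :> R.
Proof.
apply: le_trans (@bin_le_pow_div_fact R n k) _.
by rewrite ler_pdivrMr ?ltr0n ?fact_gt0// ler_peMr ?exprn_ge0// ler1n fact_gt0.
Qed.

Lemma card_edge_le (V : finType) (R : realType) : #|edge V|%:R <= #|V|%:R ^+ 2 :> R.
Proof.
have -> : #|edge V| = 'C(#|V|, 2).
  by rewrite -card_draws card_sig; apply: eq_card => A; rewrite !inE.
exact: bin_le_pow.
Qed.

(** * Tails of the ratio *)

Section Tails.
Variables (R : realType) (d : measure_display) (Omega : measurableType d) (P : probability Omega R).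
Variables (V : finType) (e0 : edge V) (w : edge V -> {RV P >-> R}).
Hypothesis w_indep : mutually_independent w.
Variables (C1 EW : R).
Hypothesis C1_gt0 : 0 < C1 :> R.
Hypothesis EW_ge0 : 0 <= EW :> R.
Hypothesis w_up : forall e (t : R), 0 <= t -> (P [set x | (w e x < t)%R] <= (C1 * t)%:E)%E.
Hypothesis w_tail : forall e (s : R), 0 < s -> (P [set x | (s <= w e x)%R] <= (EW / s)%:E)%E.
Let n := #|V|.

(** Each of four disjoint two-edge paths must have an edge of weight at least [s]. Recording the set
    of paths whose first edge is heavy gives 16 cases, each with four distinct edges. *)
Lemma small_long_paths (r t : V) (s : R) : r != t -> (6 <= n)%N -> 0 < s ->
  small P [set y | forall x, x != r -> x != t -> 2 * s <= w (eg e0 r x) y + w (eg e0 x t) y] (16 * (EW / s) ^+ 4).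
Proof.
move=> rt n6 s0.
have [Y YS Y4] : exists2 Y : {set V}, Y \subset (~: [set r; t])%SET & #|Y| = 4.
  apply: exists_subset_card; have := cardsC [set r; t]%SET; rewrite cards2 rt -/n; move: n6; clear; lia.
have YN x : x \in Y -> (r != x) /\ (x != t).
  by move=> /(fintype.subsetP YS); rewrite !inE negb_or eq_sym => /andP[].
pose f (g : {set V}) x := if x \in g then eg e0 r x else eg e0 x t.
have finj g : {in Y &, injective (f g)}.
  move=> x x' /YN[rx xt] /YN[rx' xt']; rewrite /f.
  case: ifP => _; case: ifP => _ E.
  - by have [[_ ->]|[rE _]] := eg_inj rx rx' E; rewrite // rE eqxx in rx'.
  - have [[rE _]|[rE _]] := eg_inj rx xt' E; first by rewrite rE eqxx in rx'.
    by rewrite rE eqxx in rt.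
  - have [[rE _]|[_ rE]] := eg_inj xt rx' E; first by rewrite rE eqxx in rx.
    by rewrite rE eqxx in rt.
  - by have [[->]|[_ tE]] := eg_inj xt xt' E; rewrite // tE eqxx in xt'.
have hb g : g \in powerset Y -> small P [set y | forall x, x \in Y -> s <= w (f g x) y] ((EW / s) ^+ 4).
  move=> _; have := small_rect w_indep (finj g) (fun=> measurable_ge s) (fun x _ => w_tail (f g x) s0).
  by apply: small_sub => //; rewrite prodr_const Y4.
apply: small_sub (small_exists hb).
  move=> y hy; exists [set x in Y | s <= w (eg e0 r x) y]%SET; split.
    by rewrite powersetE; apply/fintype.subsetP => x; rewrite inE => /andP[].
  move=> x xY; have [rx xt] := YN x xY; rewrite /f inE xY /=; case: ifP => // /negbT; rewrite -ltNge => lt.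
  have := hy x; rewrite eq_sym => /(_ rx xt); lra.
by rewrite sumr_const card_powerset Y4 -[_ *+ _]mulr_natl.
Qed.

Lemma small_depth_large (T : {set V}) (r : V) (k : nat) (v : R) : (6 <= n)%N -> (2 <= k)%N -> (0 < #|T|)%N -> 0 < v ->
  small P [set y | (forall e, 0 <= w e y) /\ v <= steiner_depth_min (fun e => w e y) T r k]
    (n%:R * (16 * (EW / (v / (2 * n%:R))) ^+ 4)).
Proof.
move=> n6 k2 T0 v0; have n0 : 0 < n%:R :> R by rewrite ltr0n; apply: leq_trans n6.
set s := v / (2 * n%:R); have s0 : 0 < s by rewrite divr_gt0// mulr_gt0.
have hb t : (r != t) -> small P [set y | forall x, x != r -> x != t -> 2 * s <= w (eg e0 r x) y + w (eg e0 x t) y]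
    (16 * (EW / s) ^+ 4) by move=> rt; apply: small_long_paths.
have p0 : 0 <= 16 * (EW / s) ^+ 4 by rewrite mulr_ge0// exprn_ge0// divr_ge0// ltW.
apply: small_sub (small_exists hb); last first.
  apply: (@le_trans _ _ (\sum_(t : V) (16 * (EW / s) ^+ 4))).
    by rewrite [leRHS](bigID (fun t => r != t))/= lerDl sumr_ge0.
  by rewrite sumr_const -[_ *+ _]mulr_natl.
move=> y [w0 hv]; apply: contrapT => h.
have short t : exists F, reach F k r t /\ wt (fun e => w e y) F < v / n%:R.
  have [->|rt] := eqVneq r t.
    exists finset.set0; split; first by apply: reach_mono (reach0 _ _).
    by rewrite wt0 divr_gt0.
  have [x [xr xt lt]] : exists x, [/\ x != r, x != t & w (eg e0 r x) y + w (eg e0 x t) y < 2 * s].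
    apply: contrapT => h2; apply: h; exists t; split=> // x xr xt; rewrite leNgt; apply/negP => lt.
    by apply: h2; exists x.
  exists [set eg e0 r x; eg e0 x t]%SET; split.
    apply: (reach_mono (subxx _) k2); apply: (reach_cat (i := 1) (j := 1) (y := x)); apply: reach_nbr.
      by rewrite (nbrE e0) eq_sym xr !inE eqxx.
    by rewrite (nbrE e0) xt !inE eqxx orbT.
  apply: le_lt_trans (wtU w0 _ _) _; rewrite !wt1; apply: lt_le_trans lt _.
  by rewrite le_eqVlt; apply/orP; left; apply/eqP; rewrite /s; field; rewrite gt_eqF.
have /boolp.choice[Ft hF] := short.
pose F : {set edge V} := (\bigcup_(t in T) Ft t)%SET.
have rF t : t \in T -> reach F k r t.
  move=> tT; have [rt _] := hF t; apply: reach_mono rt => //; exact: (finset.bigcup_sup t).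
have := steiner_depth_le w0 rF; apply/negP; rewrite -ltNge.
apply: lt_le_trans hv; apply: le_lt_trans (wt_bigcup w0 _ _) _.
apply: (@lt_le_trans _ _ (\sum_(t in T) (v / n%:R))).
  apply: ltr_sum => [|t _]; last by case: (hF t).
  by have /card_gt0P[t tT] := T0; apply/hasP; exists t; rewrite ?mem_index_enum.
rewrite sumr_const -[_ *+ _]mulr_natl mulrCA ler_piMr ?(ltW v0)// ler_pdivrMr// mul1r ler_nat max_card//.
Qed.

Lemma small_four_light (s : R) : 0 < s ->
  small P [set y | exists X : {set edge V}, #|X| == 4 /\ forall e, e \in X -> w e y < s] (n%:R ^+ 8 * (C1 * s) ^+ 4).
Proof.
move=> s0; have hb (X : {set edge V}) : #|X| == 4 -> small P [set y | forall e, e \in X -> w e y < s] ((C1 * s) ^+ 4).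
  move=> /eqP X4.
  have idi : {in X &, injective (fun e : edge V => e)} by [].
  have := small_rect w_indep idi (fun=> measurable_lt s) (fun e _ => w_up e (ltW s0)).
  by apply: small_sub => //; rewrite prodr_const X4.
apply: small_sub (small_exists hb) => //.
rewrite sumr_const -[_ *+ _]mulr_natl; apply: ler_wpM2r.
  by rewrite exprn_ge0// mulr_ge0// ltW.
have -> : #|[pred X : {set edge V} | #|X| == 4]| = 'C(#|edge V|, 4).
  by rewrite -card_draws; apply: eq_card => A; rewrite !inE.
apply: le_trans (bin_le_pow R _ _) _.
by rewrite (exprM _ 2 4) lerXn2r ?nnegrE ?exprn_ge0// card_edge_le.
Qed.

Lemma tree_four_edges (wy : edge V -> R) (T : {set V}) G : (forall e, 0 <= wy e) -> steiner_tree T G -> (0 < #|T|)%N ->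
  (5 <= #|G.1|)%N -> exists2 X : {set edge V}, X \subset G.2 & #|X| = 4.
Proof.
move=> w0 [tG sG] /card_gt0P[t tT] G5.
have tG1 := fintype.subsetP sG t tT.
have [par [dep [_ _ hp inj _]]] := tree_parent_weight e0 w0 tG tG1.
pose Z : {set edge V} := [set eg e0 v (par v) | v in G.1 :\ t]%SET.
have Z4 : (4 <= #|Z|)%N by rewrite card_in_imset//; move: G5; rewrite (cardsD1 t G.1) tG1.
have [X XZ X4] := exists_subset_card Z4; exists X => //; apply: fintype.subset_trans XZ _.
apply/fintype.subsetP => e /finset.imsetP[v]; rewrite finset.in_setD1 => /andP[vt vG] ->.
by have [] := hp v vG vt.
Qed.

(** If [D < sqrt u], a ratio of at least [u] forces [S < 2 / sqrt u]. A ratio above 1 excludes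
    optimal trees on at most four vertices that contain the root, as those satisfy the depth bound;
    so there are four light edges. With four independent edges a finite first moment yields a tail
    [u ^- 2], which is integrable. *)
Lemma small_ratio_large (T : {set V}) (r : V) (k : nat) (u : R) : (6 <= n)%N -> (4 <= k)%N -> (2 <= #|T|)%N ->
  r \in T \/ (5 <= #|T|)%N -> 0 < u ->
  small P [set y | 1 < steiner_depth_min (fun e => w e y) T r k / steiner_min (fun e => w e y) T /\
                   u <= steiner_depth_min (fun e => w e y) T r k / steiner_min (fun e => w e y) T]
    ((256 * EW ^+ 4 + 16 * C1 ^+ 4) * n%:R ^+ 8 / u ^+ 2).
Proof.
move=> n6 k4 T2 rT u0.
have n0 : 0 < n%:R :> R by rewrite ltr0n; apply: leq_trans n6.
have n1 : 1 <= n%:R :> R by rewrite ler1n; apply: leq_trans n6.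
have T0 : (0 < #|T|)%N by apply: leq_trans T2.
pose v := Num.sqrt u; have v0 : 0 < v by rewrite sqrtr_gt0.
have vv : v * v = u by rewrite -expr2 sqr_sqrtr// ltW.
have k2 : (2 <= k)%N by apply: leq_trans k4.
have s0 : 0 < 2 / v by rewrite divr_gt0.
apply: small_sub (smallU (smallU (small_nonpos w_up C1_gt0) (small_depth_large r n6 k2 T0 v0)) (small_four_light s0)).
  move=> y /= [h1 hu]; apply: contrapT => /not_orP[/not_orP[g1 g2] g3].
  have wpos e : 0 < w e y by rewrite ltNge; apply/negP => le; apply: g1; exists e.
  have w0 e : 0 <= w e y by exact: ltW.
  have S0 : 0 < steiner_min (fun e => w e y) T by exact: (steiner_min_gt0 e0 wpos T2).
  set S := steiner_min _ T in h1 hu S0; set D := steiner_depth_min _ T r k in h1 hu g2.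
  have Dv : D < v by rewrite ltNge; apply/negP => le; apply: g2.
  have Sv : S < 2 / v.
    have : S * v < 2 * 1; last by rewrite mulr1 ltr_pdivlMr.
    have : u * S <= D by rewrite -ler_pdivlMr.
    have : v * (v * S) < v * 1 -> v * S < 1 by rewrite ltr_pM2l.
    by rewrite mulrA vv mulr1; lra.
  have DS : S < D by move: h1; rewrite ltr_pdivlMr// mul1r.
  have [t tT] : exists t, t \in T by apply/card_gt0P.
  have [G sG SE] := steiner_opt e0 w0 T t; rewrite -/S in SE.
  have G5 : (5 <= #|G.1|)%N.
    have sTG : T \subset G.1 by case: sG.
    case: rT => [rT|T5]; last by apply: leq_trans T5 (subset_leq_card sTG).
    rewrite ltnNge; apply/negP => G4.
    have : D <= weight (fun e => w e y) G.
      apply: (steiner_depth_le_size e0 w0 sG (fintype.subsetP sTG r rT)).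
      by apply: leq_trans k4; move: G4; clear; lia.
    by rewrite -SE leNgt DS.
  have [X XG X4] := tree_four_edges w0 sG T0 G5.
  apply: g3; exists X; split; first by rewrite X4.
  move=> e eX; apply: le_lt_trans Sv; rewrite SE /weight (bigD1 e) ?(fintype.subsetP XG)//= lerDl sumr_ge0//.
have -> : n%:R * (16 * (EW / (v / (2 * n%:R))) ^+ 4) = 256 * EW ^+ 4 * n%:R ^+ 5 / u ^+ 2.
  by rewrite -vv; field; rewrite !gt_eqF.
have -> : n%:R ^+ 8 * (C1 * (2 / v)) ^+ 4 = 16 * C1 ^+ 4 * n%:R ^+ 8 / u ^+ 2.
  by rewrite -vv; field; rewrite !gt_eqF.
rewrite add0r -mulrDl ler_pM2r ?invr_gt0 ?exprn_gt0//.
rewrite [leRHS]mulrDl lerD2r; apply: ler_wpM2l; last exact: ler_weXn2l.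
by apply: mulr_ge0; [exact: ler0n|exact: exprn_ge0].
Qed.
End Tails.

(** * Measurability and convergence *)

Section Measurability.
Variables (R : realType) (d : measure_display) (Omega : measurableType d).

Lemma measurable_inv : measurable_fun [set: R] (@GRing.inv R).
Proof.
have m0 : measurable [set (0 : R)] by exact: measurable_set1.
rewrite (_ : [set: R] = [set 0] `|` ~` [set 0]); last by rewrite setUv.
apply/measurable_funU => //; first exact: measurableC.
split; first exact: measurable_fun_set1.
apply: open_continuous_measurable_fun.
  by apply: closed_openC; exact: closed_eq.
move=> x; rewrite inE /= => x0; apply: inv_continuous; exact/eqP.
Qed.

Lemma measurable_min_weight (V : finType) (P : probability Omega R) (w : edge V -> {RV P >-> R}) (Q : graph V -> Prop) :
  measurable_fun setT (fun y => min_weight (fun e => w e y) Q).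
Proof.
have mw (G : graph V) : measurable_fun setT (fun y => weight (fun e => w e y) G).
  rewrite /weight; under eq_fun do rewrite big_mkcond/=.
  apply: measurable_sum => e; case: (e \in G.2); [exact: measurable_funPT|exact: measurable_cst].
have [[G0 QG0]|nQ] := pselect (exists G, Q G); last first.
  rewrite (_ : (fun y => _) = cst 0); first exact: measurable_cst.
  apply/funext => y; rewrite /min_weight (_ : [set weight _ G | G in _] = set0) ?inf0//.
  by rewrite -subset0 => z [G QG _]; apply: nQ; exists G.
apply: (measurability _ (RGenInftyO.measurableE R)) => _ [_ [c ->] <-]; rewrite setTI.
have -> : (fun y => min_weight (fun e => w e y) Q) @^-1` `]-oo, c[%classic =
    \bigcup_(G in [set G : {set V} * {set edge V} | Q G]) [set y | weight (fun e => w e y) G < c].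
  apply/seteqP; split=> y; rewrite /= in_itv /=.
    move=> lt; have [||_ [G QG <-] Gc] := @inf_lt _ [set weight (fun e => w e y) G | G in [set G | Q G]] c.
    - by exists (weight (fun e => w e y) G0); exists G0.
    - exact: lt.
    - by exists G.
  move=> [G QG Gc]; apply: le_lt_trans Gc; apply: ge_inf; last by exists G.
  exists (- \sum_(e : edge V) `|w e y|) => _ [G' _ <-].
  rewrite /weight lerNl -sumrN (le_trans (ler_norm _))// (le_trans (ler_norm_sum _ _ _))//.
  rewrite [leRHS](bigID (mem G'.2))/= -[leLHS]addr0; apply: lerD; last exact: sumr_ge0.
  by apply: ler_sum => e _; rewrite normrN.
apply: fin_bigcup_measurable; first exact: finite_finset.
move=> G _; rewrite -[X in measurable X]setTI.
by apply: (mw G measurableT [set z | z < c]); exact: measurable_lt.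
Qed.
End Measurability.

Section ExpectationTail.
Variables (R : realType) (d : measure_display) (Omega : measurableType d) (P : probability Omega R).

Lemma sum_half_pow (n : nat) : \sum_(0 <= j < n) (2 ^- j) <= 2 :> R.
Proof.
have -> : \sum_(0 <= j < n) (2 ^- j) = 2 - 2 * 2 ^- n :> R.
  elim: n => [|n IH]; first by rewrite big_nil expr0 invr1 mulr1 subrr.
  rewrite big_nat_recr//= IH exprS; field; by rewrite expf_neq0.
by rewrite gerBl mulr_ge0// invr_ge0 exprn_ge0.
Qed.

(** Above [u0] the variable is dominated by dyadic layers [2 ^+ j.+1 * u0] on the events
    [2 ^+ j * u0 <= Y], whose means form a geometric series with sum [4 * C / u0]. *)
Lemma expectation_le_tail (Y : Omega -> R) (a p u0 C : R) : measurable_fun setT Y -> 0 <= a -> 0 < u0 -> 0 <= p -> 0 <= C ->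
  (forall y, 0 <= Y y) -> (P [set y | (a < Y y)%R] <= p%:E)%E -> (forall u, u0 <= u -> (P [set y | (u <= Y y)%R] <= (C / u ^+ 2)%:E)%E) ->
  ('E_P[Y] <= (a + u0 * p + 4 * C / u0)%:E)%E.
Proof.
move=> mY a0 u00 p0 C0 Y0 hA hB.
have mge c : measurable [set y | c <= Y y].
  by rewrite -[X in measurable X]setTI; apply: (mY measurableT [set z | c <= z]); exact: measurable_ge.
have mA : measurable [set y | a < Y y].
  rewrite (_ : [set y | a < Y y] = ~` (Y @^-1` `]-oo, a]%classic)).
    by apply: measurableC; rewrite -[X in measurable X]setTI; apply: mY.
  by apply/seteqP; split=> y /=; rewrite in_itv/= ltNge => /negP.
set A := [set y | a < Y y] in hA mA.
pose B (j : nat) := [set y | 2 ^+ j * u0 <= Y y].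
pose f (j : nat) (y : Omega) : \bar R := ((2 ^+ j.+1 * u0)%:E * (\1_(B j) y)%:E)%E.
have f0 j y : (0 <= f j y)%E by rewrite /f -EFinM lee_fin mulr_ge0// mulr_ge0 ?exprn_ge0// ltW.
have mind (A' : set Omega) : measurable A' -> measurable_fun setT (fun y => (\1_A' y : R)%:E).
  by move=> mAA; apply/measurable_EFinP; exact: measurable_indic.
have mf j : measurable_fun setT (f j) by apply: emeasurable_funM => //; apply: mind; exact: mge.
have If j : (\int[P]_y f j y <= (2 * C / u0 * 2 ^- j)%:E)%E.
  rewrite ge0_integralZl_EFin//; last 2 first.
  - by apply: mind; exact: mge.
  - by rewrite mulr_ge0 ?exprn_ge0// ltW.
  rewrite integral_indic//; last exact: mge.
  rewrite setIT; have u1 : u0 <= 2 ^+ j * u0 by rewrite ler_peMl ?(ltW u00)// exprn_ege1// ler1n.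
  apply: (@le_trans _ _ ((2 ^+ j.+1 * u0)%:E * (C / (2 ^+ j * u0) ^+ 2)%:E)%E).
    by apply: lee_wpmul2l; [rewrite lee_fin mulr_ge0 ?exprn_ge0// ltW|exact: hB].
  rewrite -EFinM lee_fin exprS le_eqVlt; apply/orP; left; apply/eqP; field.
  by rewrite expf_neq0// gt_eqF.
rewrite unlock.
apply: (@le_trans _ _ (\int[P]_y (a%:E + u0%:E * (\1_A y)%:E + \sum_(j <oo) f j y))%E).
  apply: ge0_le_integral => //.
  - by move=> y _; rewrite lee_fin.
  - exact/measurable_EFinP.
  - apply: emeasurable_funD; last by apply: ge0_emeasurable_sum.
    by apply: emeasurable_funD => //; apply: emeasurable_funM => //; exact: mind.
  move=> y _; have s0 : (0 <= \sum_(j <oo) f j y)%E by apply: nneseries_ge0.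
  have [Ya|aY] := leP (Y y) a.
    apply: (@le_trans _ _ (a%:E + u0%:E * (\1_A y)%:E)%E); last by rewrite leeDl.
    by rewrite -EFinM -EFinD lee_fin (le_trans Ya)// lerDl mulr_ge0// ltW.
  have [Yu|uY] := leP (Y y) u0.
    apply: (@le_trans _ _ (a%:E + u0%:E * (\1_A y)%:E)%E); last by rewrite leeDl.
    by rewrite indicE mem_set// -EFinM -EFinD lee_fin mulr1 (le_trans Yu)// lerDr.
  apply: (@le_trans _ _ (\sum_(j <oo) f j y)%E); last first.
    by rewrite leeDr// -EFinM -EFinD lee_fin addr_ge0// mulr_ge0// ltW.
  have Yu1 : 1 <= Y y / u0 by rewrite ler_pdivlMr// mul1r ltW.
  have ex : exists j, Y y / u0 < 2 ^+ j.+1.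
    exists (Num.truncn (Y y / u0)).+1; apply: lt_le_trans (truncnS_gt _) _.
    by rewrite -natrX ler_nat ltnW// ltnW// ltn_expl.
  case: (ex_minnP ex) => j hj jmin.
  have Bj : 2 ^+ j <= Y y / u0.
    by case: j jmin {hj} => [|j] jmin; [rewrite expr0|rewrite leNgt; apply/negP => /jmin; rewrite ltnn].
  apply: (@le_trans _ _ (f j y)).
    rewrite /f indicE mem_set ?mule1 /B/= -?ler_pdivlMr// lee_fin.
    by rewrite -ler_pdivrMr// ltW.
  rewrite (@nneseriesD1 _ (fun j => f j y) j xpredT)//.
  apply: leeDl.
  by apply: nneseries_ge0.
rewrite ge0_integralD//; last 4 first.
- by move=> y _; rewrite -EFinM -EFinD lee_fin addr_ge0// mulr_ge0// ltW.
- by apply: emeasurable_funD => //; apply: emeasurable_funM => //; exact: mind.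
- by move=> y _; apply: nneseries_ge0.
- exact: ge0_emeasurable_sum.
rewrite EFinD; apply: leeD.
  rewrite ge0_integralD//; last 2 first.
  - by move=> y _; rewrite -EFinM lee_fin mulr_ge0// ltW.
  - by apply: emeasurable_funM => //; exact: mind.
  have -> : (\int[P]_y a%:E = a%:E)%E by have := expectation_cst P a; rewrite unlock.
  rewrite EFinD leeD2l//.
  rewrite ge0_integralZl_EFin//; [|exact: mind|exact: ltW].
  by rewrite integral_indic// setIT EFinM lee_wpmul2l// lee_fin ltW.
rewrite integral_nneseries//.
apply: lime_le; first by apply: is_cvg_nneseries => j _ _; apply: integral_ge0.
near=> n; apply: (@le_trans _ _ (\sum_(0 <= j < n) (2 * C / u0 * 2 ^- j)%:E)%E).
  by apply: lee_sum => j _; exact: If.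
rewrite sumEFin lee_fin -mulr_sumr.
have -> : 4 * C / u0 = 2 * C / u0 * 2 by ring.
by rewrite ler_wpM2l ?sum_half_pow// divr_ge0 ?(ltW u00)// mulr_ge0.
Unshelve. all: by end_near. Qed.
End ExpectationTail.


Lemma measurable_RV_lt (R : realType) d (Omega : measurableType d) (P : probability Omega R) (X : {RV P >-> R}) (t : R) :
  measurable [set x | X x < t].
Proof.
rewrite -[X in measurable X]setTI.
by apply: (@measurable_funPT _ _ _ _ X measurableT [set z | z < t]); exact: measurable_lt.
Qed.

Lemma measurable_RV_ge (R : realType) d (Omega : measurableType d) (P : probability Omega R) (X : {RV P >-> R}) (t : R) :
  measurable [set x | t <= X x].
Proof.
rewrite -[X in measurable X]setTI.
by apply: (@measurable_funPT _ _ _ _ X measurableT [set z | t <= z]); exact: measurable_ge.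
Qed.

Lemma same_law_lt (R : realType) (d0 : measure_display) (Omega0 : measurableType d0) (P0 : probability Omega0 R) (W : {RV P0 >-> R})
  d (Omega : measurableType d) (P : probability Omega R) (X : {RV P >-> R}) (t : R) :
  same_law X W -> P [set x | X x < t] = P0 [set x | W x < t].
Proof. by move=> /(_ [set z | z < t] (@measurable_lt _ _)). Qed.

Lemma same_law_ge (R : realType) (d0 : measure_display) (Omega0 : measurableType d0) (P0 : probability Omega0 R) (W : {RV P0 >-> R})
  d (Omega : measurableType d) (P : probability Omega R) (X : {RV P >-> R}) (t : R) :
  same_law X W -> P [set x | t <= X x] = P0 [set x | t <= W x].
Proof. by move=> /(_ [set z | t <= z] (@measurable_ge _ _)). Qed.

Lemma prob_fineK (R : realType) d (Omega : measurableType d) (P : probability Omega R) (A : set Omega) : measurable A ->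
  ((fine (P A))%:E = P A)%E.
Proof. by move=> mA; rewrite fineK// fin_num_measure. Qed.

Lemma density_bounds (R : realType) (d0 : measure_display) (Omega0 : measurableType d0) (P0 : probability Omega0 R) (W : {RV P0 >-> R}) :
  (forall x, 0 <= W x) -> density1_at0 W -> exists C1 t0 : R, [/\ 1 <= C1, 0 < t0,
  forall t : R, 0 <= t -> (P0 [set x | (W x < t)%R] <= (C1 * t)%:E)%E &
  forall t : R, 0 <= t <= t0 -> (P0 [set x | (t <= W x)%R] <= (expR (- (t / 2)))%:E)%E].
Proof.
move=> W_ge0 /eqoP hW; have half : 0 < 1 / 2 :> R by rewrite divr_gt0.
have := hW _ half; rewrite /= nearE => -[e /= e0 he].
pose t0 := e / 2; have t00 : 0 < t0 by rewrite divr_gt0.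
pose F t := fine (P0 [set x | (W x < t)%R]).
have FE t : P0 [set x | (W x < t)%R] = (F t)%:E by rewrite /F prob_fineK//; exact: measurable_RV_lt.
have hF (t : R) : 0 < t -> t <= t0 -> t / 2 <= F t /\ F t <= 3 / 2 * t.
  move=> tpos tt; have := he t; rewrite /ball/= sub0r normrN gtr0_norm// => /(_ _ tpos).
  have te : t < e by apply: le_lt_trans tt _; rewrite /t0; move: e0; clear; lra.
  by move=> /(_ te); rewrite -/(F t) ler_norml => /andP[]; move: tpos; clear; lra.
have F1 t : F t <= 1 by rewrite -lee_fin -FE probability_le1//; exact: measurable_RV_lt.
have F0 : F 0 = 0.
  by rewrite /F (_ : [set x | _] = set0) ?measure0// -subset0 => x /=; rewrite ltNge W_ge0.
(* Beyond [t0] the summand [t0^-1] makes the upper bound trivial, as [t / t0 >= 1]. *)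
exists (2 + t0^-1), t0; split=> //.
- have : 0 < t0^-1 by rewrite invr_gt0.
  by clear; lra.
- move=> t; rewrite le_eqVlt => /orP[/eqP<-|tpos]; first by rewrite mulr0 FE F0.
  rewrite FE lee_fin; have ti : 0 < t0^-1 by rewrite invr_gt0.
  have [tt|tt] := leP t t0.
    have [_ h] := hF t tpos tt; apply: le_trans h _; rewrite ler_pM2r//; move: ti; clear; lra.
  apply: le_trans (F1 t) _; rewrite mulrDl.
  have : 1 <= t0^-1 * t by rewrite mulrC ler_pdivlMr// mul1r ltW.
  by move: tpos; clear; lra.
- move=> t /andP[t_ge0 tt].
  have -> : [set x | t <= W x] = ~` [set x | W x < t] by apply/seteqP; split=> x /=; rewrite leNgt => /negP.
  rewrite probability_setC; last exact: measurable_RV_lt.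
  rewrite FE -EFinB lee_fin.
  have h2 : 1 - t / 2 <= expR (- (t / 2)) by have := expR_ge1Dx (- (t / 2)).
  apply: le_trans h2; rewrite lerB//.
  move: t_ge0; rewrite le_eqVlt => /orP[/eqP<-|tpos]; first by rewrite mul0r F0.
  by have [] := hF t tpos tt.
Qed.

Lemma markov_bound (R : realType) (d0 : measure_display) (Omega0 : measurableType d0) (P0 : probability Omega0 R) (W : {RV P0 >-> R}) :
  (forall x, 0 <= W x) -> ('E_P0[W] < +oo)%E ->
  forall s : R, 0 < s -> (P0 [set x | (s <= W x)%R] <= (fine 'E_P0[W] / s)%:E)%E.
Proof.
move=> W_ge0 Efin s s0; have E0 : (0 <= 'E_P0[W])%E by apply: expectation_ge0.
have EE : ('E_P0[W] = (fine 'E_P0[W])%:E)%E by rewrite fineK// ge0_fin_numE.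
rewrite EFinM -EE; set A := [set x | s <= W x].
have mA : measurable A by exact: measurable_RV_ge.
have : (s%:E * P0 A <= 'E_P0[W])%E.
  rewrite unlock -[A]setIT -(integral_indic P0 measurableT mA) -ge0_integralZl_EFin//; last 2 first.
  - by apply/measurable_EFinP; exact: measurable_indic.
  - exact: ltW.
  apply: ge0_le_integral => //.
  - by move=> x _; rewrite -EFinM lee_fin mulr_ge0// ltW.
  - by apply: emeasurable_funM => //; apply/measurable_EFinP; exact: measurable_indic.
  - by apply/measurable_EFinP; exact: measurable_funPT.
  move=> x _; rewrite -EFinM lee_fin indicE; case: (boolP (x \in A)) => xA.
    by rewrite mulr1; move: xA; rewrite inE.
  by rewrite mulr0.
rewrite -(prob_fineK P0 mA) {2}EE EE -!EFinM !lee_fin => h.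
by rewrite ler_pdivlMr// mulrC.
Qed.

Lemma near_add2 (Q : nat -> Prop) : (\forall n \near \oo, Q n) -> \forall n \near \oo, Q n.+2.
Proof. by move=> [N0 _ h]; exists N0 => // n /= hn; apply: h => /=; apply: leq_trans hn _; rewrite -addn2 leq_addr. Qed.

Lemma near_nat_ge (R : realType) (c : R) : \forall n \near \oo, c <= n%:R.
Proof.
exists (Num.truncn c).+1 => // n /= hn; apply: (@le_trans _ _ (Num.truncn c).+1%:R); last by rewrite ler_nat.
by apply/ltW/truncnS_gt.
Qed.

Section Convergence.
Variables (R : realType) (d : nat -> measure_display) (Omega : forall n, measurableType (d n)).
Variables (P : forall n, probability (Omega n) R) (Y : forall n, Omega n -> R).
Arguments Y : clear implicits.
Hypothesis mY : forall n, measurable_fun setT (Y n).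
Hypothesis Y_close : forall eps : R, 0 < eps -> exists C : R, \forall n \near \oo,
  small (P n) [set y | ~ (1 <= Y n y <= 1 + eps)] (C / n.+2%:R ^+ 10).

Lemma ratio_cvg_in_probability : cvg_in_probability P Y 1.
Proof.
move=> eps eps0; have e2 : 0 < eps / 2 by rewrite divr_gt0.
have [C hC] := Y_close e2.
have mE n : measurable [set y | eps <= `|Y n y - 1|].
  rewrite -[X in measurable X]setTI.
  have mf : measurable_fun setT (fun y => `|Y n y - 1|).
    by apply: measurableT_comp => //; apply: measurable_funB => //; exact: measurable_cst.
  by apply: (mf measurableT [set z | eps <= z]); exact: measurable_ge.
have le n : small (P n) [set y | ~ (1 <= Y n y <= 1 + eps / 2)] (C / n.+2%:R ^+ 10) ->
    (P n [set y | (eps <= `|Y n y - 1|)%R] <= (`|C| * n.+1%:R^-1)%:E)%E.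
  move=> h; apply: (@le_trans _ _ (C / n.+2%:R ^+ 10)%:E).
    apply: (prob_small (mE n)); apply: small_sub h => // y /= he /andP[y1 y2].
    move: he; rewrite ger0_norm ?subr_ge0//; apply/negP; rewrite -ltNge.
    by move: y2 eps0; clear; lra.
  rewrite lee_fin; apply: (@le_trans _ _ (`|C| / n.+2%:R ^+ 10)).
    by rewrite ler_wpM2r ?ler_norm// invr_ge0 exprn_ge0.
  rewrite ler_wpM2l// lef_pV2 ?posrE ?exprn_gt0// -natrX ler_nat (leq_trans (leqnSn _))//.
  by rewrite -{1}(expn1 n.+2) leq_exp2l.
apply: (@squeeze_cvge _ _ _ _ (fun=> 0%E) _ (fun n => (`|C| * n.+1%:R^-1)%:E)).
- by apply: filterS hC => n /le h; rewrite measure_ge0 h.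
- exact: cvg_cst.
- apply: cvg_EFin; first exact: nearW.
  rewrite -[0](mulr0 `|C|); apply: cvgM; first exact: cvg_cst.
  exact: cvg_harmonic.
Qed.

Hypothesis Y_ge1 : \forall n \near \oo, small (P n) [set y | Y n y < 1] 0.
Variable C2 : R.
Hypothesis Y_tail : \forall n \near \oo, forall u, 0 < u ->
  small (P n) [set y | 1 < Y n y /\ u <= Y n y] (C2 * n.+2%:R ^+ 8 / u ^+ 2).

Lemma expectation_ratio_le n (a C : R) : 1 < a -> small (P n) [set y | Y n y < 1] 0 -> 0 <= C -> 0 <= C2 ->
  small (P n) [set y | ~ (1 <= Y n y <= a)] (C / n.+2%:R ^+ 10) ->
  (forall u, 0 < u -> small (P n) [set y | 1 < Y n y /\ u <= Y n y] (C2 * n.+2%:R ^+ 8 / u ^+ 2)) ->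
  (1 <= 'E_(P n)[Y n] <= (a + (C + 4 * C2) / n.+2%:R)%:E)%E.
Proof.
move=> a1 s1 C0 C20 sa st.
(* Differs from [Y n] only on a null set and is nonnegative everywhere, as the tail estimate
   demands. *)
pose Y' y := Order.max (Y n y) 1.
have mY' : measurable_fun setT Y' by apply: measurable_maxr => //; exact: measurable_cst.
have EY : ('E_(P n)[Y n] = 'E_(P n)[Y'])%E.
  rewrite unlock; apply: ae_eq_integral => //; [exact/measurable_EFinP|exact/measurable_EFinP|].
  have [B mB [sB hB]] := s1; exists B; split=> //; first by apply/eqP; rewrite eq_le hB measure_ge0.
  move=> y /= h; apply: sB => /=; rewrite ltNge; apply/negP => le; apply: h => _.
  by rewrite /Y' max_l.
have N0 : 0 < n.+2%:R :> R by rewrite ltr0n.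
have N1 : 1 < n.+2%:R :> R by rewrite ltr1n.
rewrite EY; apply/andP; split.
  rewrite -(expectation_cst (P n) 1) unlock; apply: ge0_le_integral => //.
  - exact/measurable_EFinP/measurable_cst.
  - exact/measurable_EFinP.
  - by move=> y _; rewrite lee_fin /Y' le_max lexx orbT.
(* The power 9 lies between the failure probability of order [n ^- 10] and the tail factor [n ^+ 8]:
   both [u0 * n ^- 10] and [n ^+ 8 / u0] are of order [1 / n]. *)
pose u0 : R := n.+2%:R ^+ 9.
have u01 : 1 < u0 by rewrite exprn_egt1.
have u00 : 0 < u0 by apply: lt_trans u01.
have E1 : a + (C + 4 * C2) / n.+2%:R = a + u0 * (C / n.+2%:R ^+ 10) + 4 * (C2 * n.+2%:R ^+ 8) / u0.
  by rewrite /u0; field; rewrite gt_eqF.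
have mge c : measurable [set y | c <= Y' y].
  rewrite -[X in measurable X]setTI; apply: (mY' measurableT [set z | c <= z]); exact: measurable_ge.
rewrite E1; apply: expectation_le_tail => //.
- by apply/ltW; apply: lt_trans a1.
- by rewrite divr_ge0// exprn_ge0.
- by rewrite mulr_ge0// exprn_ge0.
- by move=> y; rewrite /Y' le_max ler01 orbT.
- apply: prob_small; last first.
    apply: small_sub sa => // y /=; rewrite /Y' lt_max => /orP[lt /andP[_]|lt _]; last by move: lt; rewrite ltNge (ltW a1).
    by rewrite leNgt lt.
  rewrite (_ : [set y | a < Y' y] = ~` (Y' @^-1` `]-oo, a]%classic)).
    by apply: measurableC; rewrite -[X in measurable X]setTI; apply: mY'.
  by apply/seteqP; split=> y /=; rewrite in_itv/= ltNge => /negP.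
- move=> u u0u; have u1 : 1 < u by apply: lt_le_trans u0u.
  apply: prob_small; first exact: mge.
  apply: small_sub (st u (lt_trans ltr01 u1)) => // y /=; rewrite /Y' le_max => /orP[le|le]; last by move: le; rewrite leNgt u1.
  by split=> //; apply: lt_le_trans le.
Qed.

Lemma ratio_cvg_in_expectation : cvg_in_expectation P Y 1.
Proof.
have C20 : 0 <= C2.
  have : \forall n \near \oo, 0 <= C2.
    apply: filterS Y_tail => n /(_ 1 ltr01) /small_ge0; rewrite expr1n divr1 pmulr_lge0// exprn_gt0//.
  by move=> [n _ /(_ n (leqnn n))].
have main (eps : R) : 0 < eps -> \forall n \near \oo, (1 <= 'E_(P n)[Y n] <= (1 + eps)%:E)%E.
  move=> eps0; have e2 : 0 < eps / 2 by rewrite divr_gt0.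
  have [C hC] := Y_close e2.
  near=> n.
  have hCn : small (P n) [set y | ~ (1 <= Y n y <= 1 + eps / 2)] (C / n.+2%:R ^+ 10) by near: n.
  have C0 : 0 <= C by move: (small_ge0 hCn); rewrite pmulr_lge0// invr_gt0 exprn_gt0.
  have a1 : 1 < 1 + eps / 2 by rewrite ltrDl.
  have /andP[-> h] : (1 <= 'E_(P n)[Y n] <= (1 + eps / 2 + (C + 4 * C2) / n.+2%:R)%:E)%E.
    by apply: expectation_ratio_le => //; near: n.
  apply: le_trans h _; rewrite lee_fin.
  have : (C + 4 * C2) / n.+2%:R <= eps / 2.
    rewrite ler_pdivrMr// -ler_pdivrMl//.
    apply: (@le_trans _ _ n%:R); last by rewrite ler_nat -addn2 leq_addr.
    near: n; exact: near_nat_ge.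
  by move=> h; rewrite [in leRHS](splitr eps) addrA lerD2l.
apply/fine_cvgP; split.
  apply: filterS (main 1 ltr01) => n /andP[h1 h2].
  by rewrite fin_numE; apply/andP; split; apply/eqP => E; move: h1 h2; rewrite E.
apply/cvgrPdist_le => eps eps0; apply: filterS (main eps eps0) => n /= /andP[h1 h2].
have : ('E_(P n)[Y n])%E \is a fin_num.
  by rewrite fin_numE; apply/andP; split; apply/eqP => E; move: h1 h2; rewrite E.
move: h1 h2; case: ('E_(P n)[Y n])%E => [r| |]//=; rewrite !lee_fin => h1 h2 _.
by rewrite distrC ger0_norm ?subr_ge0// lerBlDl.
Unshelve. all: by end_near. Qed.
End Convergence.

(** Rounding the binary logarithm of [ln x] up to an integer costs at most one level, the 1 in the
    hypothesis [K%:R + Delta <= k%:R + 1] of the depth estimates. *)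
Lemma ln_ln_hops (R : realType) (x : R) : expR 1 <= x ->
  exists K : nat, ln x <= 2 ^+ K /\ K%:R <= ln (ln x) / ln 2 + 1 :> R.
Proof.
move=> xe; have x0 : 0 < x by apply: lt_le_trans xe; apply: expR_gt0.
have L1 : 1 <= ln x by rewrite -ler_expR lnK.
have L0 : 0 < ln x by apply: lt_le_trans L1.
have [K /andP[h1 h2]] := pow2_between L1; exists K; split=> //.
have l2 : 0 < ln 2 :> R by apply: ln_gt0; rewrite ltr1n.
have : ln (2 ^+ K) <= ln (2 * ln x) by rewrite ler_ln ?posrE ?exprn_gt0 ?mulr_gt0.
rewrite lnXn// lnM ?posrE// -[ln 2 *+ K]mulr_natl -ler_pdivlMr// => h; apply: le_trans h _.
by rewrite mulrDl divff ?gt_eqF// addrC.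
Qed.

Lemma edge_of_ord (n : nat) : edge 'I_n.+2.
Proof. by exists [set ord0; ord_max]%SET; rewrite cards2. Qed.

(** * The sequence of weighted complete graphs *)

Section Final.
Variables (R : realType) (d0 : measure_display) (Omega0 : measurableType d0) (P0 : probability Omega0 R).
Variable W : {RV P0 >-> R}.
Hypothesis W_ge0 : forall x, 0 <= W x.
Hypothesis W_density : density1_at0 W.
Variables (d : nat -> measure_display) (Omega : forall n, measurableType (d n)).
Variable P : forall n, probability (Omega n) R.
Variable w : forall n, edge 'I_n.+2 -> {RV (P n) >-> R}.
Arguments w : clear implicits.
Hypothesis w_indep : forall n, mutually_independent (w n).
Hypothesis w_law : forall n e, same_law (w n e) W.
Variables m k : nat -> nat.
Hypothesis m_bounds : forall n, (2 <= n)%N -> (2 <= m n <= n)%N.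
Variable T : forall n, {set 'I_n.+2}.
Arguments T : clear implicits.
Hypothesis T_card : forall n, #|T n| = m n.+2.
Variable Delta : nat -> R.
Hypothesis Delta_omega : Delta n / (n%:R / ((m n)%:R * ln (expR 1 * n%:R / (m n)%:R))) @[n --> \oo] --> +oo.
Hypothesis k_large : \forall n \near \oo, ln (ln n%:R) / ln 2 + Delta n <= (k n)%:R.
Variable r : forall n, 'I_n.+2.
Arguments r : clear implicits.
Hypothesis r_many : forall M : nat, \forall n \near \oo, r n \in T n \/ (M <= m n.+2)%N.

Let S n (y : Omega n) : R := steiner_min (fun e => w n e y) (T n).
Let D n (y : Omega n) : R := steiner_depth_min (fun e => w n e y) (T n) (r n) (k n.+2).
Arguments S : clear implicits.
Arguments D : clear implicits.

Lemma T_ge2 n : (2 <= #|T n|)%N.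
Proof. by rewrite T_card; have /andP[] := m_bounds (isT : (2 <= n.+2)%N). Qed.

Lemma Delta_large (B : R) : \forall n \near \oo,
  B * (n.+2%:R / phi n.+2%:R (m n.+2)%:R) <= Delta n.+2.
Proof.
have /cvgryPge/(_ B) h := Delta_omega; apply: filterS (near_add2 h) => n.
have /andP[m2 mn] := m_bounds (isT : (2 <= n.+2)%N).
rewrite ler_pdivlMr//; apply: divr_gt0; first by rewrite ltr0n.
apply: phi_gt0; first by rewrite ltr0n (leq_trans _ m2).
by rewrite ler_nat.
Qed.

Lemma scale_ge1 n : 1 <= n.+2%:R / phi n.+2%:R (m n.+2)%:R :> R.
Proof.
have /andP[m2 mn] := m_bounds (isT : (2 <= n.+2)%N).
have m0 : 0 < (m n.+2)%:R :> R by rewrite ltr0n (leq_trans _ m2).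
have mnR : (m n.+2)%:R <= n.+2%:R :> R by rewrite ler_nat.
rewrite ler_pdivlMr; last exact: phi_gt0.
by rewrite mul1r; apply: phi_le => //; rewrite ltr0n.
Qed.

Lemma k_ge4 : \forall n \near \oo, (4 <= k n.+2)%N.
Proof.
near=> n; rewrite -(ler_nat R).
have h1 : ln (ln n.+2%:R) / ln 2 + Delta n.+2 <= (k n.+2)%:R.
  by near: n; exact: (near_add2 k_large).
have h2 : 4 * (n.+2%:R / phi n.+2%:R (m n.+2)%:R) <= Delta n.+2 by near: n; exact: Delta_large.
have h3 : expR 1 <= n.+2%:R :> R.
  by near: n; exact: (near_add2 (near_nat_ge (expR 1))).
have L1 : 1 <= ln n.+2%:R :> R by rewrite -ler_expR lnK// posrE ltr0n.
have l0 : 0 <= ln (ln n.+2%:R) / ln 2 :> R by rewrite divr_ge0// ln_ge0// ler1n.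
have := scale_ge1 n; move: h1 h2 l0; move: (n.+2%:R / _) (ln _ / ln 2) => x z h1 h2 z0 x1.
apply: le_trans h1; apply: (@le_trans _ _ (4 * x)); first by rewrite ler_pMr.
by apply: le_trans h2 _; rewrite lerDr.
Unshelve. all: by end_near. Qed.

Lemma depth_ratio_close (eps : R) : 0 < eps -> exists C : R, \forall n \near \oo,
  small (P n) [set y | ~ (0 < S n y /\ D n y <= (1 + eps) * S n y)] (C / n.+2%:R ^+ 10).
Proof.
move=> eps0; have [C1 [t0 [C11 t00 up lo]]] := density_bounds W_ge0 W_density.
have [B [n0 [C [M [B0 main]]]]] := depth_ratio_whp C11 t00 eps0.
exists C; near=> n.
have cV : #|'I_n.+2| = n.+2 by rewrite card_ord.
have h3 : expR 1 <= n.+2%:R :> R by near: n; exact: (near_add2 (near_nat_ge (expR 1))).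
have [K [K1 K2]] := ln_ln_hops h3.
rewrite -[X in X%:R ^+ 10]cV.
have := main _ _ (P n) _ (edge_of_ord n) (w n) (@w_indep n) _ _ (T n) (r n) (k n.+2) K (Delta n.+2).
apply.
- by move=> e t t_ge0; rewrite (same_law_lt t (w_law e)); exact: up.
- by move=> e t tt; rewrite (same_law_ge t (w_law e)); exact: lo.
- exact: T_ge2.
- by rewrite cV; near: n; exact: (near_add2 (near_nat_ge n0)).
- by rewrite cV.
- have h1 : ln (ln n.+2%:R) / ln 2 + Delta n.+2 <= (k n.+2)%:R.
    by near: n; exact: (near_add2 k_large).
  apply: (@le_trans _ _ (ln (ln n.+2%:R) / ln 2 + 1 + Delta n.+2)); first by rewrite lerD2r.
  by rewrite addrAC lerD2r.
- by rewrite cV T_card; near: n; exact: Delta_large.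
- by rewrite T_card; near: n; exact: r_many.
Unshelve. all: by end_near. Qed.

Lemma depth_ratio_tail : ('E_P0[W] < +oo)%E -> exists C : R, \forall n \near \oo, forall u, 0 < u ->
  small (P n) [set y | 1 < D n y / S n y /\ u <= D n y / S n y] (C * n.+2%:R ^+ 8 / u ^+ 2).
Proof.
move=> Efin; have [C1 [t0 [C11 t00 up lo]]] := density_bounds W_ge0 W_density.
have C10 : 0 < C1 by apply: lt_le_trans C11.
have tail := markov_bound W_ge0 Efin.
have EW0 : 0 <= fine 'E_P0[W] by apply: fine_ge0; apply: expectation_ge0.
exists (256 * fine 'E_P0[W] ^+ 4 + 16 * C1 ^+ 4); near=> n => u u0.
have cV : #|'I_n.+2| = n.+2 by rewrite card_ord.
rewrite -[X in X%:R ^+ 8]cV.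
have := @small_ratio_large _ _ _ (P n) _ (edge_of_ord n) (w n) (@w_indep n) _ _ C10 EW0 _ _ (T n) (r n) (k n.+2) u.
apply => //.
- by move=> e t t_ge0; rewrite (same_law_lt t (w_law e)); exact: up.
- by move=> e s s0; rewrite (same_law_ge s (w_law e)); exact: tail.
- rewrite cV; near: n; apply: (near_add2 (Q := fun n => (6 <= n)%N)); exact: nbhs_infty_ge.
- by near: n; exact: k_ge4.
- exact: T_ge2.
- by rewrite T_card; near: n; exact: r_many.
Unshelve. all: by end_near. Qed.

Lemma small_nonpos_w n : small (P n) [set y | exists e, w n e y <= 0] 0.
Proof.
have [C1 [t0 [C11 t00 up lo]]] := density_bounds W_ge0 W_density.
apply: (small_nonpos (C1 := C1)); last exact: lt_le_trans C11.
by move=> e t t_ge0; rewrite (same_law_lt t (w_law e)); exact: up.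
Qed.

(** Only the sandwich between [S] and [D] on nonnegative weights is used, so the depth and the
    diameter minimum are treated at once, the latter with a root of one's choice. *)
Lemma ratio_cvg (X : forall n, Omega n -> R) : (forall n, measurable_fun setT (X n)) ->
  (forall n y, (0 < k n.+2)%N -> (forall e, 0 <= w n e y) -> S n y <= X n y <= D n y) ->
  cvg_in_probability P (fun n x => X n x / S n x) 1 /\
    (('E_P0[W] < +oo)%E -> cvg_in_expectation P (fun n x => X n x / S n x) 1).
Proof.
move=> mX hX.
have mY n : measurable_fun setT (fun y => X n y / S n y).
  apply: measurable_funM; first exact: mX.
  by apply: measurableT_comp; [exact: measurable_inv|exact: measurable_min_weight].
have good n y : (0 < k n.+2)%N -> ~ (exists e, w n e y <= 0) ->
    [/\ 0 < S n y, 1 <= X n y / S n y & X n y / S n y <= D n y / S n y].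
  move=> k0 ne; have wpos e : 0 < w n e y by rewrite ltNge; apply/negP => le; apply: ne; exists e.
  have S0 : 0 < S n y by apply: (steiner_min_gt0 (edge_of_ord n) wpos (T_ge2 n)).
  have /andP[h1 h2] := hX n y k0 (fun e => ltW (wpos e)).
  by split=> //; [rewrite ler_pdivlMr// mul1r|rewrite ler_pM2r// invr_gt0].
have k0 : \forall n \near \oo, (0 < k n.+2)%N by apply: filterS k_ge4 => n; apply: leq_trans.
have close (eps : R) : 0 < eps -> exists C : R, \forall n \near \oo,
    small (P n) [set y | ~ (1 <= X n y / S n y <= 1 + eps)] (C / n.+2%:R ^+ 10).
  move=> eps0; have [C hC] := depth_ratio_close eps0; exists C; apply: filterS2 k0 hC => n kn h.
  apply: small_sub (smallU (small_nonpos_w n) h); last by rewrite add0r.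
  move=> y /= ny; apply: contrapT => /not_orP[g1 /contrapT[S0 g2]]; apply: ny.
  have [_ -> h2] := good n y kn g1; rewrite /= (le_trans h2)//.
  by rewrite ler_pdivrMr.
split; first exact: ratio_cvg_in_probability.
move=> Efin; have [C2 tail] := depth_ratio_tail Efin.
apply: (@ratio_cvg_in_expectation _ _ _ _ _ mY close _ C2).
  apply: filterS k0 => n kn; apply: small_sub (small_nonpos_w n) => // y /= lt; apply: contrapT => g1.
  by have [_ h _] := good n y kn g1; move: lt; rewrite ltNge h.
apply: filterS2 k0 tail => n kn h u u0.
apply: small_sub (smallU (small_nonpos_w n) (h u u0)); last by rewrite add0r.
move=> y /= [h1 h2]; apply: contrapT => /not_orP[g1 g2]; apply: g2.
have [_ _ h3] := good n y kn g1.
by split; [exact: lt_le_trans h3|exact: le_trans h3].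
Qed.
End Final.
(* The n-th graph is the complete graph K_(n+2), and its data (weights,
   terminals, root) carry the index n; m and k are functions of the number of
   vertices.  If the root is not a terminal, then the depth-constrained tree
   has to contain m+1 prescribed vertices, so the claim about its weight is
   made for roots that are terminals unless m is large (hypothesis on r). *)
Theorem theorem1p5 (R : realType)
  (d0 : measure_display) (Omega0 : measurableType d0)
  (P0 : probability Omega0 R) (W : {RV P0 >-> R})
  (W_ge0 : forall x, 0 <= W x)
  (W_density : density1_at0 W)
  (d : nat -> measure_display) (Omega : forall n, measurableType (d n))
  (P : forall n, probability (Omega n) R)
  (w : forall n, edge 'I_n.+2 -> {RV (P n) >-> R})
  (w_indep : forall n, mutually_independent (w n))
  (w_law : forall n e, same_law (w n e) W)
  (m k : nat -> nat)
  (m_bounds : forall n, (2 <= n)%N -> (2 <= m n <= n)%N)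
  (T : forall n, {set 'I_n.+2}) (T_card : forall n, #|T n| = m n.+2)
  (r : forall n, 'I_n.+2)
  (Delta : nat -> R)
  (Delta_omega :
    Delta n / (n%:R / ((m n)%:R * ln (expR 1 * n%:R / (m n)%:R)))
      @[n --> \oo] --> +oo)
  (k_large : \forall n \near \oo,
    ln (ln n%:R) / ln 2 + Delta n <= (k n)%:R) :
  let S n (x : Omega n) : R := steiner_min (fun e => w n e x) (T n) in
  let D n (x : Omega n) : R :=
    steiner_depth_min (fun e => w n e x) (T n) (r n) (k n.+2) in
  let E n (x : Omega n) : R :=
    steiner_diam_min (fun e => w n e x) (T n) (2 * k n.+2) in
  ((forall M : nat, \forall n \near \oo, r n \notin T n -> (M <= m n.+2)%N) ->
    cvg_in_probability P (fun n x => D n x / S n x) 1 /\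
    (('E_P0[W] < +oo)%E ->
      cvg_in_expectation P (fun n x => D n x / S n x) 1)) /\
  (cvg_in_probability P (fun n x => E n x / S n x) 1 /\
    (('E_P0[W] < +oo)%E ->
      cvg_in_expectation P (fun n x => E n x / S n x) 1)).
Proof.
move=> S D E.
have mD n (r0 : 'I_n.+2) : measurable_fun setT (fun y => steiner_depth_min (fun e => w n e y) (T n) r0 (k n.+2)).
  exact: measurable_min_weight.
have le n (r0 : 'I_n.+2) y : (0 < k n.+2)%N -> (forall e, 0 <= w n e y) ->
    steiner_min (fun e => w n e y) (T n) <= steiner_depth_min (fun e => w n e y) (T n) r0 (k n.+2).
  by move=> k0 w0; apply: (steiner_min_le_depth (edge_of_ord n)).
split.
  move=> hr; apply: (ratio_cvg W_ge0 W_density w_indep w_law m_bounds T_card Delta_omega k_large (r := r)).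
  - move=> M; apply: filterS (hr M) => n h; have [rT|rT] := boolP (r n \in T n); [by left|by right; exact: h].
  - by move=> n; exact: mD.
  - by move=> n y k0 w0; rewrite le/=.
have /(_ _)/cid ex n : exists t, t \in T n.
  apply/card_gt0P; rewrite T_card; have /andP[m2 _] := m_bounds n.+2 isT; exact: leq_trans m2.
pose r' n := sval (ex n); have r'T n : r' n \in T n by exact: (svalP (ex n)).
apply: (ratio_cvg W_ge0 W_density w_indep w_law m_bounds T_card Delta_omega k_large (r := r')).
- by move=> M; apply: nearW => n; left; exact: r'T.
- by move=> n; exact: measurable_min_weight.
- move=> n y k0 w0; apply/andP; split.
    exact: (steiner_min_le_diam (edge_of_ord n)).
  exact: (steiner_diam_le_depth (edge_of_ord n)).
Qed.
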